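(* Let $\Psi$ be an Orlicz function satisfying condition $\Delta^2$, and let $\phi\colon\mathbb{D}\to\mathbb{D}$ be an analytic self-map. Assume that $C_\phi$ is compact on $H^\Psi$. Then the pullback measure $m_\phi$ is an $\alpha$-Carleson measure for every $\alpha\ge 1$, and hence $C_\phi\colon H^2\to H^2$ belongs to the Schatten class $S_p$ for every $p>0$.
   Context: $\mathbb{D}$ is the open unit disk of $\mathbb{C}$, $\mathbb{T}=\partial\mathbb{D}$, and $m$ is normalized Lebesgue measure on $\mathbb{T}$. $H^p$ denotes the classical Hardy space on $\mathbb{D}$. For an analytic self-map $\phi\colon\mathbb{D}\to\mathbb{D}$, $C_\phi$ is the composition operator $f\mapsto f\circ\phi$. $S_p$ ($p>0$) is the Schatten class of compact operators on the Hilbert space $H^2$ whose singular numbers are in $\ell_p$. An Orlicz function is a non-decreasing convex function $\Psi\colon[0,\infty]\to[0,\infty]$ with $\Psi(0)=0$, $\Psi(\infty)=\infty$, which is moreover assumed to be continuous at $0$, strictly convex on $[0,\infty)$ (hence finite and increasing there), and such that $\Psi(x)/x\to\infty$ as $x\to\infty$. $L^\Psi(\mathbb{T})$ is the space of (classes of) measurable $f\colon\mathbb{T}\to\mathbb{C}$ for which there is $C>0$ with $\int_{\mathbb{T}}\Psi(|f|/C)\,dm<+\infty$; the Luxemburg norm $\|f\|_\Psi$ is the infimum of the constants $C>0$ such that this integral is $\le 1$. The Hardy-Orlicz space $H^\Psi$ is the space of all $f\in H^1$ whose boundary function $f^*$ lies in $L^\Psi(\mathbb{T})$, normed by $\|f^*\|_\Psi$.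 Every composition operator is bounded on every $H^p$ and on every $H^\Psi$. $\Psi$ satisfies condition $\Delta^2$ if, for some $A>1$, one has $[\Psi(x)]^2\le\Psi(Ax)$ for all $x$ large enough. For $\xi\in\mathbb{T}$ and $0<h<1$, the Carleson window is $W(\xi,h)=\{z\in\mathbb{D}:|z|\ge 1-h,\ |\arg(z\bar\xi)|\le h\}$. For a finite positive measure $\mu$ on $\mathbb{D}$, $\rho_\mu(h)=\sup_{\xi\in\mathbb{T}}\mu[W(\xi,h)]$. For $\alpha\ge1$, $\mu$ is an $\alpha$-Carleson measure if there is a constant $C$ with $\rho_\mu(h)\le C h^\alpha$ for all $0<h<1$. The pullback measure of $\phi$ is defined on Borel sets $B\subseteq\mathbb{D}$ by $m_\phi(B)=m(\{\xi\in\mathbb{T}:\phi^*(\xi)\in B\})$, where $\phi^*$ is the boundary values function of $\phi$. (Compactness of $C_\phi$ on $H^\Psi$ implies compactness on $H^2$, hence $|\phi^*|<1$ a.e. on $\mathbb{T}$.) *)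

(* Defs.v *)
From mathcomp Require Import all_boot all_order all_algebra.
From mathcomp Require Import all_classical all_reals all_analysis.
From mathcomp Require Export complex.
Import Order.TTheory GRing.Theory Num.Theory numFieldNormedType.Exports.

Set Implicit Arguments.
Unset Strict Implicit.
Unset Printing Implicit Defensive.

Local Open Scope classical_set_scope.
Local Open Scope ring_scope.

(* The library puts the topology of a normed field on the regular algebra
   R[i]^o (convertible to R[i]); R[i] itself carries no topology. *)
Notation cplx R := ((R[i])^o).

Section Disk.
Context {R : realType}.
Local Notation C := (cplx R).
Implicit Types (f g u : C -> C) (z xi : C) (r h t : R).

Definition modulus z : R := Normc.normc z.

Definition disk : set C := [set z | modulus z < 1].
Definition circle : set C := [set xi | modulus xi = 1].

(* Functions on the disk are represented by total functions on the plane.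
   All definitions below only look at their values in the disk. *)
Definition analytic_on_disk f : Prop := forall z, disk z -> derivable f z 1.

Definition analytic_self_map f : Prop :=
  analytic_on_disk f /\ forall z, disk z -> disk (f z).

Definition cis t : C := Complex (cos t) (sin t).

(* principal argument, with values in ]-pi, pi] for z != 0 *)
Definition carg z : R :=
  if 0 <= complex.Im z then acos (complex.Re z / modulus z)
  else - acos (complex.Re z / modulus z).

Definition angles : set R := `[0, 2 * pi[.

(* normalized Lebesgue measure on the circle, and integration against it,
   through the bijection cis : [0, 2 pi[ -> circle *)
Definition circle_measure (E : set C) : \bar R :=
  (((2 * pi)^-1)%R%:E * lebesgue_measure (angles `&` (cis @^-1` E)))%E.

Definition circle_integral (u : C -> \bar R) : \bar R :=
  (((2 * pi)^-1)%R%:E * \int[lebesgue_measure]_(t in angles) u (cis t))%E.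

Definition circle_integralC u : C :=
  real_complex R (2 * pi)^-1 *
  Complex (\int[lebesgue_measure]_(t in angles) complex.Re (u (cis t)))
          (\int[lebesgue_measure]_(t in angles) complex.Im (u (cis t))).

Definition circle_measurable u : Prop :=
  measurable_fun angles (fun t => complex.Re (u (cis t))) /\
  measurable_fun angles (fun t => complex.Im (u (cis t))).

(* f^*(xi) is the radial limit of f at xi. When this limit does not exist, lim
   is a fixed default value; for f in H^1 this concerns only a null set. *)
Definition boundary_value f xi : C :=
  lim (f (real_complex R r * xi) @[r --> (1 : R)^'-]).

Definition pullback_measure (phi : C -> C) (B : set C) : \bar R :=
  circle_measure (circle `&` (boundary_value phi @^-1` B)).

Definition carleson_window xi h : set C :=
  [set z | [/\ disk z, 1 - h <= modulus z & `|carg (z * conjc xi)| <= h]].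

Definition carleson_rho (mu : set C -> \bar R) h : \bar R :=
  ereal_sup [set mu (carleson_window xi h) | xi in circle].

Definition alpha_carleson (alpha : R) (mu : set C -> \bar R) : Prop :=
  exists K : R, forall h, 0 < h < 1 ->
    (carleson_rho mu h <= (K * h `^ alpha)%:E)%E.

Definition hardy_norm (p : R) f : \bar R :=
  poweR (ereal_sup [set circle_integral
                          (fun xi => (modulus (f (real_complex R r * xi)) `^ p)%:E)
                   | r in [set r : R | 0 <= r < 1]])
        p^-1.

Definition hardy_space (p : R) : set (C -> C) :=
  [set f | analytic_on_disk f /\ (hardy_norm p f < +oo)%E].

Definition composition_operator (phi f : C -> C) : C -> C :=
  fun z => f (phi z).

End Disk.

Section Orlicz.
Context {R : realType}.
Local Notation C := (cplx R).
Implicit Types (Psi : \bar R -> \bar R) (f g : C -> C).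
Local Open Scope ereal_scope.

(* Psi is only considered on [0, +oo]. *)
Record orlicz_function Psi : Prop := OrliczFunction {
  orlicz_ge0 : forall x, 0 <= x -> 0 <= Psi x;
  orlicz_nondecreasing : forall x y, 0 <= x -> x <= y -> Psi x <= Psi y;
  orlicz_convex : forall (x y : \bar R) (t : R), 0 <= x -> 0 <= y ->
    (0 <= t <= 1)%R ->
    Psi (t%:E * x + (1 - t)%R%:E * y) <= t%:E * Psi x + (1 - t)%R%:E * Psi y;
  orlicz0 : Psi 0 = 0;
  orlicz_pinfty : Psi +oo = +oo;
  orlicz_continuous0 : Psi x%:E @[x --> (0%R : R)^'+] --> Psi 0;
  orlicz_strictly_convex : forall x y t : R, (0 <= x)%R -> (0 <= y)%R ->
    x != y -> (0 < t < 1)%R ->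
    Psi (t * x + (1 - t) * y)%R%:E < t%:E * Psi x%:E + (1 - t)%R%:E * Psi y%:E;
  orlicz_superlinear : Psi x%:E * (x^-1)%R%:E @[x --> (+oo%R : set_system R)] --> +oo
}.

Definition Delta2_up Psi : Prop :=
  exists A : R, (1 < A)%R /\
    \forall x \near (+oo%R : set_system R), Psi x%:E ^+ 2 <= Psi (A * x)%R%:E.

Definition orlicz_modular Psi g (K : R) : \bar R :=
  circle_integral (fun xi => Psi (modulus (g xi) / K)%R%:E).

Definition orlicz_space Psi : set (C -> C) :=
  [set g | circle_measurable g /\
           exists K : R, (0 < K)%R /\ orlicz_modular Psi g K < +oo].

Definition luxemburg_norm Psi g : \bar R :=
  ereal_inf [set K%:E | K in
    [set K : R | (0 < K)%R /\ orlicz_modular Psi g K <= 1]].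

Definition hardy_orlicz_space Psi : set (C -> C) :=
  [set f | hardy_space 1 f /\ orlicz_space Psi (boundary_value f)].

Definition hardy_orlicz_norm Psi f : \bar R :=
  luxemburg_norm Psi (boundary_value f).

End Orlicz.

Section Operators.
Context {R : realType}.
Local Notation C := (cplx R).
Implicit Types (X : set (C -> C)) (N : (C -> C) -> \bar R)
  (T : (C -> C) -> (C -> C)) (f g : C -> C).

(* T is a compact operator on the normed space X of functions with norm N: it
   is linear from X to X and maps the unit ball to a relatively compact set. *)
Definition compact_operator X N T : Prop :=
  [/\ forall f, X f -> X (T f),
      forall (a : C) f g, X f -> X g ->
        T (fun z => a * f z + g z) = (fun z => a * T f z + T g z) &
      forall F : nat -> C -> C, (forall n, X (F n) /\ (N (F n) <= 1)%E) ->
        exists2 k : nat -> nat, {homo k : i j / (i < j)%N} &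
        exists2 g, X g &
          N (fun z => T (F (k n)) z - g z) @[n --> \oo] --> 0%E].

(* inner product of H^2 *)
Definition hardy_inner f g : C :=
  lim (circle_integralC (fun xi =>
         f (real_complex R r * xi) * conjc (g (real_complex R r * xi)))
       @[r --> (1 : R)^'-]).

(* s lists the singular numbers of T on H^2, i.e. the eigenvalues of
   (T^* T)^(1/2) in nonincreasing order with multiplicity: (e n) is an
   orthonormal sequence with T^* T (e n) = (s n)^2 e n, exhausting the nonzero
   spectrum in the sense that T vanishes on its orthogonal complement. The
   eigenvector equation is tested against all g in H^2, <T^* T e, g> being
   <T e, T g>. *)
Definition singular_numbers T (s : nat -> R) : Prop :=
  [/\ forall n, 0 <= s n,
      forall n, s n.+1 <= s n &
      exists e : nat -> C -> C,
      [/\ forall n, hardy_space 2 (e n),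
          forall i j, hardy_inner (e i) (e j) = (i == j)%:R,
          forall n g, hardy_space 2 g ->
            hardy_inner (T (e n)) (T g) =
            real_complex R (s n ^+ 2) * hardy_inner (e n) g &
          forall f, hardy_space 2 f -> (forall n, hardy_inner f (e n) = 0) ->
            forall z, disk z -> T f z = 0]].

Definition schatten_class (p : R) T : Prop :=
  compact_operator (hardy_space 2) (hardy_norm 2) T /\
  exists s : nat -> R, singular_numbers T s /\
    (\sum_(0 <= n <oo) (s n `^ p)%:E < +oo)%E.

End Operators.

(* Main.v *)
(** If C_phi is compact on H^Psi, apply it to peak functions F_n of height x_n at
points xi_n, where Psi(x_n) is about 1/h_n; they lie in the unit ball of H^Psi.
Along a subsequence F_n o phi converges to some g.  For m fixed and n large,
F_n - F_m is of order x_n where phi* is within 2 h_n of xi_n, so F_n o phi - g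
or F_m o phi - g is of order x_n there, while both have small norm: by Markov's
inequality this set has measure at most about 1/Psi(A x_n) for A as large as we
please, and condition Delta^2 turns this into any power of h_n.

Covering the circle by small windows, |phi*| > 1 - h has measure O(h^alpha) for
every alpha, so that the square beta_n of the H^2 norm of phi^n decreases faster
than any power of n.  A function of H^2 whose first N coefficients vanish is
mapped by C_phi to one of square norm at most (beta_N + beta_(N+1) + ...) times
its own.  Hence C_phi maps weakly convergent sequences to convergent ones, its
singular numbers are found by successive maximization, and a dimension count
shows s_n^2 <= beta_n + beta_(n+1) + ..., so that (s_n) is in every l^p. *)
Require Import Defs.
From mathcomp Require Import all_boot all_order all_algebra.
From mathcomp Require Import all_classical all_reals all_analysis.
From mathcomp Require Import measurable_realfun.
From mathcomp Require Import ring lra zify.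
Import Order.TTheory GRing.Theory Num.Theory numFieldNormedType.Exports.

Set Implicit Arguments.
Unset Strict Implicit.
Unset Printing Implicit Defensive.

Local Open Scope classical_set_scope.
Local Open Scope ring_scope.

(** * Holomorphic functions on the disk *)

Section ComplexBasics.
Context {R : realType}.
Local Notation C := (cplx R).
Implicit Types (z w : C) (r t : R).

(** The limit [g] in H^Psi is never identified: measuring two peaks against the same [g] avoids it.
    What must be known is that, almost everywhere, the boundary value of [F_n o phi - g] is the
    difference of the boundary values. Of [g] only membership in H^1 is usable, so this calls for
    Fatou's theorem in H^1. It is obtained without factorization: [|g| <= Re U] for some holomorphic
    [U], and [exp(-U)] and [g exp(-U)] are bounded. The power of [h] comes from iterating Delta^2:
    [j] uses multiply the argument of [Psi] by [A^j] and raise the bound [1/h] to the power [2^j].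
    The factor [A^j] is paid for by norms of [F_n o phi - g] of order [A^-j]; boundedness alone
    would not provide them. On H^2 everything is read off Taylor coefficients. Weak limits are
    coefficientwise limits along one free ultrafilter, and the eigenvector equation follows from
    maximality alone, without constructing an adjoint. *)

Definition rc (r : R) : C := Complex r 0.

Lemma C_eq z w : complex.Re z = complex.Re w -> complex.Im z = complex.Im w -> z = w.
Proof. by case: z w => [a b] [c d] /= -> ->. Qed.

Lemma cReD z w : complex.Re (z + w) = complex.Re z + complex.Re w.
Proof. by case: z w => [a b] [c d]. Qed.
Lemma cImD z w : complex.Im (z + w) = complex.Im z + complex.Im w.
Proof. by case: z w => [a b] [c d]. Qed.
Lemma cReN z : complex.Re (- z) = - complex.Re z.
Proof. by case: z. Qed.
Lemma cImN z : complex.Im (- z) = - complex.Im z.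
Proof. by case: z. Qed.
Lemma cReB z w : complex.Re (z - w) = complex.Re z - complex.Re w.
Proof. by rewrite cReD cReN. Qed.
Lemma cImB z w : complex.Im (z - w) = complex.Im z - complex.Im w.
Proof. by rewrite cImD cImN. Qed.
Lemma cReM z w : complex.Re (z * w) =
  complex.Re z * complex.Re w - complex.Im z * complex.Im w.
Proof. by case: z w => [a b] [c d]. Qed.
Lemma cImM z w : complex.Im (z * w) =
  complex.Re z * complex.Im w + complex.Im z * complex.Re w.
Proof. by case: z w => [a b] [c d]. Qed.
Lemma cReJ z : complex.Re (conjc z) = complex.Re z. Proof. by case: z. Qed.
Lemma cImJ z : complex.Im (conjc z) = - complex.Im z. Proof. by case: z. Qed.

Lemma conjD z w : conjc (z + w) = conjc z + conjc w :> C.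
Proof. by apply: C_eq; rewrite ?(cReJ, cImJ, cReD, cImD)// opprD. Qed.
Lemma conjN z : conjc (- z) = - conjc z :> C.
Proof. by apply: C_eq; rewrite ?(cReJ, cImJ, cReN, cImN). Qed.
Lemma conjM z w : conjc (z * w) = conjc z * conjc w :> C.
Proof. by apply: C_eq; rewrite ?(cReJ, cImJ, cReM, cImM)//; ring. Qed.
Lemma conjK z : conjc (conjc z) = z.
Proof. by apply: C_eq; rewrite ?(cReJ, cImJ)// opprK. Qed.
Lemma conj_rc r : conjc (rc r) = rc r.
Proof. by rewrite /rc /= oppr0. Qed.
Lemma conjX z n : conjc (z ^+ n) = conjc z ^+ n :> C.
Proof.
by elim: n => [|n IH]; [rewrite !expr0; exact: (conj_rc 1)|rewrite !exprS conjM IH].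
Qed.

Lemma rc0 : rc 0 = 0. Proof. by []. Qed.
Lemma rc1 : rc 1 = 1. Proof. by []. Qed.
Lemma rcD r t : rc (r + t) = rc r + rc t.
Proof. by apply: C_eq; rewrite ?(cReD, cImD)//= addr0. Qed.
Lemma rcN r : rc (- r) = - rc r.
Proof. by apply: C_eq; rewrite ?(cReN, cImN)//= oppr0. Qed.
Lemma rcB r t : rc (r - t) = rc r - rc t.
Proof. by rewrite rcD rcN. Qed.
Lemma rcM r t : rc (r * t) = rc r * rc t.
Proof. by apply: C_eq; rewrite ?(cReM, cImM)/=; ring. Qed.
Lemma rcX r n : rc (r ^+ n) = rc r ^+ n.
Proof. by elim: n => [|n IH]; rewrite ?expr0// !exprS rcM IH. Qed.
Lemma rc_inj : injective rc. Proof. by move=> a b []. Qed.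
Lemma rcV r : rc r^-1 = (rc r)^-1.
Proof.
have [->|r0] := eqVneq r 0; first by rewrite invr0 rc0 invr0.
apply: (mulfI (_ : rc r != 0)); last by rewrite -rcM !divff//; apply/eqP => -[]/eqP; rewrite (negbTE r0).
by apply/eqP => -[]/eqP; rewrite (negbTE r0).
Qed.
Lemma rc_neq0 r : (rc r != 0) = (r != 0).
Proof.
by apply/idP/idP; apply: contra => /eqP; [move=> ->|move=> [] ->].
Qed.
Lemma rc_nat n : rc n%:R = n%:R.
Proof. by elim: n => [|n IH]; rewrite // -!natr1 rcD IH. Qed.

Lemma mod_ge0 z : 0 <= modulus z.
Proof. by case: z => a b; exact: sqrtr_ge0. Qed.
Lemma mod0 : modulus (0 : C) = 0. Proof. exact: Normc.normc0. Qed.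
Lemma mod1 : modulus (1 : C) = 1. Proof. exact: Normc.normc1. Qed.
Lemma modM z w : modulus (z * w) = modulus z * modulus w.
Proof. exact: Normc.normcM. Qed.
Lemma modV z : modulus (z^-1) = (modulus z)^-1.
Proof. exact: Normc.normcV. Qed.
Lemma mod_eq0 z : (modulus z == 0) = (z == 0).
Proof. by apply/eqP/eqP => [/Normc.eq0_normc//|->]; exact: mod0. Qed.
Lemma mod_gt0 z : (0 < modulus z) = (z != 0).
Proof. by rewrite lt_def mod_ge0 andbT mod_eq0. Qed.
Lemma modN z : modulus (- z) = modulus z.
Proof. exact: complex.normcN. Qed.
Lemma modD z w : modulus (z + w) <= modulus z + modulus w.
Proof. exact: complex.le_normcD. Qed.
Lemma modB z w : modulus (z - w) <= modulus z + modulus w.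
Proof. by rewrite -(modN w); exact: modD. Qed.
Lemma mod_distC z w : modulus (z - w) = modulus (w - z).
Proof. by rewrite -modN opprB. Qed.
Lemma modX z n : modulus (z ^+ n) = modulus z ^+ n.
Proof. by elim: n => [|n IH]; rewrite ?expr0 ?mod1// !exprS modM IH. Qed.
Lemma mod_rc r : modulus (rc r) = `|r|.
Proof. by rewrite /modulus /= expr0n /= addr0 sqrtr_sqr. Qed.
Lemma mod_sqr z : modulus z ^+ 2 = complex.Re z ^+ 2 + complex.Im z ^+ 2.
Proof. by case: z => a b; rewrite sqr_sqrtr// addr_ge0 ?sqr_ge0. Qed.
Lemma modJ z : modulus (conjc z) = modulus z.
Proof. by case: z => a b; rewrite /modulus /= sqrrN. Qed.
Lemma mulJ z : z * conjc z = rc (modulus z ^+ 2).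
Proof. by apply: C_eq; rewrite ?(cReM, cImM) cReJ cImJ/= ?mod_sqr; ring. Qed.
Lemma Re_le_mod z : `|complex.Re z| <= modulus z.
Proof.
by case: z => a b; rewrite /modulus /= -sqrtr_sqr ler_wsqrtr// lerDl sqr_ge0.
Qed.
Lemma Im_le_mod z : `|complex.Im z| <= modulus z.
Proof.
by case: z => a b; rewrite /modulus /= -sqrtr_sqr ler_wsqrtr// lerDr sqr_ge0.
Qed.
Lemma mod_le_ReIm z : modulus z <= `|complex.Re z| + `|complex.Im z|.
Proof.
have {1}-> : z = rc (complex.Re z) + Complex 0 1 * rc (complex.Im z).
  by apply: C_eq; rewrite ?(cReD, cImD, cReM, cImM)/=; ring.
apply: (le_trans (modD _ _)); rewrite modM !mod_rc.
by rewrite [X in X * _](_ : _ = 1) ?mul1r// /modulus /= expr0n expr1n add0r sqrtr1.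
Qed.
Lemma mod_sub_ge z w : modulus z - modulus w <= modulus (z - w).
Proof. by rewrite lerBlDr -{1}(subrK w z) modD. Qed.
Lemma mod_dist_dist z w : `|modulus z - modulus w| <= modulus (z - w).
Proof. by rewrite ler_norml mod_sub_ge andbT lerNl opprB mod_distC mod_sub_ge. Qed.

Lemma modI : modulus (Complex 0 1 : C) = 1.
Proof. by rewrite /modulus /= expr0n expr1n add0r sqrtr1. Qed.

Lemma mod_cis t : modulus (cis t) = 1.
Proof. by rewrite /modulus /= cos2Dsin2 sqrtr1. Qed.
Lemma cisD r t : cis (r + t) = cis r * cis t.
Proof. by apply: C_eq; rewrite ?(cReM, cImM)/= ?cosD ?sinD; ring. Qed.
Lemma cisN t : cis (- t) = conjc (cis t).
Proof. by rewrite /cis cosN sinN. Qed.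
Lemma cis_2pi t : cis (t + 2 * pi) = cis t.
Proof. by rewrite /cis mulrC mulr_natr cosD2pi sinD2pi. Qed.
Lemma mod_sum (I : Type) (s : seq I) (P : pred I) (F : I -> C) :
  modulus (\sum_(i <- s | P i) F i) <= \sum_(i <- s | P i) modulus (F i).
Proof.
elim/big_rec2: _ => [|i x y _ h]; first by rewrite mod0.
by apply: (le_trans (modD _ _)); rewrite lerD2l.
Qed.

Lemma Re_sum (I : Type) (s : seq I) (P : pred I) (F : I -> C) :
  complex.Re (\sum_(i <- s | P i) F i) = \sum_(i <- s | P i) complex.Re (F i).
Proof. by elim/big_rec2: _ => // i x y _ <-; rewrite cReD. Qed.
Lemma Im_sum (I : Type) (s : seq I) (P : pred I) (F : I -> C) :
  complex.Im (\sum_(i <- s | P i) F i) = \sum_(i <- s | P i) complex.Im (F i).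
Proof. by elim/big_rec2: _ => // i x y _ <-; rewrite cImD. Qed.
Lemma conj_sum (I : Type) (s : seq I) (P : pred I) (F : I -> C) :
  conjc (\sum_(i <- s | P i) F i) = \sum_(i <- s | P i) conjc (F i) :> C.
Proof. by elim/big_rec2: _ => [|i x y _ <-]; [exact: (conj_rc 0)|rewrite conjD]. Qed.
Lemma rc_sum (I : Type) (s : seq I) (P : pred I) (F : I -> R) :
  rc (\sum_(i <- s | P i) F i) = \sum_(i <- s | P i) rc (F i) :> C.
Proof. by elim/big_rec2: _ => // i x y _ <-; rewrite rcD. Qed.

End ComplexBasics.

Arguments modulus {R} z : simpl never.

(** * Continuity, complex differentiability and the exponential *)

Section Holomorphy.
Context {R : realType}.
Local Notation C := (cplx R).
Implicit Types (z w : C) (f g : C -> C) (r t : R).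

(** Radii are real here, whereas in the topology of [cplx R] the radius of a ball is itself a
    complex number. *)
Definition ccont f z : Prop := forall eps : R, 0 < eps ->
  exists2 del : R, 0 < del & forall w, modulus (w - z) < del -> modulus (f w - f z) < eps.

(* Caratheodory's form of complex differentiability: the difference quotient
   extends continuously to z. It makes the rules below algebraic. *)
Definition hol f z : Prop :=
  exists q : C -> C, ccont q z /\ forall w, f w - f z = q w * (w - z).

Lemma ccont_cst (c : C) z : ccont (fun=> c) z.
Proof. by move=> e e0; exists 1 => // w _; rewrite subrr mod0. Qed.

Lemma ccont_id z : ccont id z.
Proof. by move=> e e0; exists e. Qed.

Lemma ccont_local f g z (d : R) : 0 < d ->
  (forall w, modulus (w - z) < d -> f w = g w) -> ccont g z -> ccont f z.
Proof.
move=> d0 fg cg e /cg[d1 d10 H].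
exists (Num.min d d1); first by rewrite lt_min d0.
move=> w; rewrite lt_min => /andP[h1 h2].
by rewrite fg// (fg z) ?subrr ?mod0//; exact: H.
Qed.

Lemma ccontD f g z : ccont f z -> ccont g z -> ccont (fun w => f w + g w) z.
Proof.
move=> cf cg e e0.
have [d1 d10 H1] := cf _ (divr_gt0 e0 (ltr0Sn _ 1)).
have [d2 d20 H2] := cg _ (divr_gt0 e0 (ltr0Sn _ 1)).
exists (Num.min d1 d2); first by rewrite lt_min d10.
move=> w; rewrite lt_min => /andP[/H1 h1 /H2 h2].
rewrite opprD addrACA; apply: (le_lt_trans (modD _ _)).
by rewrite (splitr e); exact: ltrD.
Qed.

Lemma ccontN f z : ccont f z -> ccont (fun w => - f w) z.
Proof.
move=> cf e e0; have [d d0 H] := cf _ e0; exists d => // w /H.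
by rewrite -opprD modN.
Qed.

Lemma ccontB f g z : ccont f z -> ccont g z -> ccont (fun w => f w - g w) z.
Proof. by move=> cf cg; apply: ccontD => //; exact: ccontN. Qed.

Lemma ccont_bounded f z : ccont f z ->
  exists2 d : R, 0 < d & forall w, modulus (w - z) < d -> modulus (f w) <= modulus (f z) + 1.
Proof.
move=> /(_ 1 ltr01)[d d0 H]; exists d => // w /H h.
have := mod_sub_ge (f w) (f z); lra.
Qed.

Lemma ccontM f g z : ccont f z -> ccont g z -> ccont (fun w => f w * g w) z.
Proof.
move=> cf cg e e0.
have [d0 d00 H0] := ccont_bounded cf.
set A := modulus (f z) + 1; set B := modulus (g z) + 1.
have A0 : 0 < A by rewrite /A; have := mod_ge0 (f z); lra.
have B0 : 0 < B by rewrite /B; have := mod_ge0 (g z); lra.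
have e1 : 0 < e / 2 / B by rewrite !divr_gt0.
have e2 : 0 < e / 2 / A by rewrite !divr_gt0.
have [d1 d10 H1] := cf _ e1; have [d2 d20 H2] := cg _ e2.
exists (Num.min d0 (Num.min d1 d2)); first by rewrite !lt_min d00 d10.
move=> w; rewrite !lt_min => /andP[h0 /andP[h1 h2]].
have -> : f w * g w - f z * g z = f w * (g w - g z) + (f w - f z) * g z by ring.
apply: (le_lt_trans (modD _ _)); rewrite !modM (splitr e); apply: ltr_leD.
  apply: (@le_lt_trans _ _ (A * modulus (g w - g z))).
    by apply: ler_wpM2r; [exact: mod_ge0|exact: H0].
  by rewrite mulrC -ltr_pdivlMr//; exact: H2.
apply: (@le_trans _ _ (e / 2 / B * B)); last by rewrite divfK ?gt_eqF.
apply: ler_pM; [exact: mod_ge0|exact: mod_ge0|exact/ltW/H1|rewrite /B; lra].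
Qed.

Lemma ccontV z : z != 0 -> ccont (fun w => w^-1) z.
Proof.
move=> z0 e e0; have m0 : 0 < modulus z by rewrite mod_gt0.
(* The first bound keeps [modulus w] above [modulus z / 2], so that the denominator [w * z] has
   modulus at least [modulus z ^ 2 / 2]. *)
exists (Num.min (modulus z / 2) (e * modulus z ^+ 2 / 2)).
  by rewrite lt_min !divr_gt0// mulr_gt0// exprn_gt0.
move=> w; rewrite lt_min => /andP[h1 h2].
have hw : modulus z / 2 < modulus w.
  by have := mod_sub_ge z w; rewrite mod_distC; lra.
have w0 : w != 0 by rewrite -mod_gt0; lra.
have -> : w^-1 - z^-1 = (z - w) / (w * z) by field; rewrite z0 w0.
rewrite modM modV modM mod_distC ltr_pdivrMr; last by rewrite mulr_gt0//; lra.
apply: (lt_le_trans h2); rewrite -mulrA ler_pM2l// expr2.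
by rewrite mulrAC ler_wpM2r ?ltW.
Qed.

Lemma ccont_comp f g z : ccont f z -> ccont g (f z) -> ccont (fun w => g (f w)) z.
Proof.
move=> cf cg e /cg[d d0 H]; have [d1 d10 H1] := cf _ d0.
by exists d1 => // w /H1 /H.
Qed.

Lemma ccontX f z n : ccont f z -> ccont (fun w => f w ^+ n) z.
Proof.
move=> cf; elim: n => [|n IH]; first exact: ccont_cst.
apply: (@ccont_local _ (fun w => f w * f w ^+ n) _ 1 ltr01).
  by move=> w _; rewrite exprS.
exact: ccontM.
Qed.

Lemma ccontJ z : ccont (fun w => conjc w : C) z.
Proof. by move=> e e0; exists e => // w; rewrite -conjN -conjD modJ. Qed.

Lemma hol_ccont f z : hol f z -> ccont f z.
Proof.
case=> q [cq qE].
apply: (@ccont_local _ (fun w => f z + q w * (w - z)) _ 1 ltr01).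
  by move=> w _; rewrite -qE addrC subrK.
apply: ccontD; first exact: ccont_cst.
by apply: ccontM => //; apply: ccontB; [exact: ccont_id|exact: ccont_cst].
Qed.

Lemma hol_cst (c : C) z : hol (fun=> c) z.
Proof.
by exists (fun=> 0); split; [exact: ccont_cst|move=> w; rewrite subrr mul0r].
Qed.

Lemma hol_id z : hol id z.
Proof.
by exists (fun=> 1); split; [exact: ccont_cst|move=> w; rewrite mul1r].
Qed.

Lemma holD f g z : hol f z -> hol g z -> hol (fun w => f w + g w) z.
Proof.
move=> [p [cp pE]] [q [cq qE]]; exists (fun w => p w + q w); split.
  exact: ccontD.
by move=> w; rewrite mulrDl -pE -qE; ring.
Qed.

Lemma holM f g z : hol f z -> hol g z -> hol (fun w => f w * g w) z.
Proof.
move=> hf hg; case: (hf) => p [cp pE]; case: (hg) => q [cq qE].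
exists (fun w => p w * g w + f z * q w); split.
  apply: ccontD; first by apply: ccontM => //; exact: hol_ccont.
  by apply: ccontM => //; exact: ccont_cst.
move=> w; have -> : (p w * g w + f z * q w) * (w - z) =
  p w * (w - z) * g w + f z * (q w * (w - z)) by ring.
by rewrite -pE -qE; ring.
Qed.

Lemma holN f z : hol f z -> hol (fun w => - f w) z.
Proof.
move=> [p [cp pE]]; exists (fun w => - p w); split; first exact: ccontN.
by move=> w; rewrite mulNr -pE; ring.
Qed.

Lemma holB f g z : hol f z -> hol g z -> hol (fun w => f w - g w) z.
Proof. by move=> hf hg; apply: holD => //; exact: holN. Qed.

Lemma hol_comp f g z : hol f z -> hol g (f z) -> hol (fun w => g (f w)) z.
Proof.
move=> hf [q [cq qE]]; case: (hf) => p [cp pE].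
exists (fun w => q (f w) * p w); split.
  by apply: ccontM => //; apply: ccont_comp => //; exact: hol_ccont.
by move=> w; rewrite qE pE mulrA.
Qed.

Lemma hol_inv z : z != 0 -> hol (fun w => w^-1) z.
Proof.
(* The identity of [hol] is required at [w = 0] too, where the convention [0^-1 = 0] forces the
   quotient to be [z^-1 * z^-1]. *)
move=> z0; exists (fun w => if w == 0 then z^-1 * z^-1 else - (w^-1 * z^-1)); split.
  apply: (@ccont_local _ (fun w => - (w^-1 * z^-1)) _ (modulus z)).
  - by rewrite mod_gt0.
  - by move=> w; case: eqVneq => // ->; rewrite sub0r modN ltxx.
  - by apply: ccontN; apply: ccontM; [exact: ccontV|exact: ccont_cst].
move=> w; case: eqVneq => [->|w0]; first by rewrite invr0; field.
by field; rewrite w0 z0.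
Qed.

Lemma holV f z : f z != 0 -> hol f z -> hol (fun w => (f w)^-1) z.
Proof. by move=> fz hf; apply: (@hol_comp f (fun w => w^-1)) => //; exact: hol_inv. Qed.

Lemma holX f z n : hol f z -> hol (fun w => f w ^+ n) z.
Proof.
move=> hf; elim: n => [|n IH].
  by have -> : (fun w => f w ^+ 0) = (fun=> 1) by []; exact: hol_cst.
have -> : (fun w => f w ^+ n.+1) = (fun w => f w * f w ^+ n).
  by apply/funext => w; rewrite exprS.
exact: holM.
Qed.

(** [hol] asks for a factorization on the whole plane: the quotient of [g] is used near [z] and the
    plain difference quotient of [f] elsewhere. *)
Lemma hol_local f g z (d : R) : 0 < d ->
  (forall w, modulus (w - z) < d -> f w = g w) -> hol g z -> hol f z.
Proof.
move=> d0 fg [q [cq qE]].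
exists (fun w => if modulus (w - z) < d then q w else (f w - f z) / (w - z)); split.
  apply: (@ccont_local _ q _ d) => // w wd; by rewrite wd.
move=> w; case: ifPn => wd; first by rewrite !fg// ?subrr ?mod0.
rewrite divfK// subr_eq0; apply/eqP => wz; move: wd.
by rewrite wz subrr mod0 d0.
Qed.

(** The bridge to the derivative of the definitions; holomorphy is otherwise handled through
    [hol]. *)
Lemma derivable_hol f z : derivable f z 1 <-> hol f z.
Proof.
split.
  move=> /cvg_ex[d dP].
  exists (fun w => if w == z then d else (f w - f z) / (w - z)); split; last first.
    move=> w; case: eqVneq => [->|wz]; first by rewrite !subrr mulr0.
    by rewrite divfK// subr_eq0.
  move=> e e0; move/cvgrPdist_lt : dP => /(_ (rc e)).
  have /[swap]/[apply] : 0 < rc e by rewrite complex.ltcE /= eqxx.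
  rewrite near_withinE => -[/= d1 d10 H].
  case: d1 d10 H => a b; rewrite complex.ltcE /= => /andP[/eqP -> a0] H.
  exists a => // w wz; rewrite eqxx.
  case: eqVneq => [_|wz0]; first by rewrite subrr mod0.
  have := H (w - z); rewrite /ball_ /= sub0r normrN.
  rewrite complex.normc_def -/(Normc.normc _) complex.ltcE /= eqxx /=.
  have -> : Num.sqrt (complex.Re (w - z) ^+ 2 + complex.Im (w - z) ^+ 2) = modulus (w - z).
    by case: (w - z).
  move=> /(_ wz); rewrite subr_eq0 => /(_ wz0).
  rewrite scaler1 subrK complex.normc_def complex.ltcE /= eqxx /=.
  set x := (X in complex.Im X ^+ 2); rewrite -/x mod_distC.
  have <- : x = d - (f w - f z) / (w - z) by rewrite /x; congr (_ - _); exact: mulrC.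
  by case: (x).
move=> [q [cq qE]]; apply/cvg_ex; exists (q z).
apply/cvgrPdist_lt => -[e1 e2]; rewrite complex.ltcE /= => /andP[/eqP -> e0].
have [d d0 H] := cq _ e0.
rewrite near_withinE; exists (rc d) => /=; first by rewrite complex.ltcE /= eqxx.
move=> h; rewrite /ball_ /= sub0r normrN complex.normc_def complex.ltcE /= eqxx /= => hd h0.
have {}hd : modulus h < d by move: hd; case: (h).
have /H : modulus (h *: 1 + z - z) < d by rewrite scaler1 addrK.
have -> : q (h *: 1 + z) = h^-1 * (f (h *: 1 + z) - f z).
  by rewrite qE scaler1 addrK mulrCA mulVf// mulr1.
rewrite mod_distC complex.normc_def complex.ltcE /= eqxx /=.
by case: (q z - _).
Qed.

Lemma is_derive_expand (u : R -> R) (x d : R) : is_derive x 1 u d ->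
  forall e : R, 0 < e -> exists2 del : R, 0 < del & forall h, `|h| < del ->
    `|u (x + h) - u x - d * h| <= e * `|h|.
Proof.
move=> [du dE] e e0.
have /cvgrPdist_le/(_ e e0) : h^-1 *: (u (h *: 1 + x) - u x) @[h --> 0^'] --> d.
  by rewrite -dE; exact: du.
rewrite near_withinE => -[/= del del0 H]; exists del => // h hd.
have [->|h0] := eqVneq h 0; first by rewrite addr0 mulr0 !subrr normr0 mulr0.
have := H h; rewrite /ball_ /= sub0r normrN => /(_ hd h0).
rewrite [h *: 1]mulr1 [X in _ - X](_ : _ = (u (x + h) - u x) / h); last first.
  by rewrite [RHS]mulrC [h + x]addrC.
have -> : u (x + h) - u x - d * h = - ((d - (u (x + h) - u x) / h) * h) by field.
by rewrite normrN normrM; exact: ler_wpM2r.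
Qed.

(** The complex exponential in polar form. It carries rectangles to annuli in [cmean_annulus] and
    gives the bounded factor [exp(-U)] in [fatou_hardy1]. *)
Definition cexp (z : C) : C := rc (expR (complex.Re z)) * cis (complex.Im z).

Lemma cexpD z w : cexp (z + w) = cexp z * cexp w.
Proof. by rewrite /cexp cReD cImD expRD cisD rcM; ring. Qed.

Lemma mod_cexp z : modulus (cexp z) = expR (complex.Re z).
Proof. by rewrite modM mod_cis mulr1 mod_rc ger0_norm// expR_ge0. Qed.

(** Differentiability at 0, which [cexpD] transports to every point. The errors of [expR], of [cos]
    and [sin], and of the second-order product of real and imaginary parts add up to [6 e'], within
    [e = 8 e']. *)
Lemma cexp_expand (e : R) : 0 < e -> exists2 del : R, 0 < del &
  forall h, modulus h < del -> modulus (cexp h - 1 - h) <= e * modulus h.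
Proof.
move=> e0; pose e' := e / 8; have e'0 : 0 < e' by rewrite divr_gt0.
have [d1 d10 H1] := is_derive_expand (is_derive_expR (0 : R)) e'0.
have [d2 d20 H2] := is_derive_expand (is_derive_cos (0 : R)) e'0.
have [d3 d30 H3] := is_derive_expand (is_derive_sin (0 : R)) e'0.
exists (Num.min 1 (Num.min e' (Num.min d1 (Num.min d2 d3)))).
  by rewrite !lt_min ltr01 e'0 d10 d20.
move=> h; rewrite !lt_min => /and5P[h1 he hd1 hd2 hd3].
have Rh := Re_le_mod h; have Ih := Im_le_mod h.
set a := complex.Re h in Rh; set b := complex.Im h in Ih.
have {}H1 := H1 a (le_lt_trans Rh hd1).
have {}H2 := H2 b (le_lt_trans Ih hd2).
have {}H3 := H3 b (le_lt_trans Ih hd3).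
rewrite !add0r expR0 mul1r in H1; rewrite !add0r cos0 sin0 oppr0 mul0r subr0 in H2.
rewrite !add0r cos0 sin0 subr0 mul1r in H3.
have -> : cexp h - 1 - h = rc (expR a - 1 - a) * cis b
    + rc (1 + a) * Complex (cos b - 1) (sin b - b) + rc a * Complex 0 b.
  rewrite /cexp -/a -/b; apply: C_eq; rewrite !(cReD, cReN, cReM, cImD, cImN, cImM) /= -/a -/b; ring.
have m0 := mod_ge0 h.
apply: (le_trans (modD _ _)); apply: (@le_trans _ _ (5 * e' * modulus h + e' * modulus h)).
  apply: lerD.
    apply: (le_trans (modD _ _)); apply: (@le_trans _ _ (e' * modulus h + 4 * e' * modulus h)); last lra.
    apply: lerD; first by rewrite modM mod_cis mulr1 mod_rc; apply: (le_trans H1); rewrite ler_wpM2l// ltW.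
    rewrite modM mod_rc -mulrA [4]( _ : _ = 2 * 2); last by rewrite -natrM.
    rewrite -mulrA; apply: ler_pM; [exact: normr_ge0|exact: mod_ge0| |].
      by apply: (le_trans (ler_normD _ _)); rewrite normr1; lra.
    apply: (le_trans (mod_le_ReIm _)) => /=.
    have : e' * `|b| <= e' * modulus h by rewrite ler_wpM2l// ltW.
    by lra.
  rewrite modM mod_rc.
  have -> : modulus (Complex 0 b : C) = `|b| by rewrite /modulus /= expr0n add0r sqrtr_sqr.
  apply: ler_pM => //; lra.
by rewrite /e'; nra.
Qed.

Lemma hol_cexp z : hol cexp z.
Proof.
exists (fun w => if w == z then cexp z else (cexp w - cexp z) / (w - z)); split; last first.
  move=> w; case: eqVneq => [->|wz]; first by rewrite !subrr mulr0.
  by rewrite divfK// subr_eq0.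
move=> e e0; set E := modulus (cexp z).
have E0 : 0 < E by rewrite /E mod_cexp expR_gt0.
have [d d0 H] := cexp_expand (divr_gt0 (divr_gt0 e0 E0) (ltr0Sn _ 1)).
exists d => // w wd; rewrite eqxx; case: eqVneq => [_|wz]; first by rewrite subrr mod0.
have wz0 : w - z != 0 by rewrite subr_eq0.
have -> : (cexp w - cexp z) / (w - z) - cexp z =
    cexp z * ((cexp (w - z) - 1 - (w - z)) / (w - z)).
  have -> : cexp w = cexp (w - z) * cexp z by rewrite -cexpD subrK.
  move: (cexp (w - z)) (cexp z) (w - z) wz0 => A B u u0; by field.
rewrite modM -/E modM modV.
have /(_ wd) := H (w - z).
rewrite -ler_pdivrMr ?mod_gt0// => h.
have h2 : E * (modulus (cexp (w - z) - 1 - (w - z)) / modulus (w - z)) <= E * (e / E / 2).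
  by rewrite ler_pM2l.
apply: (le_lt_trans h2); have -> : E * (e / E / 2) = e / 2 by field; rewrite gt_eqF.
by rewrite ltr_pdivrMr// ltr_pMr// ltr1n.
Qed.

Lemma cexp_log (r t : R) : 0 < r -> cexp (Complex (ln r) t) = rc r * cis t.
Proof. by move=> r0; rewrite /cexp /= lnK. Qed.

Lemma cexp_2pi (x t : R) : cexp (Complex x (t + 2 * pi)) = cexp (Complex x t).
Proof. by rewrite /cexp /= cis_2pi. Qed.

End Holomorphy.

(** * Integrals of continuous functions over a segment *)

Section ComplexIntegral.
Context {R : realType}.
Local Notation C := (cplx R).
Local Notation mu := (@lebesgue_measure R).
Implicit Types (z w : C) (F G : R -> C) (f g H : C -> C) (a b r t : R).

Definition rcont F t : Prop := forall eps : R, 0 < eps ->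
  exists2 del : R, 0 < del & forall s, `|s - t| < del -> modulus (F s - F t) < eps.

Definition rcont_on a b F : Prop := forall t, a <= t <= b -> rcont F t.

Lemma rcont_ccont H F t : rcont F t -> ccont H (F t) -> rcont (fun s => H (F s)) t.
Proof.
move=> cf cg e /cg[d d0 hd]; have [d1 d10 H1] := cf _ d0.
by exists d1 => // w /H1 /hd.
Qed.

Lemma rcont_lip F t (K : R) : (forall s, modulus (F s - F t) <= K * `|s - t|) -> rcont F t.
Proof.
move=> h e e0; exists (e / (`|K| + 1)).
  by rewrite divr_gt0//; have := normr_ge0 K; lra.
move=> s; rewrite ltr_pdivlMr; last by have := normr_ge0 K; lra.
move=> hs; apply: (le_lt_trans (h s)); apply: le_lt_trans hs.
rewrite mulrC ler_wpM2l//; have := ler_norm K; lra.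
Qed.

Lemma rcont_rc t : rcont (fun s => rc s) t.
Proof. by apply: (@rcont_lip _ _ 1) => s; rewrite -rcB mod_rc mul1r. Qed.

Lemma rcont_hor (y t : R) : rcont (fun s => Complex s y) t.
Proof.
apply: (@rcont_lip _ _ 1) => s; rewrite mul1r /modulus /=.
by rewrite subrr expr0n addr0 sqrtr_sqr.
Qed.

Lemma rcont_ver (x t : R) : rcont (fun s => Complex x s) t.
Proof.
apply: (@rcont_lip _ _ 1) => s; rewrite mul1r /modulus /=.
by rewrite subrr expr0n add0r sqrtr_sqr.
Qed.

Lemma rcont_cis t : rcont cis t.
Proof.
have -> : cis = (fun s : R => cexp (Complex 0 s)).
  by apply/funext => s; rewrite /cexp /= expR0 rc1 mul1r.
apply: (@rcont_ccont cexp (fun s => Complex 0 s)); first exact: rcont_ver.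
exact/hol_ccont/hol_cexp.
Qed.

Lemma rcont_Re F t : rcont F t -> {for t, continuous (fun s => complex.Re (F s))}.
Proof.
move=> cF; apply/cvgrPdist_lt => e e0; have [d d0 hd] := cF _ e0.
near=> s; rewrite distrC -cReB; apply: (le_lt_trans (Re_le_mod _)); apply: hd.
by rewrite distrC; near: s; apply: cvgr_dist_lt.
Unshelve. all: by end_near. Qed.

Lemma rcont_Im F t : rcont F t -> {for t, continuous (fun s => complex.Im (F s))}.
Proof.
move=> cF; apply/cvgrPdist_lt => e e0; have [d d0 hd] := cF _ e0.
near=> s; rewrite distrC -cImB; apply: (le_lt_trans (Im_le_mod _)); apply: hd.
by rewrite distrC; near: s; apply: cvgr_dist_lt.
Unshelve. all: by end_near. Qed.

Lemma rcontZ (c : C) F t : rcont F t -> rcont (fun s => c * F s) t.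
Proof.
move=> cF; apply: (@rcont_ccont (fun z => c * z)) => //.
by apply: ccontM; [exact: ccont_cst|exact: ccont_id].
Qed.

Lemma rcont_mod F t : rcont F t -> rcont (fun s => rc (modulus (F s))) t.
Proof.
move=> cF; apply: (@rcont_ccont (fun z => rc (modulus z))) => //.
move=> e e0; exists e => // w hw; rewrite -rcB mod_rc.
exact: le_lt_trans (mod_dist_dist _ _) hw.
Qed.

Definition rint a b (u : R -> R) : R := (\int[mu]_(t in `[a, b]) u t)%R.

Definition cint a b F : C :=
  Complex (rint a b (fun t => complex.Re (F t))) (rint a b (fun t => complex.Im (F t))).

Definition cts_on a b (u : R -> R) := forall t, a <= t <= b -> {for t, continuous u}.

Lemma cts_integrable a b (u : R -> R) : cts_on a b u ->
  mu.-integrable `[a, b] (EFin \o u).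
Proof.
move=> cu; apply: continuous_compact_integrable; first exact: segment_compact.
apply: continuous_in_subspaceT => t; rewrite inE /= in_itv /= => h; exact: cu.
Qed.

Lemma rcont_on_Re a b F : rcont_on a b F -> cts_on a b (fun t => complex.Re (F t)).
Proof. by move=> cF t /cF; exact: rcont_Re. Qed.
Lemma rcont_on_Im a b F : rcont_on a b F -> cts_on a b (fun t => complex.Im (F t)).
Proof. by move=> cF t /cF; exact: rcont_Im. Qed.
Lemma rcont_on_mod a b F : rcont_on a b F -> cts_on a b (fun t => modulus (F t)).
Proof. by move=> cF t /cF /rcont_mod /rcont_Re. Qed.

Lemma rintD a b (u v : R -> R) : cts_on a b u -> cts_on a b v ->
  rint a b (fun t => u t + v t) = rint a b u + rint a b v.
Proof. by move=> cu cv; apply: RintegralD => //; exact: cts_integrable. Qed.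

Lemma rintZ a b (c : R) (u : R -> R) : cts_on a b u ->
  rint a b (fun t => c * u t) = c * rint a b u.
Proof. by move=> cu; apply: RintegralZl => //; exact: cts_integrable. Qed.

Lemma rint_cst a b (c : R) : a <= b -> rint a b (fun=> c) = c * (b - a).
Proof.
move=> ab; rewrite /rint Rintegral_cst//= lebesgue_measure_itv /= lte_fin.
by case: ltP => // ba /=; have -> : b = a by [apply/eqP; rewrite eq_le ba ab]; rewrite subrr.
Qed.

Lemma le_rint a b (u v : R -> R) : cts_on a b u -> cts_on a b v ->
  (forall t, a <= t <= b -> u t <= v t) -> rint a b u <= rint a b v.
Proof.
move=> cu cv uv; apply: le_Rintegral; [exact: measurable_itv|exact: cts_integrable|exact: cts_integrable|].
by move=> t /=; rewrite in_itv /=; exact: uv.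
Qed.

Lemma eq_rint a b (u v : R -> R) : (forall t, a <= t <= b -> u t = v t) ->
  rint a b u = rint a b v.
Proof. by move=> uv; apply: eq_Rintegral => t; rewrite inE /= in_itv /= => /uv. Qed.

Lemma rint_split a b c (u : R -> R) : a <= b -> b <= c -> cts_on a c u ->
  rint a c u = rint a b u + rint b c u.
Proof.
move=> ab bc cu; have iu := cts_integrable cu.
have := @Rintegral_itvB _ u (BLeft a) (BRight c) b iu.
rewrite !bnd_simp => /(_ ab bc) h.
rewrite /rint -(@Rintegral_itv_obnd_cbnd _ b (BRight c)); last first.
  apply: integrableS iu => //; apply: subset_itvr; by rewrite bnd_simp.
by rewrite -h; ring.
Qed.

Lemma cts_cst a b (c : R) : cts_on a b (fun=> c).
Proof. by move=> t _; exact: cvg_cst. Qed.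
Lemma cts_Z a b (c : R) (u : R -> R) : cts_on a b u -> cts_on a b (fun t => c * u t).
Proof. by move=> cu t /cu h; apply: continuousM => //; exact: cvg_cst. Qed.
Lemma cintD a b F G : rcont_on a b F -> rcont_on a b G ->
  cint a b (fun t => F t + G t) = cint a b F + cint a b G.
Proof.
move=> cF cG; apply: C_eq; rewrite ?(cReD, cImD) /=.
  rewrite -rintD; [|exact: rcont_on_Re..].
  by apply: eq_rint => t _; rewrite cReD.
rewrite -rintD; [|exact: rcont_on_Im..].
by apply: eq_rint => t _; rewrite cImD.
Qed.

Lemma cintZ a b (c : C) F : rcont_on a b F ->
  cint a b (fun t => c * F t) = c * cint a b F.
Proof.
move=> cF; have cR := rcont_on_Re cF; have cI := rcont_on_Im cF.
apply: C_eq; rewrite ?(cReM, cImM) /=.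
  rewrite -rintZ// -mulNr -rintZ// -rintD; [|exact: cts_Z..].
  by apply: eq_rint => t _; rewrite cReM mulNr.
rewrite -rintZ// -rintZ// -rintD; [|exact: cts_Z..].
by apply: eq_rint => t _; rewrite cImM.
Qed.

Lemma cint_cst a b (c : C) : a <= b -> cint a b (fun=> c) = c * rc (b - a).
Proof.
by move=> ab; apply: C_eq; rewrite ?(cReM, cImM) /= rint_cst// ?mulr0 ?subr0 ?add0r.
Qed.

Lemma eq_cint a b F G : (forall t, a <= t <= b -> F t = G t) -> cint a b F = cint a b G.
Proof. by move=> FG; apply: C_eq; apply: eq_rint => t /FG ->. Qed.

Lemma cint_split a b c F : a <= b -> b <= c -> rcont_on a c F ->
  cint a c F = cint a b F + cint b c F.
Proof.
move=> ab bc cF; apply: C_eq; rewrite ?(cReD, cImD) /=; apply: rint_split => //.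
  exact: rcont_on_Re.
exact: rcont_on_Im.
Qed.

Lemma cint_conj a b F : rcont_on a b F ->
  cint a b (fun t => conjc (F t)) = conjc (cint a b F).
Proof.
move=> cF; apply: C_eq; rewrite ?(cReJ, cImJ) /=.
  by apply: eq_rint => t _; rewrite cReJ.
rewrite -mulN1r -rintZ; last exact: rcont_on_Im.
by apply: eq_rint => t _; rewrite cImJ mulN1r.
Qed.

(* Rotating F by the phase of its integral makes the integral real. *)
Lemma mod_cint a b F : rcont_on a b F ->
  modulus (cint a b F) <= rint a b (fun t => modulus (F t)).
Proof.
move=> cF; have [I0|I0] := eqVneq (cint a b F) 0.
  by rewrite I0 mod0; apply: Rintegral_ge0 => t _; exact: mod_ge0.
set I := cint a b F in I0 *; have mI : 0 < modulus I by rewrite mod_gt0.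
pose u := conjc I * rc (modulus I)^-1.
have mu1 : modulus u = 1.
  by rewrite modM modJ mod_rc ger0_norm ?invr_ge0 ?mod_ge0// divff// gt_eqF.
have uI : u * I = rc (modulus I).
  rewrite /u mulrAC [_ * I]mulrC mulJ -rcM expr2 mulfK// gt_eqF//.
have -> : modulus I = complex.Re (cint a b (fun t => u * F t)) by rewrite cintZ// uI.
apply: le_rint.
- by apply: rcont_on_Re => t ht; apply: rcontZ; exact: cF.
- exact: rcont_on_mod.
- move=> t _; apply: (le_trans (ler_norm _)); apply: (le_trans (Re_le_mod _)).
  by rewrite modM mu1 mul1r.
Qed.

Lemma mod_cint_le a b F (M : R) : a <= b -> rcont_on a b F ->
  (forall t, a <= t <= b -> modulus (F t) <= M) -> modulus (cint a b F) <= M * (b - a).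
Proof.
move=> ab cF FM; apply: (le_trans (mod_cint cF)); rewrite -rint_cst//.
by apply: le_rint => //; [exact: rcont_on_mod|exact: cts_cst].
Qed.

Lemma rint_id a b : a <= b -> rint a b id = (b ^+ 2 - a ^+ 2) / 2.
Proof.
rewrite le_eqVlt => /predU1P[->|ab].
  by rewrite /rint set_itv1 Rintegral_set1 subrr mul0r.
pose F : R -> R := fun t => 2^-1 * t ^+ 2.
have dE (x : R) : is_derive x 1 F x.
  have := @is_deriveZ _ _ _ (fun t : R^o => t ^+ 2) 2^-1 x 1 _ (is_deriveX 2 (is_derive_id x 1)).
  by move=> /is_derive_eq; apply; rewrite /GRing.scale /= expr1 mulr1 mulrA mulVf ?mul1r.
rewrite /rint /Rintegral (@continuous_FTC2 _ id F)//=.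
- by rewrite /F; ring.
- by apply: continuous_subspaceT => x; exact: cvg_id.
- split => //.
  + by apply: cvg_at_right_filter; apply: differentiable_continuous; apply/derivable1_diffP; case: (dE a).
  + by apply: cvg_at_left_filter; apply: differentiable_continuous; apply/derivable1_diffP; case: (dE b).
- by move=> x _; rewrite derive1E; case: (dE x).
Qed.

End ComplexIntegral.

(** * Means over the unit circle *)

Section CircleMean.
Context {R : realType}.
Local Notation C := (cplx R).
Implicit Types (z w : C) (f g H G : C -> C) (u v : C -> R) (a r t : R).

Definition circ_cont H : Prop := forall z, modulus z = 1 -> ccont H z.

(** The starting angle [a] is left free: the definitions integrate from 0, while the maximal
    inequality needs the period centred at the angle under study. *)
Definition cmean a H : C := rc (2 * pi)^-1 * cint a (a + 2 * pi) (fun t => H (cis t)).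

Definition rmean a u : R := (2 * pi)^-1 * rint a (a + 2 * pi) (fun t => u (cis t)).

Lemma twopi_gt0 : 0 < 2 * pi :> R.
Proof. by rewrite mulr_gt0// pi_gt0. Qed.

Lemma inv2pi_ge0 : 0 <= (2 * pi)^-1 :> R.
Proof. by rewrite invr_ge0 ltW// twopi_gt0. Qed.

Lemma period_le a : a <= a + 2 * pi.
Proof. by rewrite lerDl ltW// twopi_gt0. Qed.

Lemma circ_rcont H a b : circ_cont H -> rcont_on a b (fun t => H (cis t)).
Proof. by move=> cH t _; apply: rcont_ccont; [exact: rcont_cis|apply: cH; exact: mod_cis]. Qed.

Lemma cmeanD a H G : circ_cont H -> circ_cont G ->
  cmean a (fun z => H z + G z) = cmean a H + cmean a G.
Proof. by move=> cH cG; rewrite /cmean cintD ?mulrDr//; exact: circ_rcont. Qed.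

Lemma cmeanZ a (c : C) H : circ_cont H -> cmean a (fun z => c * H z) = c * cmean a H.
Proof. by move=> cH; rewrite /cmean cintZ; [rewrite mulrCA|exact: circ_rcont]. Qed.

Lemma cmeanB a H G : circ_cont H -> circ_cont G ->
  cmean a (fun z => H z - G z) = cmean a H - cmean a G.
Proof.
move=> cH cG; rewrite -(mulN1r (cmean a G)) -cmeanZ// -cmeanD//.
  by congr cmean; apply/funext => z; rewrite mulN1r.
by move=> z hz; apply: ccontM; [exact: ccont_cst|exact: cG].
Qed.

Lemma cmean_cst a (c : C) : cmean a (fun=> c) = c.
Proof.
rewrite /cmean cint_cst ?period_le// mulrCA -rcM addrAC subrr add0r mulVf ?mulr1//.
by rewrite gt_eqF// twopi_gt0.
Qed.

Lemma eq_cmean a H G : (forall z, modulus z = 1 -> H z = G z) -> cmean a H = cmean a G.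
Proof. by move=> HG; rewrite /cmean; congr (_ * _); apply: eq_cint => t _; rewrite HG// mod_cis. Qed.

Lemma cmean_conj a H : circ_cont H -> cmean a (fun z => conjc (H z)) = conjc (cmean a H).
Proof.
by move=> cH; rewrite /cmean cint_conj ?conjM ?conj_rc//; exact: circ_rcont.
Qed.

Lemma circ_contM H G : circ_cont H -> circ_cont G -> circ_cont (fun z => H z * G z).
Proof. by move=> cH cG z hz; apply: ccontM; [exact: cH|exact: cG]. Qed.
Lemma circ_contD H G : circ_cont H -> circ_cont G -> circ_cont (fun z => H z + G z).
Proof. by move=> cH cG z hz; apply: ccontD; [exact: cH|exact: cG]. Qed.
Lemma circ_cont_cst (c : C) : circ_cont (fun=> c).
Proof. by move=> z _; exact: ccont_cst. Qed.
Lemma circ_contX n : circ_cont (fun z => z ^+ n).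
Proof. by move=> z _; apply: ccontX; exact: ccont_id. Qed.
Lemma circ_contJ H : circ_cont H -> circ_cont (fun z => conjc (H z)).
Proof. by move=> cH z hz; apply: (@ccont_comp _ H (fun w => conjc w)); [exact: cH|exact: ccontJ]. Qed.
Lemma circ_contN H : circ_cont H -> circ_cont (fun z => - H z).
Proof. by move=> cH z hz; apply: ccontN; exact: cH. Qed.

Lemma circ_cont_sum n (H : nat -> C -> C) : (forall k, circ_cont (H k)) ->
  circ_cont (fun z => \sum_(0 <= k < n) H k z).
Proof.
move=> cH; elim: n => [|n IH].
  have -> : (fun z => \sum_(0 <= k < 0) H k z) = (fun=> 0).
    by apply/funext => z; rewrite big_nil.
  exact: circ_cont_cst.
have -> : (fun z => \sum_(0 <= k < n.+1) H k z) = (fun z => \sum_(0 <= k < n) H k z + H n z).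
  by apply/funext => z; rewrite big_nat_recr.
exact: circ_contD.
Qed.

Lemma cmean_sum a n (H : nat -> C -> C) : (forall k, circ_cont (H k)) ->
  cmean a (fun z => \sum_(0 <= k < n) H k z) = \sum_(0 <= k < n) cmean a (H k).
Proof.
move=> cH; elim: n => [|n IH].
  rewrite big_nil -[RHS](cmean_cst a 0); congr cmean.
  by apply/funext => z; rewrite big_nil.
rewrite big_nat_recr//= -IH -cmeanD//; last exact: circ_cont_sum.
by congr cmean; apply/funext => z; rewrite big_nat_recr.
Qed.

Lemma cmean_rc a u : cmean a (fun z => rc (u z)) = rc (rmean a u).
Proof.
apply: C_eq; rewrite ?(cReM, cImM) /=; first by rewrite mul0r subr0.
rewrite mul0r addr0 [rint _ _ _](_ : _ = 0) ?mulr0//.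
by rewrite rint_cst ?period_le// mul0r.
Qed.

Lemma mod_cmean a H : circ_cont H -> modulus (cmean a H) <= rmean a (fun z => modulus (H z)).
Proof.
move=> cH; rewrite modM mod_rc ger0_norm ?inv2pi_ge0//.
rewrite ler_wpM2l ?inv2pi_ge0//.
by apply: mod_cint; exact: circ_rcont.
Qed.

Lemma circ_rc_cts u a b : circ_cont (fun z => rc (u z)) -> cts_on a b (fun t => u (cis t)).
Proof. by move=> /circ_rcont cu; exact: (rcont_on_Re (cu a b)). Qed.

Lemma le_rmean a u v : circ_cont (fun z => rc (u z)) -> circ_cont (fun z => rc (v z)) ->
  (forall z, modulus z = 1 -> u z <= v z) -> rmean a u <= rmean a v.
Proof.
move=> cu cv uv; rewrite ler_wpM2l ?inv2pi_ge0//.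
by apply: le_rint; [exact: circ_rc_cts|exact: circ_rc_cts|move=> t _; rewrite uv// mod_cis].
Qed.

Lemma eq_rmean a u v : (forall z, modulus z = 1 -> u z = v z) -> rmean a u = rmean a v.
Proof. by move=> uv; rewrite /rmean; congr (_ * _); apply: eq_rint => t _; rewrite uv// mod_cis. Qed.

Lemma rmean_cst a (c : R) : rmean a (fun=> c) = c.
Proof. by apply: (@rc_inj R); rewrite -cmean_rc cmean_cst. Qed.

Lemma rmeanD a u v : circ_cont (fun z => rc (u z)) -> circ_cont (fun z => rc (v z)) ->
  rmean a (fun z => u z + v z) = rmean a u + rmean a v.
Proof.
move=> cu cv; rewrite /rmean rintD ?mulrDr//; exact: circ_rc_cts.
Qed.

Lemma rmeanZ a (c : R) u : circ_cont (fun z => rc (u z)) ->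
  rmean a (fun z => c * u z) = c * rmean a u.
Proof.
by move=> cu; rewrite /rmean rintZ; [rewrite mulrCA|exact: circ_rc_cts].
Qed.

Lemma circ_cont_mod H : circ_cont H -> circ_cont (fun z => rc (modulus (H z))).
Proof.
move=> cH z /cH cz; apply: (@ccont_comp _ H (fun z => rc (modulus z))) => //.
move=> e e0; exists e => // w hw; rewrite -rcB mod_rc.
exact: le_lt_trans (mod_dist_dist _ _) hw.
Qed.

Lemma circ_cont_modX H n : circ_cont H -> circ_cont (fun z => rc (modulus (H z) ^+ n)).
Proof.
move=> cH z hz; have -> : (fun z => rc (modulus (H z) ^+ n)) = (fun z => rc (modulus (H z)) ^+ n).
  by apply/funext => w; rewrite rcX.
by apply: ccontX; exact: circ_cont_mod.
Qed.

Lemma mod_cmean_le a H (M : R) : circ_cont H ->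
  (forall z, modulus z = 1 -> modulus (H z) <= M) -> modulus (cmean a H) <= M.
Proof.
move=> cH HM; apply: (le_trans (mod_cmean _ cH)); rewrite -(rmean_cst a M).
by apply: le_rmean => //; [exact: circ_cont_mod|exact: circ_cont_cst].
Qed.

Lemma rmean_ge0 a u : (forall z, modulus z = 1 -> 0 <= u z) -> 0 <= rmean a u.
Proof.
move=> u0; rewrite mulr_ge0 ?inv2pi_ge0//.
by apply: Rintegral_ge0 => t _; rewrite u0// mod_cis.
Qed.

(** Tube lemma: compactness of the segment makes the radius [d] independent of the point. *)
Lemma segment_uniform (P : R -> R -> Prop) a b (r0 : R) :
  (forall t, a <= t <= b -> exists2 d, 0 < d & forall r s, `|r - r0| < d -> `|s - t| < d -> P r s) ->
  exists2 d, 0 < d & forall r s, `|r - r0| < d -> a <= s <= b -> P r s.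
Proof.
move=> h; have /compact_near_coveringP/(_ R (nbhs r0) (fun r s => P r s)) := @segment_compact R a b.
case.
  move=> t /=; rewrite in_itv /= => /h[d d0 hd].
  exists (ball t d, ball r0 d); first by split; exact: nbhsx_ballx.
  move=> [s r] /= []; rewrite /ball /= => h1 h2; apply: hd; by rewrite distrC.
move=> d /= d0 hd; exists d => // r s rd sab.
by apply: (hd r); rewrite /= ?in_itv// distrC.
Qed.

Lemma segment_uniform_cont H (r0 a b : R) : (forall z, modulus z = 1 -> ccont H (rc r0 * z)) ->
  forall e : R, 0 < e -> exists2 d : R, 0 < d & forall r t, `|r - r0| < d ->
    a <= t <= b -> modulus (H (rc r * cis t) - H (rc r0 * cis t)) < e.
Proof.
move=> cH e e0; apply: segment_uniform => t _.
have [d d0 hd] := cH _ (mod_cis t) _ (divr_gt0 e0 (ltr0Sn _ 1)).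
have K0 : 0 < `|r0| + 1 by have := normr_ge0 r0; lra.
have [d1 d10 hd1] := rcont_cis t (divr_gt0 (divr_gt0 d0 (ltr0Sn _ 1)) K0).
exists (Num.min (d / 2) d1); first by rewrite lt_min d10 divr_gt0.
move=> r s; rewrite !lt_min => /andP[h1 _] /andP[_ /hd1].
rewrite ltr_pdivlMr// => h2.
have h3 : modulus (rc r0 * cis s - rc r0 * cis t) < d / 2.
  rewrite -mulrBr modM mod_rc; apply: le_lt_trans h2; rewrite mulrC ler_wpM2l ?mod_ge0//; lra.
have -> : H (rc r * cis s) - H (rc r0 * cis s) =
  (H (rc r * cis s) - H (rc r0 * cis t)) - (H (rc r0 * cis s) - H (rc r0 * cis t)) by ring.
apply: (le_lt_trans (modB _ _)); rewrite (splitr e); apply: ltrD; apply: hd; last lra.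
have -> : rc r * cis s - rc r0 * cis t = rc (r - r0) * cis s + (rc r0 * cis s - rc r0 * cis t).
  by rewrite rcB; ring.
by apply: (le_lt_trans (modD _ _)); rewrite modM mod_cis mulr1 mod_rc; lra.
Qed.

Lemma cmean_radius_cont H (r0 a : R) (d0 : R) : 0 < d0 ->
  (forall r z, `|r - r0| < d0 -> modulus z = 1 -> ccont H (rc r * z)) ->
  forall e : R, 0 < e -> exists2 d : R, 0 < d & forall r, `|r - r0| < d ->
    modulus (cmean a (fun z => H (rc r * z)) - cmean a (fun z => H (rc r0 * z))) <= e.
Proof.
move=> d00 cH e e0.
have cH0 z : modulus z = 1 -> ccont H (rc r0 * z) by apply: cH; rewrite subrr normr0.
have [d d1 hd] := @segment_uniform_cont H r0 a (a + 2 * pi) cH0 e e0.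
exists (Num.min d d0); first by rewrite lt_min d1.
move=> r; rewrite lt_min => /andP[rd rd0].
have cc r' : `|r' - r0| < d0 -> circ_cont (fun z => H (rc r' * z)).
  move=> h z hz; apply: ccont_comp; last exact: cH.
  by apply: ccontM; [exact: ccont_cst|exact: ccont_id].
have c1 := cc _ rd0; have c2 : circ_cont (fun z => H (rc r0 * z)) by apply: cc; rewrite subrr normr0.
rewrite -cmeanB// modM mod_rc ger0_norm ?inv2pi_ge0//.
rewrite mulrC ler_pdivrMr ?twopi_gt0//.
have -> : e * (2 * pi) = e * ((a + 2 * pi) - a) by congr (_ * _); ring.
apply: mod_cint_le; first exact: period_le.
  exact: (circ_rcont (circ_contD c1 (circ_contN c2))).
by move=> t ht; apply/ltW/hd.
Qed.

End CircleMean.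

(** * Goursat's theorem on rectangles and annuli *)

Section Goursat.
Context {R : realType}.
Local Notation C := (cplx R).
Implicit Types (z w : C) (F G H f g : C -> C) (x y a r t e : R).

Lemma nested_intervals (x : nat -> R) (l : R) : 0 <= l ->
  (forall n, x n <= x n.+1) ->
  (forall n, x n.+1 + l / 2 ^+ n.+1 <= x n + l / 2 ^+ n) ->
  exists X, forall n, x n <= X <= x n + l / 2 ^+ n.
Proof.
move=> l0 xnd xl.
have x_le m n : (m <= n)%N -> x m <= x n.
  by move=> mn; apply: (@nondecreasing_seqP _ _ x).1 => //; exact: xnd.
have y_le m n : (m <= n)%N -> x n + l / 2 ^+ n <= x m + l / 2 ^+ m.
  move=> mn; have /nonincreasing_seqP := xl; exact.
have key m n : x m <= x n + l / 2 ^+ n.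
  apply: (@le_trans _ _ (x (maxn m n))); first by apply: x_le; exact: leq_maxl.
  apply: (@le_trans _ _ (x (maxn m n) + l / 2 ^+ maxn m n)).
    by rewrite lerDl divr_ge0// exprn_ge0.
  by apply: y_le; exact: leq_maxr.
exists (sup (range x)) => n; apply/andP; split.
  apply: ub_le_sup; last by exists n.
  by exists (x 0%N + l / 2 ^+ 0) => _ [m _ <-]; exact: key.
by apply: ge_sup; [exists (x 0%N), 0%N|move=> _ [m _ <-]; exact: key].
Qed.

(** The contour integral along the boundary of the rectangle, counterclockwise: bottom minus top,
    plus [i] times right minus left. *)
Definition bnd F x1 x2 y1 y2 : C :=
  cint x1 x2 (fun x => F (Complex x y1)) - cint x1 x2 (fun x => F (Complex x y2)) +
  Complex 0 1 * (cint y1 y2 (fun y => F (Complex x2 y)) - cint y1 y2 (fun y => F (Complex x1 y))).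

Definition rect_cont F x1 x2 y1 y2 := forall x y, x1 <= x <= x2 -> y1 <= y <= y2 ->
  ccont F (Complex x y).

Lemma rect_hor F x1 x2 y1 y2 y : rect_cont F x1 x2 y1 y2 -> y1 <= y <= y2 ->
  rcont_on x1 x2 (fun x => F (Complex x y)).
Proof.
move=> cF hy x hx; apply: (@rcont_ccont _ F (fun x => Complex x y)); first exact: rcont_hor.
exact: cF.
Qed.

Lemma rect_ver F x1 x2 y1 y2 x : rect_cont F x1 x2 y1 y2 -> x1 <= x <= x2 ->
  rcont_on y1 y2 (fun y => F (Complex x y)).
Proof.
move=> cF hx y hy; apply: (@rcont_ccont _ F (fun y => Complex x y)); first exact: rcont_ver.
exact: cF.
Qed.

Lemma bnd_split_x F x1 xm x2 y1 y2 : x1 <= xm -> xm <= x2 -> y1 <= y2 ->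
  rect_cont F x1 x2 y1 y2 ->
  bnd F x1 x2 y1 y2 = bnd F x1 xm y1 y2 + bnd F xm x2 y1 y2.
Proof.
move=> h1 h2 h3 cF; rewrite /bnd.
rewrite (cint_split h1 h2 (rect_hor cF (_ : y1 <= y1 <= y2))) ?lexx//.
rewrite (cint_split h1 h2 (rect_hor cF (_ : y1 <= y2 <= y2))) ?lexx ?andbT//.
by ring.
Qed.

Lemma bnd_split_y F x1 x2 y1 ym y2 : y1 <= ym -> ym <= y2 -> x1 <= x2 ->
  rect_cont F x1 x2 y1 y2 ->
  bnd F x1 x2 y1 y2 = bnd F x1 x2 y1 ym + bnd F x1 x2 ym y2.
Proof.
move=> h1 h2 h3 cF; rewrite /bnd.
rewrite (cint_split h1 h2 (rect_ver cF (_ : x1 <= x1 <= x2))) ?lexx//.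
rewrite (cint_split h1 h2 (rect_ver cF (_ : x1 <= x2 <= x2))) ?lexx ?andbT//.
by ring.
Qed.

Lemma bnd_le F x1 x2 y1 y2 (M : R) : x1 <= x2 -> y1 <= y2 -> rect_cont F x1 x2 y1 y2 ->
  (forall x y, x1 <= x <= x2 -> y1 <= y <= y2 -> modulus (F (Complex x y)) <= M) ->
  modulus (bnd F x1 x2 y1 y2) <= 2 * M * ((x2 - x1) + (y2 - y1)).
Proof.
move=> hx hy cF FM; have my1 : y1 <= y1 <= y2 by rewrite lexx.
have my2 : y1 <= y2 <= y2 by rewrite lexx andbT.
have mx1 : x1 <= x1 <= x2 by rewrite lexx.
have mx2 : x1 <= x2 <= x2 by rewrite lexx andbT.
have b1 := mod_cint_le hx (rect_hor cF my1) (fun t ht => FM t y1 ht my1).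
have b2 := mod_cint_le hx (rect_hor cF my2) (fun t ht => FM t y2 ht my2).
have b3 := mod_cint_le hy (rect_ver cF mx1) (fun t ht => FM x1 t mx1 ht).
have b4 := mod_cint_le hy (rect_ver cF mx2) (fun t ht => FM x2 t mx2 ht).
rewrite /bnd; set A := cint _ _ _ in b1 *; set B := cint _ _ _ in b2 *.
set A' := cint _ _ _ in b4 *; set B' := cint _ _ _ in b3 *.
have := modD (A - B) (Complex 0 1 * (A' - B')); rewrite modM.
rewrite modI.
by have := modB A B; have := modB A' B'; nra.
Qed.

Lemma cint_rc x1 x2 : x1 <= x2 -> cint x1 x2 (fun x => rc x) = rc ((x2 ^+ 2 - x1 ^+ 2) / 2).
Proof.
move=> h; apply: C_eq => /=; first by rewrite -rint_id.
by rewrite rint_cst// mul0r.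
Qed.

(** This lets Goursat's argument subtract the first-order expansion of [F] at a point without
    changing the contour integral. *)
Lemma bnd_affine (A B : C) x1 x2 y1 y2 : x1 <= x2 -> y1 <= y2 ->
  bnd (fun z => A + B * z) x1 x2 y1 y2 = 0.
Proof.
move=> hx hy; rewrite /bnd.
have hor y : cint x1 x2 (fun x => A + B * Complex x y) =
    (A + B * Complex 0 y) * rc (x2 - x1) + B * rc ((x2 ^+ 2 - x1 ^+ 2) / 2).
  rewrite -cint_cst// -cint_rc// -cintZ; last by move=> t _; exact: rcont_rc.
  rewrite -cintD; first 1 last.
  - by move=> t _; apply: (@rcont_lip _ _ _ 0) => s; rewrite subrr mod0 mul0r.
  - by move=> t _; apply: rcontZ; exact: rcont_rc.
  apply: eq_cint => t _; rewrite -addrA -mulrDr; congr (_ + _ * _).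
  by apply: C_eq; rewrite ?(cReD, cImD)/= ?add0r ?addr0.
have ver x : cint y1 y2 (fun y => A + B * Complex x y) =
    (A + B * rc x) * rc (y2 - y1) + B * Complex 0 1 * rc ((y2 ^+ 2 - y1 ^+ 2) / 2).
  rewrite -cint_cst// -cint_rc// -cintZ; last by move=> t _; exact: rcont_rc.
  rewrite -cintD; first 1 last.
  - by move=> t _; apply: (@rcont_lip _ _ _ 0) => s; rewrite subrr mod0 mul0r.
  - by move=> t _; apply: rcontZ; exact: rcont_rc.
  apply: eq_cint => t _; rewrite -addrA -mulrA -mulrDr; congr (_ + _ * _).
  by apply: C_eq; rewrite ?(cReD, cImD, cReM, cImM)/=; ring.
have iE y : Complex 0 y = Complex 0 1 * rc y :> C.
  by apply: C_eq; rewrite ?(cReM, cImM)/=; ring.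
rewrite !hor !ver {hor ver} (iE y1) (iE y2) !rcB; ring.
Qed.

Lemma bndB F G x1 x2 y1 y2 : x1 <= x2 -> y1 <= y2 ->
  rect_cont F x1 x2 y1 y2 -> rect_cont G x1 x2 y1 y2 ->
  bnd (fun z => F z - G z) x1 x2 y1 y2 = bnd F x1 x2 y1 y2 - bnd G x1 x2 y1 y2.
Proof.
move=> hx hy cF cG.
have my1 : y1 <= y1 <= y2 by rewrite lexx.
have my2 : y1 <= y2 <= y2 by rewrite lexx andbT.
have mx1 : x1 <= x1 <= x2 by rewrite lexx.
have mx2 : x1 <= x2 <= x2 by rewrite lexx andbT.
have cB a b (f g : R -> C) : rcont_on a b f -> rcont_on a b g ->
    cint a b (fun t => f t - g t) = cint a b f - cint a b g.
  move=> cf cg; rewrite -(mulN1r (cint a b g)) -cintZ// -cintD//.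
    by apply: eq_cint => t _; rewrite mulN1r.
  by move=> t ht; apply: rcontZ; exact: cg.
rewrite /bnd !cB; [ring|exact: (rect_ver cF)|exact: (rect_ver cG)|exact: (rect_ver cF)
  |exact: (rect_ver cG)|exact: (rect_hor cF)|exact: (rect_hor cG)
  |exact: (rect_hor cF)|exact: (rect_hor cG)].
Qed.

Lemma bnd_quarters F x y (L M B : R) : 0 <= L -> 0 <= M ->
  rect_cont F x (x + L + L) y (y + M + M) ->
  modulus (bnd F x (x + L) y (y + M)) <= B ->
  modulus (bnd F x (x + L) (y + M) (y + M + M)) <= B ->
  modulus (bnd F (x + L) (x + L + L) y (y + M)) <= B ->
  modulus (bnd F (x + L) (x + L + L) (y + M) (y + M + M)) <= B ->
  modulus (bnd F x (x + L + L) y (y + M + M)) <= 4 * B.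
Proof.
move=> hL hM cF.
have x1 : x <= x + L by rewrite lerDl.
have x2 : x + L <= x + L + L by rewrite lerDl.
have y1 : y <= y + M by rewrite lerDl.
have y2 : y + M <= y + M + M by rewrite lerDl.
have c1 : rect_cont F x (x + L) y (y + M + M).
  move=> s t /andP[s1 s2] ht; apply: cF => //; rewrite s1; exact: le_trans x2.
have c2 : rect_cont F (x + L) (x + L + L) y (y + M + M).
  move=> s t /andP[s1 s2] ht; apply: cF => //; rewrite s2 andbT; exact: le_trans s1.
rewrite (bnd_split_x x1 x2 (le_trans y1 y2) cF) (bnd_split_y y1 y2 x1 c1).
rewrite (bnd_split_y y1 y2 x2 c2) {cF c1 c2 x1 x2 y1 y2 hL hM}.
move: (bnd _ _ _ _ _) (bnd _ _ _ _ _) (bnd _ _ _ _ _) (bnd _ _ _ _ _) => B4 B3 B2 B1.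
have := modD (B1 + B2) (B3 + B4); have := modD B1 B2; have := modD B3 B4; lra.
Qed.

Section Bisection.
Variables (F : C -> C) (x0 y0 l m : R).
Hypotheses (l0 : 0 <= l) (m0 : 0 <= m)
  (hF : forall x y, x0 <= x <= x0 + l -> y0 <= y <= y0 + m -> hol F (Complex x y)).
Variables (e : R).
Hypothesis e0 : 0 < e.

(** The triple [(n, (x, y))] stands for the rectangle with lower left corner [(x, y)] and sides
    [l / 2 ^ n] and [m / 2 ^ n]; [good] places it inside the initial one. *)
Let good (p : nat * (R * R)) := [&& x0 <= p.2.1, p.2.1 + l / 2 ^+ p.1 <= x0 + l,
  y0 <= p.2.2 & p.2.2 + m / 2 ^+ p.1 <= y0 + m].

(** The threshold is quadratic in the half-perimeter, hence divided by 4 at each bisection, like the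
    share of the integral that one of the four quarters must carry. *)
Let bad (p : nat * (R * R)) : Prop := good p /\
  e * (l / 2 ^+ p.1 + m / 2 ^+ p.1) ^+ 2 <
  modulus (bnd F p.2.1 (p.2.1 + l / 2 ^+ p.1) p.2.2 (p.2.2 + m / 2 ^+ p.1)).

Let halves (p q : nat * (R * R)) : Prop := [/\ q.1 = p.1.+1,
  p.2.1 <= q.2.1, q.2.1 + l / 2 ^+ q.1 <= p.2.1 + l / 2 ^+ p.1,
  p.2.2 <= q.2.2 & q.2.2 + m / 2 ^+ q.1 <= p.2.2 + m / 2 ^+ p.1].

Let good_cont n x y : good (n, (x, y)) ->
  rect_cont F x (x + l / 2 ^+ n) y (y + m / 2 ^+ n).
Proof.
move=> /and4P[/= h1 h2 h3 h4] s t hs ht; apply/hol_ccont/hF; lra.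
Qed.

Let half_pow (k : R) n : k / 2 ^+ n = k / 2 ^+ n.+1 + k / 2 ^+ n.+1.
Proof. by rewrite exprS; field; rewrite expf_neq0. Qed.

Let bisect p : bad p -> exists2 q, bad q & halves p q.
Proof.
case: p => n [x y] [gp bp]; apply: contrapT => nq.
have cF := good_cont gp.
move: gp bp => /and4P[/= h1 h2 h3 h4]; apply/negP.
set L := l / 2 ^+ n.+1; set M := m / 2 ^+ n.+1.
have hL : 0 <= L by rewrite divr_ge0// exprn_ge0.
have hM : 0 <= M by rewrite divr_ge0// exprn_ge0.
have eL : l / 2 ^+ n = L + L by exact: half_pow.
have eM : m / 2 ^+ n = M + M by exact: half_pow.
rewrite eL eM; rewrite eL eM in cF; rewrite eL in h2; rewrite eM in h4.
have small u v : (u == x) || (u == x + L) -> (v == y) || (v == y + M) ->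
    modulus (bnd F u (u + L) v (v + M)) <= e * (L + M) ^+ 2.
  move=> hu hv; rewrite leNgt; apply/negP => bb; apply: nq.
  exists (n.+1, (u, v)).
    split => //; apply/and4P; rewrite /= -/L -/M.
    by case/orP: hu => /eqP ->; case/orP: hv => /eqP ->; split; lra.
  rewrite /halves /= eL eM -/L -/M.
  by case/orP: hu => /eqP ->; case/orP: hv => /eqP ->; split => //; lra.
have gE : e * (L + L + (M + M)) ^+ 2 = 4 * (e * (L + M) ^+ 2) by ring.
rewrite gE; rewrite -leNgt !addrA.
by apply: bnd_quarters => //; [rewrite -!addrA|apply: small..]; rewrite ?eqxx ?orbT.
Qed.

(** Otherwise bad rectangles shrink to a point. There [F] differs from an affine function by a small
    multiple of the size of the rectangle, and the perimeter has that same order, so small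
    rectangles around the point cannot be bad. *)
Lemma goursat_bound : modulus (bnd F x0 (x0 + l) y0 (y0 + m)) <= e * (l + m) ^+ 2.
Proof.
rewrite leNgt; apply/negP => b0.
have bad0 : bad (0%N, (x0, y0)).
  split; last by rewrite /= expr0 !divr1.
  by apply/and4P; rewrite /= expr0 !divr1; split; lra.
have step (p : {p | bad p}) : {q : {q | bad q} | halves (projT1 p) (projT1 q)}.
  apply: cid; case: p => p bp; have [q bq hq] := bisect bp; by exists (exist _ q bq).
have [s [s0 sS]] := @dependent_choice {p | bad p} (fun p q => halves (projT1 p) (projT1 q)) step (exist _ _ bad0).
pose p n := projT1 (s n).
have p1 n : (p n).1 = n.
  by elim: n => [|n IH]; rewrite /p ?s0//; case: (sS n) => ->; rewrite -/(p n) IH.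
have [X hX] : exists X, forall n, (p n).2.1 <= X <= (p n).2.1 + l / 2 ^+ n.
  apply: nested_intervals => // n; have := sS n; rewrite -/(p n) -/(p n.+1) => -[_];
  by rewrite !p1.
have [Y hY] : exists Y, forall n, (p n).2.2 <= Y <= (p n).2.2 + m / 2 ^+ n.
  apply: nested_intervals => // n; have := sS n; rewrite -/(p n) -/(p n.+1) => -[_];
  by rewrite !p1.
have bp n : bad (n, (p n).2) by rewrite -{1}(p1 n) -surjective_pairing; exact: projT2 (s n).
have [q [cq qE]] : hol F (Complex X Y).
  have := hX 0%N; have := hY 0%N; rewrite /p s0 /= expr0 !divr1; by move=> hy hx; exact: hF.
have e4 : 0 < e / 4 by rewrite divr_gt0.
have [d d0 hd] := cq _ e4.
have [n hn] : exists n, l / 2 ^+ n + m / 2 ^+ n < d.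
  have [N hN] : exists N : nat, (l + m) / d < N%:R.
    by exists (Num.truncn ((l + m) / d)).+1; exact: truncnS_gt.
  exists N; rewrite -mulrDl ltr_pdivrMr ?exprn_gt0//.
  rewrite ltr_pdivrMr// in hN; apply: (lt_le_trans hN); rewrite mulrC ler_wpM2l ?(ltW d0)//.
  by rewrite -natrX ler_nat ltnW// ltn_expl.
have [gp bn] := bp n; have cF : rect_cont F (p n).2.1 ((p n).2.1 + l / 2 ^+ n) (p n).2.2 ((p n).2.2 + m / 2 ^+ n).
  by apply: good_cont; rewrite -surjective_pairing.
move: bn; apply/negP; rewrite -leNgt /=.
have {}hX := hX n; have {}hY := hY n.
set x := (p n).2.1 in cF hX *; set y := (p n).2.2 in cF hY *.
set L := l / 2 ^+ n in cF hX hn *; set M := m / 2 ^+ n in cF hY hn *.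
have hL : 0 <= L by rewrite divr_ge0// exprn_ge0.
have hM : 0 <= M by rewrite divr_ge0// exprn_ge0.
set z0 := Complex X Y in cq qE hd; set D := q z0.
have cG : rect_cont (fun z => (F z0 - D * z0) + D * z) x (x + L) y (y + M).
  move=> ? ? _ _; apply: ccontD; first exact: ccont_cst.
  by apply: ccontM; [exact: ccont_cst|exact: ccont_id].
have <- : bnd (fun z => F z - ((F z0 - D * z0) + D * z)) x (x + L) y (y + M) =
    bnd F x (x + L) y (y + M).
  by rewrite bndB ?bnd_affine ?subr0//; lra.
have -> : e * (L + M) ^+ 2 = 2 * (e / 2 * (L + M)) * ((x + L - x) + (y + M - y)) by field.
apply: bnd_le; [lra|lra| |].
  move=> u t hs ht; apply: ccontB; [exact: cF|exact: cG].
move=> u t hs ht; set z : C := Complex u t.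
have -> : F z - (F z0 - D * z0 + D * z) = (q z - D) * (z - z0).
  by rewrite mulrBl -qE; ring.
have zz0 : modulus (z - z0) <= L + M.
  apply: (le_trans (mod_le_ReIm _)); rewrite cReB cImB /=; apply: lerD; rewrite ler_norml; lra.
have : modulus (q z - D) < e / 4 by apply: hd; exact: le_lt_trans zz0 hn.
by rewrite modM; have := mod_ge0 (q z - D); have := mod_ge0 (z - z0); nra.
Qed.

End Bisection.

Lemma goursat F x1 x2 y1 y2 : x1 <= x2 -> y1 <= y2 ->
  (forall x y, x1 <= x <= x2 -> y1 <= y <= y2 -> hol F (Complex x y)) ->
  bnd F x1 x2 y1 y2 = 0.
Proof.
move=> hx hy hF; apply/eqP; rewrite -mod_eq0 eq_le mod_ge0 andbT.
apply/ler_addgt0Pr => e e0; rewrite add0r.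
pose K := (x2 - x1 + (y2 - y1)) ^+ 2 + 1.
have K0 : 0 < K by rewrite ltr_wpDl// sqr_ge0.
have := @goursat_bound F x1 y1 (x2 - x1) (y2 - y1) _ _ _ (e / K) _.
have -> : x1 + (x2 - x1) = x2 by ring.
have -> : y1 + (y2 - y1) = y2 by ring.
move=> h.
apply: (le_trans (h _ _ _ _)); [lra|lra|exact: hF|exact: divr_gt0|].
by rewrite mulrAC ler_pdivrMr// ler_pM2l// /K; lra.
Qed.

(** Goursat's theorem for [H o cexp] on [[ln r1, ln r2] x [a, a + 2 pi]]: the horizontal sides
    cancel by periodicity and the vertical sides are the two means, up to the factor [2 pi]. *)
Lemma cmean_annulus a H r1 r2 : 0 < r1 -> r1 <= r2 ->
  (forall z, r1 <= modulus z <= r2 -> hol H z) ->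
  cmean a (fun z => H (rc r1 * z)) = cmean a (fun z => H (rc r2 * z)).
Proof.
move=> r10 r12 hH; have r20 : 0 < r2 by exact: lt_le_trans r12.
have := @goursat (fun z => H (cexp z)) (ln r1) (ln r2) a (a + 2 * pi).
rewrite ler_ln// r12 period_le /bnd => /(_ isT isT).
have -> : cint (ln r1) (ln r2) (fun x => H (cexp (Complex x (a + 2 * pi)))) =
    cint (ln r1) (ln r2) (fun x => H (cexp (Complex x a))).
  by apply: eq_cint => t _; rewrite cexp_2pi.
rewrite subrr add0r => h.
suff : cint a (a + 2 * pi) (fun y => H (cexp (Complex (ln r2) y))) -
    cint a (a + 2 * pi) (fun y => H (cexp (Complex (ln r1) y))) = 0.
  move=> /eqP; rewrite subr_eq0 => /eqP E; rewrite /cmean; congr (_ * _).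
  transitivity (cint a (a + 2 * pi) (fun y => H (cexp (Complex (ln r1) y)))).
    by apply: eq_cint => t _; rewrite cexp_log.
  by rewrite -E; apply: eq_cint => t _; rewrite cexp_log.
apply/eqP; rewrite -mod_eq0; apply/eqP.
have : modulus (0 : C) = 0 by exact: mod0.
rewrite -{1}h; last first.
  move=> x y hx hy; apply: (hol_comp (hol_cexp _)); apply: hH; rewrite mod_cexp /=.
  case/andP: hx => hx1 hx2.
  by rewrite -(lnK r10) -(lnK r20) !ler_expR hx1.
by rewrite modM modI mul1r.
Qed.

End Goursat.

(** * Mean value property, Cauchy and Poisson formulas *)

Section Cauchy.
Context {R : realType}.
Local Notation C := (cplx R).
Implicit Types (z w v : C) (F G H f g : C -> C) (a r t e : R).

Lemma circ_cont_radius H r : (forall z, modulus z = `|r| -> ccont H z) ->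
  circ_cont (fun z => H (rc r * z)).
Proof.
move=> cH z hz; apply: (@ccont_comp _ (fun z => rc r * z)).
  by apply: ccontM; [exact: ccont_cst|exact: ccont_id].
by apply: cH; rewrite modM mod_rc hz mulr1.
Qed.

(** The mean depends continuously on the radius and is constant below and above [modulus p] by
    [cmean_annulus], hence equal to its value at radius 0. The exceptional point [p] is allowed
    because the difference quotient used in [cauchy] is only known to be continuous there. *)
Lemma mean_value a H (rho : R) (p : C) :
  (forall z, modulus z < rho -> ccont H z) ->
  (forall z, modulus z < rho -> z != p -> hol H z) ->
  forall r, 0 <= r < rho -> cmean a (fun z => H (rc r * z)) = H 0.
Proof.
move=> cH hH.
pose M r := cmean a (fun z => H (rc r * z)).
have M0 : M 0 = H 0.
  rewrite /M -[RHS](cmean_cst a); apply: eq_cmean => z _; by rewrite rc0 mul0r.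
have Mc r0 : 0 <= r0 < rho -> forall e, 0 < e -> exists2 d : R, 0 < d &
    forall r, `|r - r0| < d -> modulus (M r - M r0) <= e.
  move=> /andP[r00 r0r]; apply: (@cmean_radius_cont _ H r0 a (rho - r0)); first lra.
  move=> r z hr hz; apply: cH; rewrite modM mod_rc hz mulr1.
  have := ler_normD (r - r0) r0; rewrite subrK (ger0_norm r00); lra.
have step r : 0 < r < rho -> r != modulus p ->
    exists2 s0, 0 <= s0 < r & (s0 == 0) || (s0 == modulus p) /\ forall s, s0 < s <= r -> M s = M r.
  move=> /andP[r0 rr] rp; have [pr|rp'] := ltP (modulus p) r.
    exists (modulus p); first by rewrite mod_ge0 pr.
    rewrite eqxx orbT; split => // s /andP[s1 s2]; apply: cmean_annulus => //.
      exact: le_lt_trans (mod_ge0 _) s1.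
    move=> z /andP[z1 z2]; apply: hH; first exact: le_lt_trans rr.
    by apply/eqP => zp; move: z1; rewrite zp; lra.
  exists 0; first by rewrite lexx.
  rewrite eqxx; split => // s /andP[s1 s2]; apply: cmean_annulus => //.
  move=> z /andP[z1 z2]; apply: hH; first exact: le_lt_trans rr.
  apply/eqP => zp; move: z2; rewrite zp => h; move: rp; by rewrite eq_le h rp'.
have lim s0 r : 0 <= s0 < r -> r < rho -> (forall s, s0 < s <= r -> M s = M r) -> M r = M s0.
  move=> /andP[s00 s0r] rr Ms; apply/eqP; rewrite -subr_eq0 -mod_eq0 eq_le mod_ge0 andbT.
  apply/ler_addgt0Pr => e e0; rewrite add0r.
  have [|d d0 hd] := Mc s0 _ e e0; first by rewrite s00 (lt_trans s0r).
  pose s := Num.min r (s0 + d / 2).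
  have hs : s0 < s by rewrite /s lt_min s0r; lra.
  rewrite -(Ms s); first by apply: hd; rewrite ger0_norm; [|lra]; rewrite /s /Num.min; case: ifP; lra.
  by rewrite hs ge_min lexx.
have off r : 0 <= r < modulus p -> modulus p < rho -> M r = H 0.
  move=> /andP[]; rewrite le_eqVlt => /predU1P[<-//|r0] rp prho.
  have rr : r < rho by exact: lt_trans prho.
  rewrite -M0; apply: lim => //; first by rewrite lexx.
  move=> s /andP[s1 s2]; apply: cmean_annulus => // z /andP[z1 z2]; apply: hH.
    exact: le_lt_trans rr.
  by apply/eqP => zp; move: z2; rewrite zp; lra.
have at_p : modulus p < rho -> M (modulus p) = H 0.
  move=> prho; have [->//|p0] := eqVneq (modulus p) 0.
  have p0' : 0 < modulus p by rewrite lt_def p0 mod_ge0.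
  apply/eqP; rewrite -subr_eq0 -mod_eq0 eq_le mod_ge0 andbT.
  apply/ler_addgt0Pr => e e0; rewrite add0r.
  have [|d d0 hd] := Mc (modulus p) _ e e0; first by rewrite mod_ge0.
  pose s := Num.max 0 (modulus p - d / 2).
  have hs : 0 <= s < modulus p by rewrite /s /Num.max; case: ifP; lra.
  rewrite -(off s)// mod_distC; apply: hd; rewrite distrC ger0_norm; last lra.
  by rewrite /s /Num.max; case: ifP; lra.
move=> r /andP[]; rewrite le_eqVlt => /predU1P[<- _ //|r0] rr.
have [rp|rp] := eqVneq r (modulus p).
  by rewrite rp -/(M _) at_p// -rp.
have [|s0 /andP[s00 s0r] [/orP s0E Ms]] := step r _ rp; first by rewrite r0.
rewrite -/(M r) (lim s0) ?s00//.
case: s0E => /eqP sE; rewrite sE// at_p//; rewrite -sE; exact: lt_trans rr.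
Qed.

Lemma mean_value1 a H (rho : R) : 1 < rho -> (forall z, modulus z < rho -> hol H z) ->
  cmean a H = H 0.
Proof.
move=> r1 hH; rewrite -(@mean_value a H rho 0 _ _ 1).
- by apply: eq_cmean => z _; rewrite rc1 mul1r.
- by move=> z /hH/hol_ccont.
- by move=> z hz _; exact: hH.
- by rewrite ler01.
Qed.

Lemma conj_circ z : modulus z = 1 -> conjc z = z^-1.
Proof.
move=> hz; have z0 : z != 0 by rewrite -mod_gt0 hz.
by apply: (mulfI z0); rewrite mulJ hz expr1n rc1 divff.
Qed.

Lemma sub1_neq0 z : modulus z < 1 -> 1 - z != 0.
Proof. by apply: contraTneq => /eqP; rewrite subr_eq0 => /eqP <-; rewrite mod1 ltxx. Qed.

Lemma hol_geom (v z : C) : modulus v * modulus z < 1 -> hol (fun z => (1 - v * z)^-1) z.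
Proof.
move=> h; apply: holV; first by rewrite sub1_neq0// modM.
apply: holB; first exact: hol_cst.
by apply: holM; [exact: hol_cst|exact: hol_id].
Qed.

Lemma circ_cont_hol H : (forall z, modulus z = 1 -> hol H z) -> circ_cont H.
Proof. by move=> hH z /hH/hol_ccont. Qed.

Lemma circ_cont_geom v : modulus v < 1 -> circ_cont (fun z => (1 - v * z)^-1).
Proof. by move=> hv z hz; apply/hol_ccont/hol_geom; rewrite hz mulr1. Qed.

Lemma circ_cont_geomJ v : modulus v < 1 -> circ_cont (fun z => (1 - v * conjc z)^-1).
Proof.
move=> hv z hz; apply: (@ccont_comp _ (fun z => conjc z : C) (fun z => (1 - v * z)^-1)); first exact: ccontJ.
by apply/hol_ccont/hol_geom; rewrite modJ hz mulr1.
Qed.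

Lemma radius_lt (v : C) (rho : R) : modulus v < 1 -> 1 < rho ->
  exists2 rho' : R, 1 < rho' <= rho & forall z, modulus z < rho' -> modulus v * modulus z < 1.
Proof.
move=> hv hr; have [v0|v0] := eqVneq v 0.
  by exists rho; [rewrite hr/=|move=> z _; rewrite v0 mod0 mul0r].
have v0' : 0 < modulus v by rewrite mod_gt0.
exists (Num.min rho (modulus v)^-1).
  by rewrite lt_min hr invf_gt1// hv ge_min lexx.
by move=> z; rewrite lt_min => /andP[_]; rewrite -ltr_pdivlMl// mulr1.
Qed.

(** With [q] the difference quotient of [g] at [v], the function [z q(z)] has mean 0, and on the
    circle it equals [(g z - g v) / (1 - v * conjc z)]. There the kernel is the usual
    [z / (z - v)]. *)
Lemma cauchy a g (rho : R) v : 1 < rho -> (forall z, modulus z < rho -> hol g z) ->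
  modulus v < 1 -> cmean a (fun z => g z * (1 - v * conjc z)^-1) = g v.
Proof.
move=> r1 hg v1.
have cg : circ_cont g by apply: circ_cont_hol => z hz; apply: hg; rewrite hz.
have [q [cq qE]] := hg v (lt_trans v1 r1).
have : cmean a (fun z => z * q z) = 0.
  have -> : 0 = 0 * q 0 :> C by rewrite mul0r.
  rewrite -(@mean_value a (fun z => z * q z) rho v _ _ 1) ?ler01//.
  - by apply: eq_cmean => z _; rewrite rc1 mul1r.
  - move=> z hz; apply: ccontM; first exact: ccont_id.
    have [->//|zv] := eqVneq z v; apply: hol_ccont.
    have zv0 : 0 < modulus (z - v) by rewrite mod_gt0 subr_eq0.
    apply: (@hol_local _ _ (fun w => (g w - g v) * (w - v)^-1) _ _ zv0) => [w wz|].
      rewrite qE mulfK// subr_eq0; apply/eqP => wv; move: wz.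
      by rewrite wv mod_distC ltxx.
    apply: holM; first by apply: holB; [exact: hg|exact: hol_cst].
    by apply: holV; [rewrite subr_eq0|apply: holB; [exact: hol_id|exact: hol_cst]].
  - move=> z hz zv; apply: holM; first exact: hol_id.
    have zv0 : 0 < modulus (z - v) by rewrite mod_gt0 subr_eq0.
    apply: (@hol_local _ _ (fun w => (g w - g v) * (w - v)^-1) _ _ zv0) => [w wz|].
      rewrite qE mulfK// subr_eq0; apply/eqP => wv; move: wz.
      by rewrite wv mod_distC ltxx.
    apply: holM; first by apply: holB; [exact: hg|exact: hol_cst].
    by apply: holV; [rewrite subr_eq0|apply: holB; [exact: hol_id|exact: hol_cst]].
have cK := circ_cont_geomJ v1.
have -> : cmean a (fun z => z * q z) =
    cmean a (fun z => g z * (1 - v * conjc z)^-1 - g v * (1 - v * conjc z)^-1).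
  apply: eq_cmean => z hz; have z0 : z != 0 by rewrite -mod_gt0 hz.
  have zv : z - v != 0.
    by rewrite subr_eq0; apply/eqP => zv; move: v1; rewrite -zv hz ltxx.
  rewrite conj_circ// -mulrBl qE; field; by rewrite zv z0.
rewrite cmeanB; [|exact: circ_contM|apply: circ_contM => //; exact: circ_cont_cst].
rewrite cmeanZ//; have -> : cmean a (fun z => (1 - v * conjc z)^-1) = 1.
  have vJ : modulus (conjc v) < 1 by rewrite modJ.
  have [rho' /andP[r'1 _] hr'] := radius_lt vJ r1.
  rewrite -(conjK (cmean _ _)) -cmean_conj//.
  rewrite (@eq_cmean _ _ _ (fun z => (1 - conjc v * z)^-1)); last first.
    move=> z _; rewrite (complex.conjc_inv (1 - v * conjc z)).
    by rewrite conjD conjN conjM conjK (conj_rc 1).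
  rewrite (@mean_value1 _ _ rho')//.
    by rewrite mulr0 subr0 invr1; exact: (conj_rc 1).
  by move=> z /hr'; exact: hol_geom.
by rewrite mulr1 => /eqP; rewrite subr_eq0 => /eqP.
Qed.

(** The Poisson kernel of the point [v] of the disk at the point [z] of the circle is
    [poisson (v * conjc z)]. *)
Definition poisson (u : C) : R := (1 - modulus u ^+ 2) / modulus (1 - u) ^+ 2.

Lemma poissonE u : modulus u < 1 -> rc (poisson u) = (1 - u)^-1 + conjc u * (1 - conjc u)^-1.
Proof.
move=> u1; have n0 := sub1_neq0 u1.
have n1 : 1 - conjc u != 0 by apply: sub1_neq0; rewrite modJ.
rewrite /poisson rcM rcV -mulJ conjD conjN (conj_rc 1) rcB -mulJ rc1.
by field; rewrite n0 n1.
Qed.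

Lemma poisson_ge0 u : modulus u < 1 -> 0 <= poisson u.
Proof.
move=> u1; rewrite divr_ge0 ?sqr_ge0// subr_ge0 expr_le1 ?mod_ge0//.
exact: ltW.
Qed.

(** By [poissonE] the kernel is Cauchy's kernel plus a term which, multiplied by [g], is holomorphic
    past the circle and vanishes at 0. *)
Lemma poisson_formula a g (rho : R) v : 1 < rho -> (forall z, modulus z < rho -> hol g z) ->
  modulus v < 1 -> cmean a (fun z => g z * rc (poisson (v * conjc z))) = g v.
Proof.
move=> r1 hg v1.
have cg : circ_cont g by apply: circ_cont_hol => z hz; apply: hg; rewrite hz.
have vJ : modulus (conjc v) < 1 by rewrite modJ.
have cK := circ_cont_geomJ v1.
have cK' := circ_cont_geom vJ.
rewrite (@eq_cmean _ _ _ (fun z => g z * (1 - v * conjc z)^-1 +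
    g z * (conjc v * z * (1 - conjc v * z)^-1))); last first.
  move=> z hz; rewrite poissonE; last by rewrite modM modJ hz mulr1.
  by rewrite conjM conjK mulrDr.
have cid : circ_cont (fun z => conjc v * z).
  by apply: circ_contM; [exact: circ_cont_cst|move=> z _; exact: ccont_id].
rewrite cmeanD; [|exact: circ_contM|by apply: circ_contM => //; exact: circ_contM].
rewrite (@cauchy a g rho v)// [X in _ + X](_ : _ = 0) ?addr0//.
have [rho' /andP[r'1 rr'] hr'] := radius_lt vJ r1.
rewrite (@mean_value1 _ _ rho')//; first by rewrite mulr0 mul0r mulr0.
move=> z hz; apply: holM; first by apply: hg; exact: lt_le_trans rr'.
apply: holM; last by apply: hol_geom; exact: hr'.
by apply: holM; [exact: hol_cst|exact: hol_id].
Qed.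

Lemma ccont_poisson u : modulus u < 1 -> ccont (fun u => rc (poisson u)) u.
Proof.
move=> u1; have d0 : 0 < 1 - modulus u by rewrite subr_gt0.
apply: (@ccont_local _ _ (fun u => (1 - u)^-1 + conjc u * (1 - conjc u)^-1) _ _ d0).
  by move=> w hw; apply: poissonE; have := modD (w - u) u; rewrite subrK; lra.
have c1 w : ccont (fun w : C => 1 - w) w by apply: ccontB; [exact: ccont_cst|exact: ccont_id].
have cV w : modulus w < 1 -> ccont (fun w : C => (1 - w)^-1) w.
  move=> w1; apply: (@ccont_comp _ (fun w => 1 - w) (fun w => w^-1)) => //.
  exact/ccontV/sub1_neq0.
apply: ccontD; first exact: cV.
apply: ccontM; first exact: ccontJ.
apply: (@ccont_comp _ (fun u => conjc u : C) (fun w => (1 - w)^-1)); first exact: ccontJ.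
by apply: cV; rewrite modJ.
Qed.

Lemma circ_cont_poisson v : modulus v < 1 -> circ_cont (fun z => rc (poisson (v * conjc z))).
Proof.
move=> v1 z hz; apply: (@ccont_comp _ (fun z => v * conjc z) (fun u => rc (poisson u))).
  by apply: ccontM; [exact: ccont_cst|exact: ccontJ].
by apply: ccont_poisson; rewrite modM modJ hz mulr1.
Qed.

End Cauchy.

(** * Fourier coefficients and Parseval's identity *)

Section Fourier.
Context {R : realType}.
Local Notation C := (cplx R).
Implicit Types (z w v : C) (F G H f g : C -> C) (a r t e : R) (b c : nat -> C).

Definition fpoly b (N : nat) (z : C) : C := \sum_(0 <= k < N) b k * z ^+ k.

Definition expands F b : Prop := circ_cont F /\ forall e, 0 < e ->
  exists N0, forall N, (N0 <= N)%N -> forall z, modulus z = 1 ->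
    modulus (F z - fpoly b N z) <= e.

Lemma circ_cont_monoZ b k : circ_cont (fun z => b k * z ^+ k).
Proof. by apply: circ_contM; [exact: circ_cont_cst|exact: circ_contX]. Qed.

Lemma circ_cont_fpoly b N : circ_cont (fpoly b N).
Proof. by apply: circ_cont_sum => k; exact: circ_cont_monoZ. Qed.

Lemma circ_contXJ n : circ_cont (fun z : C => conjc z ^+ n).
Proof. by move=> z _; apply: (@ccontX _ (fun z => conjc z : C)); exact: ccontJ. Qed.

Lemma cmean_X a n : cmean a (fun z : C => z ^+ n) = (n == 0%N)%:R.
Proof.
rewrite (@mean_value1 _ a _ 2) ?ltr1n//; first by rewrite expr0n.
by move=> z _; apply: holX; exact: hol_id.
Qed.

Lemma mulJ_circ z : modulus z = 1 -> z * conjc z = 1.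
Proof. by move=> hz; rewrite mulJ hz expr1n. Qed.

Lemma cmean_XJ a j k : cmean a (fun z : C => z ^+ j * conjc z ^+ k) = (j == k)%:R.
Proof.
have up m n : cmean a (fun z : C => z ^+ (m + n) * conjc z ^+ n) = (m == 0%N)%:R.
  rewrite -(cmean_X a); apply: eq_cmean => z hz.
  by rewrite exprD -mulrA -exprMn mulJ_circ// expr1n mulr1.
have [jk|kj] := leqP k j.
  by rewrite -{1}(subnK jk) up subn_eq0 [j == k]eqn_leq jk andbT.
rewrite (@eq_cmean _ _ _ (fun z => conjc (z ^+ k * conjc z ^+ j))); last first.
  by move=> z _; rewrite conjM !conjX conjK mulrC.
rewrite cmean_conj; last by apply: circ_contM; [exact: circ_contX|exact: circ_contXJ].
by rewrite -{1}(subnK (ltnW kj)) up subn_eq0 leqNgt kj [j == k]eqn_leq [(k <= j)%N]leqNgt kj andbF (conj_rc 0).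
Qed.

Lemma cmean_fpoly_coef a b N n : (n < N)%N -> cmean a (fun z => fpoly b N z * conjc z ^+ n) = b n.
Proof.
move=> nN; rewrite (@eq_cmean _ _ _ (fun z => \sum_(0 <= k < N) b k * (z ^+ k * conjc z ^+ n))); last first.
  by move=> z _; rewrite /fpoly big_distrl /=; apply: eq_bigr => k _; rewrite mulrA.
have cX k : circ_cont (fun z : C => z ^+ k * conjc z ^+ n).
  by apply: circ_contM; [exact: circ_contX|exact: circ_contXJ].
rewrite cmean_sum; last by move=> k; apply: circ_contM => //; exact: circ_cont_cst.
rewrite (eq_bigr (fun k => b k * (k == n)%:R)); last by move=> k _; rewrite cmeanZ// cmean_XJ.
rewrite big_mkord (bigD1 (Ordinal nN))//= eqxx mulr1 big1 ?addr0// => i.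
by rewrite -val_eqE /= => /negbTE ->; rewrite mulr0.
Qed.

Lemma expands_coef a F b n : expands F b -> cmean a (fun z => F z * conjc z ^+ n) = b n.
Proof.
move=> [cF eF]; apply/eqP; rewrite -subr_eq0 -mod_eq0 eq_le mod_ge0 andbT.
apply/ler_addgt0Pr => e e0; rewrite add0r; have [N0 hN] := eF e e0.
have := hN (maxn N0 n.+1) (leq_maxl _ _); set N := maxn _ _ => {}hN.
rewrite -(@cmean_fpoly_coef a b N n) ?leq_maxr// -cmeanB; first 1 last.
- by apply: circ_contM => //; exact: circ_contXJ.
- by apply: circ_contM; [exact: circ_cont_fpoly|exact: circ_contXJ].
apply: mod_cmean_le => [|z hz].
  apply: circ_contD; [|apply: circ_contN]; apply: circ_contM => //;
  by [exact: circ_contXJ|exact: circ_cont_fpoly].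
by rewrite -mulrBl modM modX modJ hz expr1n mulr1; exact: hN.
Qed.

Lemma rmean_normsq a F : circ_cont F ->
  rc (rmean a (fun z => modulus (F z) ^+ 2)) = cmean a (fun z => F z * conjc (F z)).
Proof. by move=> cF; rewrite -cmean_rc; apply: eq_cmean => z _; rewrite mulJ. Qed.

Lemma cmean_fpolyJ a F b c N : circ_cont F ->
  (forall n, (n < N)%N -> cmean a (fun z => F z * conjc z ^+ n) = c n) ->
  cmean a (fun z => F z * conjc (fpoly b N z)) = \sum_(0 <= k < N) c k * conjc (b k).
Proof.
move=> cF hc.
rewrite (@eq_cmean _ _ _ (fun z => \sum_(0 <= k < N) conjc (b k) * (F z * conjc z ^+ k))); last first.
  move=> z _; rewrite /fpoly conj_sum big_distrr /=; apply: eq_bigr => k _.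
  by rewrite conjM conjX mulrCA.
have cX k : circ_cont (fun z => F z * conjc z ^+ k).
  by apply: circ_contM => //; exact: circ_contXJ.
rewrite cmean_sum; last by move=> k; apply: circ_contM => //; exact: circ_cont_cst.
by rewrite !big_nat; apply: eq_bigr => k /andP[_ kN]; rewrite cmeanZ// hc// mulrC.
Qed.

(** Pythagoras: [F] and its partial sum have the same first [N] coefficients, so the remainder is
    orthogonal to the partial sum. *)
Lemma parseval_identity a F b N : expands F b ->
  rmean a (fun z => modulus (F z) ^+ 2) =
  \sum_(0 <= k < N) modulus (b k) ^+ 2 + rmean a (fun z => modulus (F z - fpoly b N z) ^+ 2).
Proof.
move=> eF; have [cF _] := eF; apply: rc_inj; rewrite rcD rc_sum.
pose S := fpoly b N; have cS : circ_cont S by exact: circ_cont_fpoly.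
have cB : circ_cont (fun z => F z - S z) by apply: circ_contD => //; exact: circ_contN.
rewrite !rmean_normsq//.
have FS : cmean a (fun z => F z * conjc (S z)) = \sum_(0 <= k < N) rc (modulus (b k) ^+ 2).
  rewrite (@cmean_fpolyJ a F b b)//; last by move=> n _; exact: expands_coef.
  by apply: eq_bigr => k _; rewrite mulJ.
have SS : cmean a (fun z => S z * conjc (S z)) = \sum_(0 <= k < N) rc (modulus (b k) ^+ 2).
  rewrite (@cmean_fpolyJ a S b b)//; last by move=> n nN; exact: cmean_fpoly_coef.
  by apply: eq_bigr => k _; rewrite mulJ.
have SF : cmean a (fun z => S z * conjc (F z)) = \sum_(0 <= k < N) rc (modulus (b k) ^+ 2).
  rewrite (@eq_cmean _ _ _ (fun z => conjc (F z * conjc (S z)))); last first.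
    by move=> z _; rewrite conjM conjK mulrC.
  rewrite cmean_conj ?FS; last by apply: circ_contM => //; exact: circ_contJ.
  by rewrite -rc_sum conj_rc.
have cM G H : circ_cont G -> circ_cont H -> circ_cont (fun z => G z * conjc (H z)).
  by move=> cG cH; apply: circ_contM => //; exact: circ_contJ.
rewrite (@eq_cmean _ a (fun z => (F z - fpoly b N z) * _) (fun z => (F z * conjc (F z) + S z * conjc (S z)) -
   (F z * conjc (S z) + S z * conjc (F z)))); last first.
  by move=> z _; rewrite -/(S z) conjD conjN; ring.
rewrite cmeanB ?cmeanD ?FS ?SS ?SF; [ring| | | | | |];
  by [exact: cM|apply: circ_contD; exact: cM].
Qed.

Lemma bessel a F b N : expands F b ->
  \sum_(0 <= k < N) modulus (b k) ^+ 2 <= rmean a (fun z => modulus (F z) ^+ 2).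
Proof.
move=> /(parseval_identity a N) ->; rewrite lerDl; apply: rmean_ge0 => z _.
exact: sqr_ge0.
Qed.

Lemma parseval_le a F b (B : R) : expands F b ->
  (forall N, \sum_(0 <= k < N) modulus (b k) ^+ 2 <= B) ->
  rmean a (fun z => modulus (F z) ^+ 2) <= B.
Proof.
move=> eF hB; have [cF uF] := eF; apply/ler_addgt0Pr => e e0.
have [|N0 hN] := uF (Num.min 1 e); first by rewrite lt_min ltr01.
rewrite (parseval_identity a N0 eF); apply: lerD => //.
rewrite -(rmean_cst a e).
have cB : circ_cont (fun z => F z - fpoly b N0 z).
  by apply: circ_contD => //; apply: circ_contN; exact: circ_cont_fpoly.
apply: le_rmean; [exact: circ_cont_modX|exact: circ_cont_cst|].
move=> z /(hN _ (leqnn _)); rewrite le_min => /andP[h1 h2].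
by rewrite expr2; have := mod_ge0 (F z - fpoly b N0 z); nra.
Qed.

End Fourier.

(** * Taylor coefficients on the disk *)

Section Taylor.
Context {R : realType}.
Local Notation C := (cplx R).
Implicit Types (z w v : C) (F G H f g : C -> C) (a r t e : R) (b c : nat -> C).

Definition hol_disk f : Prop := forall z, modulus z < 1 -> hol f z.

Lemma analytic_hol f : analytic_on_disk f <-> hol_disk f.
Proof. by split=> h z hz; apply/derivable_hol; exact: h. Qed.

Lemma hol_disk_scale f r : hol_disk f -> 0 < r ->
  forall z, modulus z < r^-1 -> hol (fun z => f (rc r * z)) z.
Proof.
move=> hf r0 z hz; apply: (@hol_comp _ (fun z => rc r * z)).
  by apply: holM; [exact: hol_cst|exact: hol_id].
by apply: hf; rewrite modM mod_rc gtr0_norm// mulrC -ltr_pdivlMr// mul1r.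
Qed.

Lemma hol_disk_circ f r : hol_disk f -> 0 <= r < 1 -> circ_cont (fun z => f (rc r * z)).
Proof.
move=> hf /andP[r0 r1]; apply: circ_cont_radius => z hz; apply/hol_ccont/hf.
by rewrite hz ger0_norm.
Qed.

(** The radius [2^-1] is an arbitrary choice and [2 ^ n] undoes its power: [taylor_radius] shows
    that every radius gives the same coefficient. *)
Definition taylor f (n : nat) : C :=
  rc (2 ^+ n) * cmean 0 (fun z => f (rc 2^-1 * z) * conjc z ^+ n).

(** The function [f z / z ^ n] is holomorphic off 0, so its circle means do not depend on the
    radius. *)
Lemma taylor_radius f r n : hol_disk f -> 0 < r < 1 ->
  cmean 0 (fun z => f (rc r * z) * conjc z ^+ n) = taylor f n * rc (r ^+ n).
Proof.
move=> hf /andP[r0 r1].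
pose H z := f z * (z ^+ n)^-1.
have HE s : 0 < s < 1 -> rc (s ^+ n) * cmean 0 (fun z => H (rc s * z)) =
    cmean 0 (fun z => f (rc s * z) * conjc z ^+ n).
  move=> hs; have s0 : s != 0 by case/andP: hs => ? _; rewrite gt_eqF.
  have hs' : 0 <= s < 1 by case/andP: hs => /ltW -> ->.
  rewrite (@eq_cmean _ _ (fun z => H (rc s * z)) (fun z => rc (s ^+ n)^-1 * (f (rc s * z) * conjc z ^+ n))).
    rewrite cmeanZ ?mulrA -?rcM ?divff ?expf_neq0 ?rc1 ?mul1r//.
    by apply: circ_contM; [exact: hol_disk_circ|exact: circ_contXJ].
  move=> z hz; rewrite /H exprMn invfM conj_circ// exprVn rcV rcX; ring.
have HC s1 s2 : 0 < s1 -> s1 <= s2 -> s2 < 1 ->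
    cmean 0 (fun z => H (rc s1 * z)) = cmean 0 (fun z => H (rc s2 * z)).
  move=> s10 s12 s21; apply: cmean_annulus => // z /andP[z1 z2]; apply: holM.
    by apply: hf; exact: le_lt_trans s21.
  apply: holV; first by rewrite expf_neq0// -mod_gt0; exact: lt_le_trans z1.
  by apply: holX; exact: hol_id.
have h2 : 0 < (2^-1 : R) < 1 by rewrite invr_gt0 ltr0n invf_lt1// ltr1n.
rewrite -HE ?r0// /taylor -HE// mulrA -rcM -exprMn mulfV// expr1n rc1 mul1r mulrC.
suff -> : cmean 0 (fun z => H (rc r * z)) = cmean 0 (fun z => H (rc 2^-1 * z)) by [].
have [h|h] := leP r 2^-1.
  by apply: HC => //; case/andP: h2.
by apply/esym/HC; [case/andP: h2|exact: ltW|].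
Qed.

Lemma geom_sum (u : C) N : \sum_(0 <= j < N) u ^+ j * (1 - u) + u ^+ N = 1.
Proof.
elim: N => [|N IH]; first by rewrite big_nil expr0 add0r.
by rewrite big_nat_recr//= -[RHS]IH exprS; ring.
Qed.

Lemma geomE (u : C) N : 1 - u != 0 ->
  (1 - u)^-1 = \sum_(0 <= j < N) u ^+ j + u ^+ N * (1 - u)^-1.
Proof.
move=> u0; apply: (mulIf u0); rewrite mulVf// mulrDl mulfVK// big_distrl /=.
by rewrite geom_sum.
Qed.

(** Cauchy's formula on the circle of radius [r], with the first [N] terms of the geometric series
    of the kernel split off; what remains contains the factor [(w conj z)^N / (1 - w conj z)]. *)
Lemma taylor_bound f r (M : R) w N : hol_disk f -> 0 < r < 1 ->
  (forall z, modulus z = 1 -> modulus (f (rc r * z)) <= M) -> modulus w < 1 ->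
  modulus (f (rc r * w) - \sum_(0 <= k < N) taylor f k * (rc r * w) ^+ k) <=
    M * modulus w ^+ N / (1 - modulus w).
Proof.
move=> hf hr hM w1; have /andP[r0 r1] := hr.
have r01 : 0 <= r < 1 by rewrite ltW.
have M0 : 0 <= M by apply: le_trans (hM 1 _); [exact: mod_ge0|exact: mod1].
pose g z := f (rc r * z); have cg : circ_cont g by exact: hol_disk_circ.
have hg := hol_disk_scale hf r0.
have ri : 1 < r^-1 by rewrite invf_gt1.
have cK := circ_cont_geomJ w1.
have cX k : circ_cont (fun z => g z * conjc z ^+ k) by apply: circ_contM => //; exact: circ_contXJ.
have cXZ k : circ_cont (fun z => w ^+ k * (g z * conjc z ^+ k)).
  by apply: circ_contM => //; exact: circ_cont_cst.
have n0 z : modulus z = 1 -> 1 - w * conjc z != 0.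
  by move=> hz; rewrite sub1_neq0// modM modJ hz mulr1.
have -> : f (rc r * w) - \sum_(0 <= k < N) taylor f k * (rc r * w) ^+ k =
    cmean 0 (fun z => g z * (w * conjc z) ^+ N * (1 - w * conjc z)^-1).
  have -> : f (rc r * w) = cmean 0 (fun z => g z * (1 - w * conjc z)^-1).
    by rewrite (@cauchy _ 0 g r^-1 w).
  rewrite (@eq_cmean _ _ _ (fun z =>
     \sum_(0 <= k < N) w ^+ k * (g z * conjc z ^+ k) +
     g z * (w * conjc z) ^+ N * (1 - w * conjc z)^-1)); last first.
    move=> z hz; rewrite {1}(geomE N (n0 z hz)) mulrDr mulrA big_distrr /=; congr (_ + _).
    by apply: eq_bigr => k _; rewrite exprMn mulrCA.
  rewrite cmeanD; first 1 last.
  - by apply: circ_cont_sum.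
  - apply: circ_contM => //; apply: circ_contM => // z hz; apply: ccontX.
    by apply: ccontM; [exact: ccont_cst|exact: ccontJ].
  rewrite cmean_sum// addrAC [X in X - _](_ : _ = \sum_(0 <= k < N) taylor f k * (rc r * w) ^+ k).
    by rewrite subrr add0r.
  apply: eq_bigr => k _; rewrite cmeanZ// taylor_radius// exprMn rcX; ring.
apply: mod_cmean_le => [|z hz].
  apply: circ_contM => //; apply: circ_contM => // z hz; apply: ccontX.
  by apply: ccontM; [exact: ccont_cst|exact: ccontJ].
rewrite !modM modV modX modM modJ hz mulr1.
apply: ler_pM.
- by rewrite mulr_ge0 ?exprn_ge0 ?mod_ge0.
- by rewrite invr_ge0 mod_ge0.
- by apply: ler_wpM2r; [rewrite exprn_ge0// mod_ge0|exact: hM].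
rewrite lef_pV2 ?posrE ?subr_gt0 ?mod_gt0 ?n0//.
by have := mod_sub_ge 1 (w * conjc z); rewrite mod1 modM modJ hz mulr1.
Qed.

Lemma circ_polar z : modulus z = 1 -> exists2 t, - pi <= t <= pi & z = cis t.
Proof.
move=> hz; have hx := Re_le_mod z; rewrite hz in hx.
have hx' : -1 <= complex.Re z <= 1 by rewrite -ler_norml.
have sE : Num.sqrt (1 - complex.Re z ^+ 2) = `|complex.Im z|.
  by rewrite -sqrtr_sqr; congr Num.sqrt; have := mod_sqr z; rewrite hz expr1n => ->; ring.
have h1 := acos_ge0 hx'; have h2 := acos_lepi hx'.
have [i0|i0] := leP 0 (complex.Im z).
  exists (acos (complex.Re z)); first lra.
  by apply: C_eq; rewrite /= ?acosK// sin_acos// sE ger0_norm.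
exists (- acos (complex.Re z)); first lra.
by apply: C_eq; rewrite /= ?cosN ?acosK// sinN sin_acos// sE ltr0_norm// opprK.
Qed.

Lemma circ_cont_bounded H : circ_cont H ->
  exists2 M : R, 0 <= M & forall z, modulus z = 1 -> modulus (H z) <= M.
Proof.
move=> cH; have pp : - pi <= pi :> R by have := pi_gt0 R; lra.
have cm : {within `[- pi, pi], continuous (fun t => modulus (H (cis t)))}.
  apply: continuous_in_subspaceT => t; rewrite inE /= in_itv /= => ht.
  have := @rcont_on_mod _ (- pi) pi (fun t => H (cis t)) (@circ_rcont _ H (- pi) pi cH).
  by move=> /(_ t ht).
have [c _ hc] := EVT_max pp cm; exists (modulus (H (cis c))); first exact: mod_ge0.
by move=> z /circ_polar[t ht ->]; apply: hc; rewrite in_itv.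
Qed.

Lemma taylor_expands f r : hol_disk f -> 0 <= r < 1 ->
  expands (fun z => f (rc r * z)) (fun k => taylor f k * rc (r ^+ k)).
Proof.
move=> hf /andP[r0 r1]; split; first by apply: hol_disk_circ => //; rewrite r0.
(* A radius strictly between [r] and 1: on the circle of radius [r] the remainder then decays like
   [(r / s) ^ N]. *)
pose s := (1 + r) / 2; have s0 : 0 < s by rewrite /s; lra.
have s1 : s < 1 by rewrite /s; lra.
have rs : r < s by rewrite /s; lra.
have [M M0 hM] := circ_cont_bounded (@hol_disk_circ f s hf ltac:(lra)).
pose q := r / s; have q0 : 0 <= q by rewrite divr_ge0// ltW.
have q1 : q < 1 by rewrite ltr_pdivrMr// mul1r.
move=> e e0; have [N0 hN] : exists N0 : nat, M * q ^+ N0 / (1 - q) <= e.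
  have [M_0|M_0] := eqVneq M 0; first by exists 0%N; rewrite M_0 !mul0r ltW.
  have Mp : 0 < M by rewrite lt_def M_0.
  have qq : `|q| < 1 by rewrite ger0_norm.
  have e1 : 0 < e * (1 - q) / M by rewrite divr_gt0// mulr_gt0// subr_gt0.
  have /cvgrPdist_le/(_ _ e1)[N0 _ hN] := cvg_expr qq; exists N0.
  have := hN N0 (leqnn _); rewrite /= sub0r normrN ger0_norm ?exprn_ge0//.
  by rewrite ler_pdivlMr// => h; rewrite ler_pdivrMr ?subr_gt0// mulrC.
exists N0 => N NN z hz.
have wE : rc r * z = rc s * (rc q * z).
  by rewrite mulrA -rcM /q mulrCA divff ?mulr1// gt_eqF.
have wq : modulus (rc q * z) = q by rewrite modM hz mulr1 mod_rc ger0_norm.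
have := @taylor_bound f s M (rc q * z) N hf _ hM; rewrite s0 s1 wq -wE => /(_ isT q1).
have -> : fpoly (fun k => taylor f k * rc (r ^+ k)) N z = \sum_(0 <= k < N) taylor f k * (rc r * z) ^+ k.
  by apply: eq_bigr => k _; rewrite exprMn rcX mulrA.
move=> h; apply: (le_trans h); apply: le_trans hN.
apply: ler_wpM2r; first by rewrite invr_ge0 subr_ge0 ltW.
by apply: ler_wpM2l => //; apply: ler_wiXn2l => //; exact: ltW.
Qed.

Lemma expands_uniq F b c : expands F b -> expands F c -> b = c.
Proof.
by move=> hb hc; apply/funext => n; rewrite -(expands_coef 0 n hb); exact: expands_coef.
Qed.

Lemma taylor_uniq f r b : hol_disk f -> 0 < r < 1 ->
  expands (fun z => f (rc r * z)) (fun k => b k * rc (r ^+ k)) -> b = taylor f.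
Proof.
move=> hf /andP[r0 r1] /expands_uniq/(_ (taylor_expands hf _)) E.
apply/funext => k; have := congr1 (fun u => u k) (E ltac:(lra)); apply: mulIf.
by rewrite rc_neq0 expf_neq0// gt_eqF.
Qed.

End Taylor.

(** * Power series with bounded coefficients *)

Section PowerSeries.
Context {R : realType}.
Local Notation C := (cplx R).
Implicit Types (z w v : C) (F G H f g : C -> C) (a r t e s K : R) (b c : nat -> C).

Lemma geom_sum_le s N : 0 <= s < 1 -> \sum_(0 <= j < N) s ^+ j <= (1 - s)^-1.
Proof.
move=> /andP[s0 s1]; have h : (\sum_(0 <= j < N) s ^+ j) * (1 - s) + s ^+ N = 1.
  elim: N => [|N IH]; first by rewrite big_nil mul0r expr0 add0r.
  by rewrite big_nat_recr//= -[RHS]IH exprS; ring.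
rewrite -[leRHS]mul1r ler_pdivlMr ?subr_gt0//.
by have := exprn_ge0 N s0; lra.
Qed.

Lemma geom_vanish s K e : 0 <= s < 1 -> 0 < e -> exists N0, forall N, (N0 <= N)%N -> K * s ^+ N <= e.
Proof.
move=> /andP[s0 s1] e0.
have K0 : 0 < `|K| + 1 by have := normr_ge0 K; lra.
have s1' : `|s| < 1 by rewrite ger0_norm.
have /cvgrPdist_le/(_ _ (divr_gt0 e0 K0))[N0 _ hN] := cvg_expr s1'.
exists N0 => N /hN; rewrite /= sub0r normrN ger0_norm ?exprn_ge0// ler_pdivlMr// => h.
apply: le_trans h; rewrite mulrC ler_wpM2l ?exprn_ge0//; have := ler_norm K; lra.
Qed.

Lemma geom_squeeze s K (x : R) : 0 <= s < 1 -> (forall N, x <= K * s ^+ N) -> x <= 0.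
Proof.
move=> hs hx; apply/ler_addgt0Pr => e e0; rewrite add0r.
by have [N0 hN] := geom_vanish K hs e0; apply: (le_trans (hx N0)); exact: hN.
Qed.

Lemma real_tail (u : nat -> R) K s : 0 <= s < 1 -> (forall k, `|u k| <= K * s ^+ k) ->
  forall N, `|limn (series u) - \sum_(0 <= k < N) u k| <= K * s ^+ N / (1 - s).
Proof.
move=> hs hu N; have /andP[s0 s1] := hs.
have K0 : 0 <= K by have := hu 0%N; rewrite expr0 mulr1; apply: le_trans; exact: normr_ge0.
have cu : cvgn (series u).
  apply: normed_cvg; apply: (@series_le_cvg _ _ (geometric K s)).
  - by move=> n; exact: normr_ge0.
  - by move=> n; rewrite /= mulr_ge0// exprn_ge0.
  - by move=> n; exact: hu.
  - by apply: is_cvg_geometric_series; rewrite ger0_norm.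
have part M : (N <= M)%N -> `|\sum_(0 <= k < M) u k - \sum_(0 <= k < N) u k| <= K * s ^+ N / (1 - s).
  move=> NM; rewrite (@big_cat_nat _ _ _ N)//= addrAC subrr add0r.
  apply: (le_trans (ler_norm_sum _ _ _)).
  apply: (@le_trans _ _ (\sum_(N <= k < M) K * s ^+ k)); first by apply: ler_sum => k _; exact: hu.
  rewrite -{1}[N]add0n big_addn.
  rewrite (eq_bigr (fun k => K * s ^+ N * s ^+ k)); last by move=> k _; rewrite exprD; ring.
  rewrite -big_distrr /=; apply: ler_wpM2l; first by rewrite mulr_ge0// exprn_ge0.
  exact: geom_sum_le.
have lu : (fun M => `|series u M - \sum_(0 <= k < N) u k|) @ \oo --> `|limn (series u) - \sum_(0 <= k < N) u k|.
  by apply: cvg_norm; apply: cvgB; [exact: cu|exact: cvg_cst].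
apply: (limr_le_near lu) || (rewrite -(cvg_lim _ lu)//; apply: limr_le); first by apply/cvg_ex; eexists; exact: lu.
by exists N => // M /= NM; exact: part.
Qed.

Definition csum (u : nat -> C) : C :=
  Complex (limn (series (fun k => complex.Re (u k)))) (limn (series (fun k => complex.Im (u k)))).

Lemma csum_tail (u : nat -> C) K s : 0 <= s < 1 -> (forall k, modulus (u k) <= K * s ^+ k) ->
  forall N, modulus (csum u - \sum_(0 <= k < N) u k) <= 2 * K / (1 - s) * s ^+ N.
Proof.
move=> hs hu N; apply: (le_trans (mod_le_ReIm _)); rewrite cReB cImB Re_sum Im_sum /=.
have hR k : `|complex.Re (u k)| <= K * s ^+ k by exact: le_trans (Re_le_mod _) (hu k).
have hI k : `|complex.Im (u k)| <= K * s ^+ k by exact: le_trans (Im_le_mod _) (hu k).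
apply: (le_trans (lerD (real_tail hs hR N) (real_tail hs hI N))).
by rewrite [X in X <= _](_ : _ = 2 * K / (1 - s) * s ^+ N)//; ring.
Qed.

Definition psum b (z : C) : C := csum (fun k => b k * z ^+ k).

Lemma hol_intro f (q : C -> C) z (d : R) : 0 < d -> ccont q z ->
  (forall w, modulus (w - z) < d -> f w - f z = q w * (w - z)) -> hol f z.
Proof.
move=> d0 cq qE.
exists (fun w => if modulus (w - z) < d then q w else (f w - f z) / (w - z)); split.
  apply: (@ccont_local _ _ q _ d) => // w wd; by rewrite wd.
move=> w; case: ifPn => wd; first exact: qE.
rewrite divfK// subr_eq0; apply/eqP => wz; move: wd.
by rewrite wz subrr mod0 d0.
Qed.

(** Each of the [k] terms [s ^ j], [j < k], of the geometric sum is at least [s ^ k]. *)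
Lemma nat_geom_le s k : 0 <= s < 1 -> k%:R * s ^+ k <= (1 - s)^-1.
Proof.
move=> hs; have /andP[s0 s1] := hs; apply: le_trans (geom_sum_le k hs).
rewrite mulr_natl -[X in s ^+ k *+ X]subn0 -sumr_const_nat !big_nat.
by apply: ler_sum => j /andP[_ jk]; apply: ler_wiXn2l; [|exact: ltW|exact: ltnW].
Qed.

Lemma psum_tail b K r w N : (forall k, modulus (b k) <= K) -> 0 <= r < 1 -> modulus w <= r ->
  modulus (psum b w - fpoly b N w) <= 2 * K / (1 - r) * r ^+ N.
Proof.
move=> hb hr wr; apply: csum_tail => // k; rewrite modM modX.
by apply: ler_pM; rewrite ?exprn_ge0 ?mod_ge0//; apply: lerXn2r; rewrite ?nnegrE ?mod_ge0//; case/andP: hr.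
Qed.

Lemma ccont_sum (I : Type) (l : seq I) (P : pred I) (h : I -> C -> C) z :
  (forall i, ccont (h i) z) -> ccont (fun w => \sum_(i <- l | P i) h i w) z.
Proof.
move=> ch; elim: l => [|i l IHl].
  apply: (@ccont_local _ _ (fun=> 0) _ 1 ltr01); last exact: ccont_cst.
  by move=> w _; rewrite big_nil.
apply: (@ccont_local _ _ (fun w => (if P i then h i w else 0) + \sum_(i <- l | P i) h i w) _ 1 ltr01).
  by move=> w _; rewrite big_cons; case: ifP; rewrite ?add0r.
apply: ccontD => //; case: (P i); [exact: ch|exact: ccont_cst].
Qed.

Lemma ccont_unif_lim (q : C -> C) (qN : nat -> C -> C) z (d : R) : 0 < d ->
  (forall N, ccont (qN N) z) ->
  (forall e, 0 < e -> exists N, forall w, modulus (w - z) < d -> modulus (q w - qN N w) <= e) ->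
  ccont q z.
Proof.
move=> d0 cqN hq e e0; have e3 : 0 < e / 3 by rewrite divr_gt0.
have [N hN] := hq _ e3; have [d' d1 hd] := cqN N _ e3.
exists (Num.min d' d); first by rewrite lt_min d1.
move=> w; rewrite lt_min => /andP[/hd h3 /hN h1].
have h2 : modulus (q z - qN N z) <= e / 3 by apply: hN; rewrite subrr mod0.
have -> : q w - q z = (q w - qN N w) + (qN N w - qN N z) - (q z - qN N z) by ring.
have := modB (q w - qN N w + (qN N w - qN N z)) (q z - qN N z).
have := modD (q w - qN N w) (qN N w - qN N z); lra.
Qed.

(** As [w ^ k - z ^ k = p k w * (w - z)], Caratheodory's quotient at [z] is the sum of the series
    [b k * p k w], a uniform limit of polynomials near [z]. Since [p k] has [k] terms of modulus at
    most [r ^ (k - 1)], the larger radius [s] is there to absorb the factor [k]. *)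
Lemma psum_hol b K : (forall k, modulus (b k) <= K) -> hol_disk (psum b).
Proof.
move=> hb z z1; have z0 := mod_ge0 z.
have K0 : 0 <= K by apply: le_trans (hb 0%N); exact: mod_ge0.
pose r := (1 + modulus z) / 2; have r0 : 0 < r by rewrite /r; lra.
have r1 : r < 1 by rewrite /r; lra.
have zr : modulus z < r by rewrite /r; lra.
pose s := (1 + r) / 2; have s0 : 0 < s by rewrite /s; lra.
have s1 : s < 1 by rewrite /s; lra.
have rs : r < s by rewrite /s; lra.
have hr : 0 <= r < 1 by rewrite ltW. have hs : 0 <= s < 1 by rewrite ltW.
pose p k w : C := \sum_(i < k) w ^+ (k.-1 - i) * z ^+ i.
have pE k w : w ^+ k - z ^+ k = p k w * (w - z) by rewrite subrXX mulrC.
pose K1 := K * (r^-1 * (1 - r / s)^-1).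
have rs1 : 0 <= r / s < 1 by rewrite divr_ge0 ?ltW//= ltr_pdivrMr// mul1r.
have pb k w : modulus w <= r -> modulus (b k * p k w) <= K1 * s ^+ k.
  move=> wr; rewrite modM /K1 -mulrA; apply: ler_pM; rewrite ?mod_ge0//.
  apply: (le_trans (mod_sum _ _ _)).
  have -> : r^-1 * (1 - r / s)^-1 * s ^+ k = r^-1 * ((1 - r / s)^-1 * s ^+ k) by rewrite mulrA.
  apply: (@le_trans _ _ (r^-1 * (k%:R * (r / s) ^+ k * s ^+ k))); last first.
    apply: ler_wpM2l; first by rewrite invr_ge0 ltW.
    by apply: ler_wpM2r; [rewrite exprn_ge0// ltW|exact: nat_geom_le].
  have -> : k%:R * (r / s) ^+ k * s ^+ k = \sum_(i < k) r ^+ k.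
    by rewrite sumr_const card_ord -mulrA -exprMn divfK ?gt_eqF// mulr_natl.
  rewrite big_distrr /=; apply: ler_sum => i _.
  rewrite modM !modX -ler_pdivrMl ?invr_gt0// invrK.
  have -> : r ^+ k = r * (r ^+ (k.-1 - i) * r ^+ i).
    by rewrite -exprD -exprS; congr (r ^+ _); case: k i => [[]//|k] i /=; rewrite subnK// -ltnS.
  apply: ler_wpM2l; first exact: ltW.
  by apply: ler_pM; rewrite ?exprn_ge0 ?mod_ge0//; apply: lerXn2r;
    rewrite ?nnegrE ?mod_ge0//; exact: ltW.
pose q w := csum (fun k => b k * p k w).
pose qN N w := \sum_(0 <= k < N) b k * p k w.
have qt N w : modulus w <= r -> modulus (q w - qN N w) <= 2 * K1 / (1 - s) * s ^+ N.
  by move=> wr; apply: csum_tail => // k; exact: pb.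
have d0 : 0 < r - modulus z by lra.
have wr w : modulus (w - z) < r - modulus z -> modulus w <= r.
  by move=> h; have := modD (w - z) z; rewrite subrK; lra.
have cqN N : ccont (qN N) z.
  elim: N => [|N IH].
    have -> : qN 0%N = fun=> 0 by apply/funext => w; rewrite /qN big_nil.
    exact: ccont_cst.
  have -> : qN N.+1 = fun w => qN N w + b N * p N w.
    by apply/funext => w; rewrite /qN big_nat_recr.
  apply: ccontD => //; apply: ccontM; first exact: ccont_cst.
  apply: ccont_sum => i; apply: ccontM; last exact: ccont_cst.
  by apply: ccontX; exact: ccont_id.
apply: (@hol_intro _ q _ _ d0).
  apply: (ccont_unif_lim d0 cqN) => e e0.
  have [N hN] := geom_vanish (2 * K1 / (1 - s)) hs e0.
  by exists N => w /wr wz; apply: (le_trans (qt N w wz)); exact: hN.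
move=> w wd; have wz := wr w wd; apply/eqP; rewrite -subr_eq0 -mod_eq0 eq_le mod_ge0 andbT.
apply: (@geom_squeeze s (2 * K / (1 - r) + 2 * K / (1 - r) + 2 * K1 / (1 - s) * modulus (w - z))) => // N.
have -> : psum b w - psum b z - q w * (w - z) =
    (psum b w - fpoly b N w) - (psum b z - fpoly b N z) - (q w - qN N w) * (w - z).
  have : fpoly b N w - fpoly b N z = qN N w * (w - z).
    rewrite /fpoly /qN -sumrB big_distrl /=; apply: eq_bigr => k _.
    by rewrite -mulrBr pE mulrA.
  move: (psum b w) (psum b z) (fpoly b N w) (fpoly b N z) (qN N w) (q w) (w - z).
  by move=> x1 x2 x3 x4 x5 x6 x7 /(canRL (subrK _)) ->; ring.
have sN : r ^+ N <= s ^+ N by apply: lerXn2r; rewrite ?nnegrE; lra.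
have KK : 0 <= 2 * K / (1 - r) by rewrite divr_ge0 ?mulr_ge0//; lra.
have h1 := le_trans (@psum_tail b K r w N hb hr wz) (ler_wpM2l KK sN).
have h2 := le_trans (@psum_tail b K r z N hb hr (ltW zr)) (ler_wpM2l KK sN).
have h3 := ler_wpM2r (mod_ge0 (w - z)) (qt N w wz).
apply: (le_trans (modB _ _)); rewrite modM.
apply: (le_trans (lerD (modB _ _) (lexx _))); apply: (le_trans (lerD (lerD h1 h2) h3)).
by rewrite [X in X <= _](_ : _ = (2 * K / (1 - r) + 2 * K / (1 - r) +
  2 * K1 / (1 - s) * modulus (w - z)) * s ^+ N)//; ring.
Qed.

Lemma psum_expands b K r : (forall k, modulus (b k) <= K) -> 0 <= r < 1 ->
  expands (fun z => psum b (rc r * z)) (fun k => b k * rc (r ^+ k)).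
Proof.
move=> hb hr; split; first by apply: hol_disk_circ => //; exact: psum_hol hb.
move=> e e0; have [N0 hN] := geom_vanish (2 * K / (1 - r)) hr e0.
exists N0 => N /hN h z hz; apply: le_trans h.
have -> : fpoly (fun k => b k * rc (r ^+ k)) N z = fpoly b N (rc r * z).
  by apply: eq_bigr => k _; rewrite exprMn rcX mulrA.
apply: psum_tail => //; rewrite modM hz mulr1 mod_rc ger0_norm//; by case/andP: hr.
Qed.

Lemma taylor_psum b K : (forall k, modulus (b k) <= K) -> taylor (psum b) = b.
Proof.
move=> hb; have h2 : 0 < (2^-1 : R) < 1 by rewrite invr_gt0 ltr0n invf_lt1// ltr1n.
apply/esym/(@taylor_uniq _ _ 2^-1) => //; first exact: psum_hol hb.
by apply: (@psum_expands b K) => //; case/andP: h2 => /ltW -> ->.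
Qed.

End PowerSeries.

(** * Limits along a free ultrafilter *)

Section Ultralimit.
Context {R : realType}.
Local Notation C := (cplx R).

Lemma free_ultrafilter_ex : exists U : set_system nat, UltraFilter U /\ \oo `<=` U.
Proof.
by have [U [UU h]] := @ultraFilterLemma nat \oo _; exists U.
Qed.

(** Fixing one ultrafilter gives every bounded sequence a limit along the same filter, hence all
    Taylor coefficients at once, with no diagonal extraction. *)
Definition free_ultra : set_system nat := projT1 (cid free_ultrafilter_ex).

Lemma free_ultra_ultra : UltraFilter free_ultra.
Proof. by rewrite /free_ultra; case: cid => U []. Qed.

Lemma free_ultra_eventually : \oo `<=` free_ultra.
Proof. by rewrite /free_ultra; case: cid => U []. Qed.

Lemma free_ultra_proper : ProperFilter free_ultra.
Proof. exact: (@ultra_proper _ _ free_ultra_ultra). Qed.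

Definition uconv (s : nat -> C) (l : C) : Prop :=
  forall e : R, 0 < e -> free_ultra [set n | modulus (s n - l) < e].

Lemma bounded_ultra_cvg (u : nat -> R) (M : R) : (forall n, `|u n| <= M) ->
  exists2 l : R, `|l| <= M & forall e : R, 0 < e -> free_ultra [set n | `|u n - l| < e].
Proof.
move=> hu; have UU := free_ultra_ultra; have PU := free_ultra_proper.
have [] := @segment_compact R (- M) M (u @ free_ultra) _ _.
  apply: (@filterE _ _ PU) => n; rewrite /= in_itv /= -ler_norml; exact: hu.
move=> l []; rewrite /= in_itv /= -ler_norml => lM ul; exists l => // e e0.
have [//|nU] := @in_ultra_setVsetC _ free_ultra [set n | `|u n - l| < e] UU.
have := ul (fun x => ~ `|x - l| < e) (ball l e) nU (nbhsx_ballx l e e0).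
by move=> -[x [/= hx]]; rewrite /ball /= distrC => /hx.
Qed.

Lemma bounded_uconv (s : nat -> C) (M : R) : (forall n, modulus (s n) <= M) ->
  exists l, uconv s l.
Proof.
move=> hs; have PU := free_ultra_proper.
have [l1 _ h1] := bounded_ultra_cvg (fun n => le_trans (Re_le_mod (s n)) (hs n)).
have [l2 _ h2] := bounded_ultra_cvg (fun n => le_trans (Im_le_mod (s n)) (hs n)).
exists (Complex l1 l2) => e e0; have e2 : 0 < e / 2 by rewrite divr_gt0.
apply: filterS (filterI (h1 _ e2) (h2 _ e2)) => n /= [a1 a2].
apply: (le_lt_trans (mod_le_ReIm _)); rewrite cReB cImB /= (splitr e); exact: ltrD.
Qed.

Lemma ultra_nonempty (P : set nat) : free_ultra P -> exists n, P n.
Proof. by move=> /(@filter_ex _ _ free_ultra_proper)[n Pn]; exists n. Qed.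

Lemma ultra_ge (N : nat) : free_ultra [set n | (N <= n)%N].
Proof. by apply: free_ultra_eventually; exists N. Qed.

Lemma ultraI (P Q : set nat) : free_ultra P -> free_ultra Q -> free_ultra (P `&` Q).
Proof. by have PU := free_ultra_proper; exact: filterI. Qed.

Lemma ultraS (P Q : set nat) : P `<=` Q -> free_ultra P -> free_ultra Q.
Proof. by have PU := free_ultra_proper; exact: filterS. Qed.

Lemma ultra_forall (P : nat -> set nat) N : (forall k, free_ultra (P k)) ->
  free_ultra [set n | forall k, (k < N)%N -> P k n].
Proof.
move=> hP; elim: N => [|N IH]; first by apply: ultraS (ultra_ge 0) => n _ k; rewrite ltn0.
apply: ultraS (ultraI IH (hP N)) => n [h1 h2] k; rewrite ltnS leq_eqVlt => /predU1P[->//|].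
exact: h1.
Qed.

Lemma uconv_le s l (B : R) : uconv s l -> (forall n, modulus (s n) <= B) -> modulus l <= B.
Proof.
move=> sl sB; apply/ler_addgt0Pr => e /sl/ultra_nonempty[n /= hn].
by have := mod_sub_ge l (s n); have := sB n; rewrite mod_distC; lra.
Qed.

End Ultralimit.

(** * Radial limits *)

Section PoissonKernelBound.
Context {R : realType}.
Local Notation C := (cplx R).
Local Notation mu := (@lebesgue_measure R).
Implicit Types (z w v : C) (f g : C -> C) (a r t e s d : R) (G : R -> R).

(** Up to [pi / 2] the half-angle formula and the mean value theorem give more. Beyond,
    [1 - cos s >= 1], and [pi < 4] explains the constant 16. *)
Lemma one_sub_cos_ge s : `|s| <= pi -> s ^+ 2 / 16 <= 1 - cos s.
Proof.
wlog s0 : s / 0 <= s.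
  move=> h hs; have [s0|s0] := leP 0 s; first exact: h.
  by rewrite -(sqrrN s) -(cosN s); apply: h; rewrite ?normrN//; lra.
rewrite ger0_norm// => sp; have p4 := pihalf_02 R; have pp := pi_gt0 R.
have [sh|sh] := leP s (pi / 2); last first.
  have c0 : 0 <= cos (pi - s) by apply: cos_ge0_pihalf; lra.
  by rewrite cosB cospi sinpi mul0r addr0 mulN1r in c0; nra.
have -> : cos s = 1 - 2 * sin (s / 2) ^+ 2.
  have {1}-> : s = (s / 2) *+ 2 by rewrite -mulr_natr divfK.
  by rewrite cos_mulr2n cos2sin2 -mulr_natr; ring.
have ms : 0 <= s / 2 by lra.
have cs : {within `[0, s / 2], continuous (@sin R)}.
  by apply: continuous_subspaceT => x; exact: continuous_sin.
have [x xs] := @MVT_segment R sin cos 0 (s / 2) ms (fun x _ => is_derive_sin x) cs.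
rewrite sin0 !subr0 in_itv /= in xs * => ->.
have /andP[x0 x1] := xs.
have c0 : 0 <= cos (x *+ 2) by apply: cos_ge0_pihalf; rewrite -mulr_natr; lra.
have c1 : 1 / 2 <= cos x ^+ 2 by move: c0; rewrite cos_mulr2n -mulr_natr; lra.
by rewrite exprMn expr_div_n; nra.
Qed.

Lemma mod_1sub_polar r s : modulus (1 - rc r * cis s) ^+ 2 = (1 - r) ^+ 2 + 2 * r * (1 - cos s).
Proof.
rewrite mod_sqr cReB cImB cReM cImM /=.
have := cos2Dsin2 s; set c := cos s; set x := sin s => h.
rewrite (_ : (0 - _) ^+ 2 = r ^+ 2 * x ^+ 2); last by ring.
have -> : x ^+ 2 = 1 - c ^+ 2 by rewrite -h; ring.
by ring.
Qed.

(** The numerator is at most [2 (1 - r)]; since [2 r >= 1], the denominator is at least one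
    sixteenth of [(1 - r) ^ 2 + s ^ 2]. *)
Lemma poisson_bound r s : 1 / 2 <= r < 1 -> `|s| <= pi ->
  poisson (rc r * cis s) <= 32 * (1 - r) / ((1 - r) ^+ 2 + s ^+ 2).
Proof.
move=> /andP[r2 r1] sp; have h := one_sub_cos_ge sp.
rewrite /poisson mod_1sub_polar modM mod_cis mulr1 mod_rc ger0_norm; last lra.
have d0 : 0 < (1 - r) ^+ 2 by rewrite exprn_gt0// subr_gt0.
have s0 := sqr_ge0 s.
have D0 : 0 < (1 - r) ^+ 2 + 2 * r * (1 - cos s) by nra.
rewrite ler_pdivrMr// mulrAC ler_pdivlMr; last lra.
have -> : 1 - r ^+ 2 = (1 - r) * (1 + r) by ring.
rewrite -!mulrA [32 * _]mulrCA; apply: ler_wpM2l; first lra.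
nra.
Qed.

(** For [k > 0], a bound of [d / (d ^ 2 + s ^ 2)] on the shell [2 ^ (k - 1) d <= |s| < 2 ^ k d].
    Dominating the kernel by constants on balls reduces Poisson integrals to averages over balls. *)
Definition dyadic d (k : nat) : R := 4 / (4 ^+ k * d).

Lemma dyadic_bound d s m : 0 < d -> `|s| < 2 ^+ m * d ->
  d / (d ^+ 2 + s ^+ 2) <= \sum_(0 <= k < m.+1) dyadic d k * \1_(ball 0 (2 ^+ k * d)) s.
Proof.
move=> d0; have dy0 k : 0 <= dyadic d k.
  by rewrite divr_ge0// mulr_ge0 ?exprn_ge0// ltW.
have ind0 k : 0 <= dyadic d k * \1_(ball 0 (2 ^+ k * d)) s.
  by rewrite mulr_ge0// indicE ler0n.
have dd : 0 < d ^+ 2 by rewrite exprn_gt0.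
have s0 := sqr_ge0 s.
elim: m => [|m IH] sm.
  rewrite big_nat1 indicE mem_set ?mulr1; last by rewrite /ball /= sub0r normrN.
  rewrite /dyadic expr0 mul1r ler_pdivrMr; last lra.
  by rewrite mulrAC ler_pdivlMr//; nra.
have [h|h] := ltP `|s| (2 ^+ m * d).
  by rewrite big_nat_recr//=; apply: (le_trans (IH h)); rewrite lerDl.
rewrite big_nat_recr//= indicE mem_set ?mulr1; last by rewrite /ball /= sub0r normrN.
rewrite -[leLHS]add0r; apply: lerD; first exact: sumr_ge0.
have h2 : (2 ^+ m * d) ^+ 2 <= s ^+ 2.
  by rewrite -(real_normK (num_real s)) lerXn2r ?nnegrE// mulr_ge0 ?exprn_ge0// ltW.
have e4 : (2 ^+ m) ^+ 2 = 4 ^+ m :> R.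
  by rewrite -exprM mulnC exprM; congr (_ ^+ m); rewrite -natrX.
rewrite exprMn e4 in h2; have m0 : 0 < 4 ^+ m :> R by rewrite exprn_gt0.
rewrite /dyadic [4 ^+ m.+1]exprS; move: (4 ^+ m) m0 h2 => q q0 h2.
have -> : 4 / (4 * q * d) = (q * d)^-1 by field; rewrite !gt_eqF.
rewrite ler_pdivrMr; last lra.
by rewrite mulrC ler_pdivlMr ?mulr_gt0//; nra.
Qed.

Lemma HL_ball G t (r : R) : 0 < r ->
  (\int[mu]_(s in ball t r) `|(G s)%:E| <= (2 * r)%:E * HL_maximal G t)%E.
Proof.
move=> r0; have h : (iavg G (ball t r) <= HL_maximal G t)%E.
  by apply: ereal_sup_ubound; exists r => //=; rewrite in_itv /= r0.
have r2 : 2 * r != 0 by rewrite mulf_neq0// gt_eqF.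
have e : (iavg G (ball t r) = (2 * r)^-1%:E * \int[mu]_(s in ball t r) `|(G s)%:E|)%E.
  by rewrite /iavg lebesgue_measure_ball ?ltW// inver (_ : r *+ 2 = 2 * r) ?(negbTE r2)// mulr_natl.
have r20 : (0 <= (2 * r)%:E)%E by rewrite lee_fin mulr_ge0// ltW.
apply: le_trans (lee_wpmul2l r20 h).
by rewrite e muleA -EFinM divff// mul1e.
Qed.

(** In [HL_poisson] the ball of radius [2 ^ k d] contributes [32 * (4 / (4 ^ k d)) * (2 * 2 ^ k d) =
    256 / 2 ^ k], and these sum to at most 512. *)
Definition HL_cst : R := 512.

Lemma HL_cst_gt0 : 0 < HL_cst.
Proof. by rewrite ltr0n. Qed.

(** Restricting [F] to [A] makes it integrable on the line, as the maximal function requires,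
    without changing it on the period centred at [t]. *)
Lemma HL_poisson (F : R -> R) (A : set R) t r : 1 / 2 <= r < 1 ->
  measurable A -> mu.-integrable A (EFin \o F) -> (forall s, 0 <= F s) ->
  `[t - pi, t + pi]%classic `<=` A ->
  measurable_fun `[t - pi, t + pi]%classic (fun s => poisson (rc r * cis (t - s)) * F s) ->
  (\int[mu]_(s in `[(t - pi)%R, (t + pi)%R]) (poisson (rc r * cis (t - s)) * F s)%:E
    <= HL_cst%:E * HL_maximal (F \_ A) t)%E.
Proof.
move=> hr mA iF F0 tA mPF; have /andP[r2 r1] := hr; pose d := 1 - r.
have d0 : 0 < d by rewrite subr_gt0.
have pp := pi_gt0 R.
have [m hm] : exists m : nat, pi < 2 ^+ m * d.
  have [N hN] : exists N : nat, pi / d < N%:R.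
    by exists (Num.truncn (pi / d)).+1; exact: truncnS_gt.
  exists N; rewrite -ltr_pdivrMr//; apply: (lt_le_trans hN).
  by rewrite -natrX ler_nat ltnW// ltn_expl.
set D := `[(t - pi)%R, (t + pi)%R]%classic in tA mPF *.
have mD : measurable D by exact: measurable_itv.
have iG : locally_integrable setT (F \_ A) by exact: integrable_locally_restrict.
have mG : measurable_fun setT (F \_ A) by case: iG.
have G0 s : 0 <= (F \_ A) s by rewrite patchE; case: ifP.
have P0 s : 0 <= poisson (rc r * cis (t - s)).
  by rewrite poisson_ge0// modM mod_cis mod_rc mulr1 ger0_norm; lra.
pose G := (fun s => ((F \_ A) s)%:E).
pose b k : R := 32 * dyadic d k.
have b0 k : 0 <= b k by rewrite mulr_ge0// divr_ge0// mulr_ge0 ?exprn_ge0// ltW.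
pose B k := ball t (2 ^+ k * d).
have mB k : measurable (B k) by apply: open_measurable; apply: ball_open; rewrite mulr_gt0// exprn_gt0.
have mGB k : measurable_fun setT (G \_ (B k)).
  apply/(measurable_restrictT _ (mB k)); apply: (measurable_funS measurableT) => //.
  exact/measurable_EFinP.
have GB0 k s : (0 <= (G \_ (B k)) s)%E by rewrite patchE; case: ifP => // _; rewrite lee_fin.
apply: (@le_trans _ _ (\int[mu]_s \sum_(0 <= k < m.+1) (b k)%:E * (G \_ (B k)) s)%E).
  rewrite integral_mkcond; apply: ge0_le_integral => //.
  - by move=> s _; rewrite patchE; case: ifP => // sD; rewrite lee_fin mulr_ge0.
  - apply/(measurable_restrictT _ mD); exact/measurable_EFinP.
  - apply: emeasurable_sum => k.
    apply: measurable_funeM.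
    exact: mGB.
  move=> s _; rewrite patchE; case: ifPn => sD; last first.
    suff h : (0 <= \sum_(0 <= k < m.+1) (b k)%:E * (G \_ (B k)) s)%E by exact: h.
    by apply: sume_ge0 => k _; apply: mule_ge0; [rewrite lee_fin|].
  move: sD; rewrite inE /D /= in_itv /= => sD.
  have ts : `|t - s| <= pi by rewrite ler_norml; lra.
  have FG : F s = (F \_ A) s by rewrite patchE mem_set//; apply: tA; rewrite /D /= in_itv.
  have h1 := poisson_bound hr ts; rewrite -/d in h1.
  have h2 := @dyadic_bound d (t - s) m d0 (le_lt_trans ts hm).
  have -> : (\sum_(0 <= k < m.+1) (b k)%:E * (G \_ (B k)) s)%E =
     (32 * (\sum_(0 <= k < m.+1) dyadic d k * \1_(ball 0 (2 ^+ k * d)) (t - s)) * F s)%:E.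
    rewrite big_distrr big_distrl /= -sumEFin; apply: eq_bigr => k _.
    rewrite patchE FG /b indicE.
    have BE : ball (0 : R) (2 ^+ k * d) (t - s) = B k s.
      by rewrite /B /ball /= sub0r normrN.
    have [sB|sB] := pselect (B k s).
      by rewrite !mem_set ?BE// mulr1 -EFinM.
    rewrite !memNset ?BE// mulr0 mulr0 mul0r.
    exact: mule0.
  rewrite lee_fin; apply: ler_wpM2r; first exact: F0.
  by apply: (le_trans h1); rewrite -mulrA; apply: ler_wpM2l.
rewrite ge0_integral_sum//; first last.
- by move=> k s _; apply: mule_ge0; [rewrite lee_fin|].
- by move=> k; apply: measurable_funeM; exact: mGB.
apply: (@le_trans _ _ (\sum_(0 <= k < m.+1) (256 * 2^-1 ^+ k)%:E * HL_maximal (F \_ A) t)%E).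
  apply: lee_sum => k _; rewrite ge0_integralZl_EFin//; last exact: mGB.
  have -> : (\int[mu]_s (G \_ (B k)) s = \int[mu]_(s in B k) G s)%E.
    by rewrite [RHS]integral_mkcond.
  have h : (\int[mu]_(s in B k) G s <= (2 * (2 ^+ k * d))%:E * HL_maximal (F \_ A) t)%E.
    have := @HL_ball (F \_ A) t (2 ^+ k * d) (mulr_gt0 (exprn_gt0 k (ltr0Sn R 1)) d0).
    apply: le_trans; rewrite le_eqVlt; apply/orP; left; apply/eqP.
    by apply: eq_integral => s _; rewrite gee0_abs// lee_fin.
  have bk : (0 <= (b k)%:E)%E by rewrite lee_fin.
  apply: (le_trans (lee_wpmul2l bk h)); rewrite muleA -EFinM.
  rewrite (_ : b k * _ = 256 * 2^-1 ^+ k)// /b /dyadic.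
  have -> : 4 ^+ k = 2 ^+ k * 2 ^+ k :> R by rewrite -exprMn -natrM.
  by rewrite exprVn; field; rewrite expf_neq0// gt_eqF.
rewrite -ge0_sume_distrl; last by move=> k _; rewrite lee_fin; apply: mulr_ge0 => //; apply: exprn_ge0; rewrite invr_ge0.
have HL0 : (0 <= HL_maximal (F \_ A) t)%E.
  apply: (@le_trans _ _ (iavg (F \_ A) (ball t 1))); first exact: iavg_ge0.
  by apply: ereal_sup_ubound; exists 1 => //=; rewrite in_itv /= ltr01.
apply: lee_wpmul2r => //.
rewrite sumEFin lee_fin -big_distrr /= (_ : HL_cst = 256 * 2); last by rewrite /HL_cst -natrM.
have h2 : 0 <= (2^-1 : R) < 1 by rewrite invr_ge0 ler0n invf_lt1// ltr1n.
have half : (1 - 2^-1)^-1 = 2 :> R by field.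
by apply: ler_wpM2l => //; rewrite -[leRHS]half; exact: geom_sum_le.
Qed.

End PoissonKernelBound.

(** * Fatou's theorem for square summable coefficients *)

Section Fatou.
Context {R : realType}.
Local Notation C := (cplx R).
Local Notation mu := (@lebesgue_measure R).
Implicit Types (z w v l : C) (f g u : C -> C) (a r t e s d c : R).

Definition radial_limit f t l : Prop := forall e, 0 < e ->
  exists2 rho : R, rho < 1 & forall r, rho < r < 1 -> modulus (f (rc r * cis t) - l) < e.

Definition has_rlim f t : Prop := exists l, radial_limit f t l.

Definition radial_cauchy f t e : Prop := exists2 rho : R, rho < 1 &
  forall r s, rho < r < 1 -> rho < s < 1 -> modulus (f (rc r * cis t) - f (rc s * cis t)) <= e.

Lemma cauchy_has_rlim f t : (forall e, 0 < e -> radial_cauchy f t e) -> has_rlim f t.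
Proof.
move=> hc; have [p p1 hp] := hc 1 ltr01.
(* Radii in []p, 1[] tending to 1. The ultralimit along them is the candidate, and the Cauchy
   condition extends the convergence to all radii. *)
pose r (n : nat) := 1 - (1 - p) / n.+2%:R.
have rp n : p < r n < 1.
  have n0 : 0 < n.+2%:R :> R by [].
  have : 0 < (1 - p) / n.+2%:R by rewrite divr_gt0// subr_gt0.
  have : (1 - p) / n.+2%:R < 1 - p by rewrite ltr_pdivrMr// ltr_pMr ?subr_gt0// ltr1n.
  by rewrite /r; move: (_ / _) => x x1 x0; lra.
have rlim q : q < 1 -> exists N, forall n, (N <= n)%N -> q < r n.
  move=> q1; exists (Num.truncn ((1 - p) / (1 - q))) => n hn.
  have q0 : 0 < 1 - q by rewrite subr_gt0.
  have h : (1 - p) / (1 - q) < n.+2%:R.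
    by apply: (lt_le_trans (truncnS_gt _)); rewrite ler_nat ltnS (leq_trans hn).
  have : (1 - p) / n.+2%:R < 1 - q.
    by rewrite ltr_pdivrMr// mulrC -ltr_pdivrMr.
  by rewrite /r; move: (_ / n.+2%:R) => x; lra.
have [l hl] : exists l, uconv (fun n => f (rc (r n) * cis t)) l.
  apply: (@bounded_uconv _ _ (modulus (f (rc (r 0%N) * cis t)) + 1)) => n.
  have := hp (r n) (r 0%N) (rp n) (rp 0%N).
  have := mod_sub_ge (f (rc (r n) * cis t)) (f (rc (r 0%N) * cis t)); lra.
exists l => e e0; have e2 : 0 < e / 2 by rewrite divr_gt0.
have [q q1 hq] := hc _ e2; exists q => // s hs.
have [N hN] := rlim q q1.
have /ultra_nonempty[n [/= h1 h2]] := ultraI (hl _ e2) (ultra_ge N).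
have rq : q < r n < 1 by rewrite hN//=; case/andP: (rp n).
have := hq s (r n) hs rq.
have := modD (f (rc s * cis t) - f (rc (r n) * cis t)) (f (rc (r n) * cis t) - l).
by rewrite addrA subrK; lra.
Qed.

(** The factor 3 of the weak type inequality, doubled because [max_set_radius] integrates over two
    periods. *)
Definition max_cst : R := 6 * HL_cst.

Lemma max_cst_gt0 : 0 < max_cst.
Proof. by rewrite mulr_gt0// HL_cst_gt0. Qed.

Definition max_set u c (p : R) : set R :=
  [set t | exists2 r, 1 / 2 <= r < p & c < modulus (u (rc r * cis t))].

Lemma hol_disk_rad_cts u r : hol_disk u -> 0 <= r < 1 ->
  continuous (fun t => modulus (u (rc r * cis t))).
Proof.
move=> hu hr t; have cu := hol_disk_circ hu hr.
have := @rcont_on_mod _ t t _ (@circ_rcont _ (fun z => u (rc r * z)) t t cu).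
by move=> /(_ t); rewrite lexx; apply.
Qed.

Lemma max_set_open u c p : hol_disk u -> p <= 1 -> open (max_set u c p).
Proof.
move=> hu p1; have -> : max_set u c p =
    \bigcup_(r in [set r | 1 / 2 <= r < p]) ((fun t => modulus (u (rc r * cis t))) @^-1` [set x | c < x]).
  by apply/seteqP; split=> t [r hr ht]; exists r.
apply: bigcup_open => r /= hr; apply: open_comp; last exact: open_gt.
by move=> t _; apply: hol_disk_rad_cts => //; lra.
Qed.

Lemma angles_measurable : measurable (@angles R).
Proof. exact: measurable_itv. Qed.

Lemma max_set_measurable u c p : hol_disk u -> p <= 1 -> measurable (angles `&` max_set u c p).
Proof.
move=> hu p1; apply: measurableI; first exact: angles_measurable.
by apply: open_measurable; exact: max_set_open.
Qed.

Lemma integral_rint a b (F : R -> R) : cts_on a b F ->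
  (\int[mu]_(s in `[a, b]) (F s)%:E)%E = (rint a b F)%:E.
Proof.
move=> cF; rewrite /rint /Rintegral fineK//; apply: integrable_fin_num => //.
exact: cts_integrable.
Qed.

Lemma cts_measurable a b (F : R -> R) : cts_on a b F -> measurable_fun `[a, b]%classic F.
Proof. by move=> /cts_integrable/(measurable_int mu) h; exact/measurable_EFinP. Qed.

(** For [r < p], the value of [u] at radius [r] is a Poisson integral, with parameter
    [q = r / p >= 1 / 2], of its continuous values on the circle of radius [p]. By [HL_poisson] the
    radial maximum is dominated by a Hardy-Littlewood maximal function, to which the weak type
    inequality applies. *)
Lemma max_set_radius u c (p B d : R) : hol_disk u -> 1 / 2 < p < 1 -> 0 < c -> 0 < d ->
  B <= d ^+ 2 -> (forall a r, 0 <= r < 1 -> rmean a (fun z => modulus (u (rc r * z)) ^+ 2) <= B) ->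
  (mu (angles `&` max_set u c p) <= (max_cst * d / c)%:E)%E.
Proof.
move=> hu /andP[p2 p1] c0 d0 Bd hB; have p0 : 0 < p by lra.
have hp : 0 <= p < 1 by lra.
have pp := pi_gt0 R.
(* Two periods, so that [[t - pi, t + pi]] stays inside [A] for every [t] in [angles]. *)
pose F s := modulus (u (rc p * cis s)); pose A := `[- pi, 3 * pi]%classic : set R.
have cF : continuous F by exact: hol_disk_rad_cts.
have cFon a b : cts_on a b F by move=> x _; exact: cF.
have mA : measurable A by exact: measurable_itv.
have iF : mu.-integrable A (EFin \o F) by apply: cts_integrable => x _; exact: cF.
have F0 s : 0 <= F s by exact: mod_ge0.
have iG := integrable_locally_restrict mA iF.
have K0 := @HL_cst_gt0 R; pose c' := 2 * pi * c / HL_cst.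
have c'0 : 0 < c' by apply: divr_gt0 => //; apply: mulr_gt0 => //; exact: twopi_gt0.
have cu : circ_cont (fun z => u (rc p * z)) by exact: hol_disk_circ.
have sub : angles `&` max_set u c p `<=` [set t | (c'%:E < HL_maximal (F \_ A) t)%E].
  move=> t [ht [r /andP[r2 rp] ct]] /=.
  move: ht; rewrite /angles /= in_itv /= => /andP[t0 t1].
  pose q := r / p; have q2 : 1 / 2 <= q < 1.
    apply/andP; split; last by rewrite ltr_pdivrMr// mul1r.
    by rewrite ler_pdivlMr//; nra.
  pose v : C := rc q * cis t.
  have v1 : modulus v < 1 by rewrite modM mod_cis mulr1 mod_rc ger0_norm; lra.
  have pE z : modulus z = 1 -> 0 <= poisson (v * conjc z).
    by move=> hz; apply: poisson_ge0; rewrite modM modJ hz mulr1.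
  have cP := circ_cont_poisson v1.
  have cuP : circ_cont (fun z => u (rc p * z) * rc (poisson (v * conjc z))) by exact: circ_contM.
  have uv : modulus (u (rc r * cis t)) <= rmean (t - pi) (fun z => poisson (v * conjc z) * modulus (u (rc p * z))).
    have -> : rc r * cis t = rc p * v.
      by rewrite mulrA -rcM /q mulrCA divff ?mulr1// gt_eqF.
    have h1 : 1 < p^-1 by rewrite invf_gt1.
    rewrite -(@poisson_formula _ (t - pi) (fun z => u (rc p * z)) p^-1 v h1)//; last exact: hol_disk_scale.
    apply: (le_trans (mod_cmean _ cuP)); apply: le_rmean.
    - exact: circ_cont_mod.
    - move=> z hz; apply: (@ccont_local _ _ (fun z => rc (poisson (v * conjc z)) * rc (modulus (u (rc p * z)))) _ 1 ltr01).
        by move=> w _; rewrite rcM.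
      apply: ccontM; first exact: cP.
      exact: circ_cont_mod.
    - by move=> z hz; rewrite modM mod_rc ger0_norm ?pE// mulrC.
  have te : t - pi + 2 * pi = t + pi by ring.
  have vE s : v * conjc (cis s) = rc q * cis (t - s) by rewrite cisD cisN mulrA.
  have cts : cts_on (t - pi) (t + pi) (fun s => poisson (rc q * cis (t - s)) * F s).
    have cc : circ_cont (fun z => rc (poisson (v * conjc z) * modulus (u (rc p * z)))).
      move=> z hz; apply: (@ccont_local _ _ (fun z => rc (poisson (v * conjc z)) * rc (modulus (u (rc p * z)))) _ 1 ltr01).
        by move=> w _; rewrite rcM.
      apply: ccontM; first exact: cP.
      exact: circ_cont_mod.
    have := @circ_rc_cts _ _ (t - pi) (t + pi) cc.
    by under [in X in X -> _]eq_fun do rewrite vE.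
  have tA : `[t - pi, t + pi]%classic `<=` A.
    move=> x; rewrite /A /= !in_itv /=; clear -t0 t1 pp.
    by move=> /andP[h1 h2]; apply/andP; split; lra.
  have := @HL_poisson _ F A t q q2 mA iF F0 tA _.
  have mPF : measurable_fun `[t - pi, t + pi]%classic (fun s => poisson (rc q * cis (t - s)) * F s).
    exact: cts_measurable.
  rewrite integral_rint// => /(_ mPF); set I := rint _ _ _ => h.
  have cI : 2 * pi * c < I.
    have -> : I = 2 * pi * rmean (t - pi) (fun z => poisson (v * conjc z) * modulus (u (rc p * z))).
      rewrite /rmean mulrA divff ?mul1r ?te; last by rewrite gt_eqF// twopi_gt0.
      by apply: eq_rint => s _; rewrite vE.
    rewrite ltr_pM2l ?twopi_gt0//; exact: lt_le_trans uv.
  move: h; case: (HL_maximal _ t) => [x| |]; last 2 first.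
  - by rewrite ltry.
  - by rewrite gt0_muleNy.
  rewrite -EFinM lee_fin lte_fin /c' => h.
  by rewrite ltr_pdivrMr// [ltRHS]mulrC; exact: lt_le_trans h.
have ms := max_set_measurable c hu (ltW p1).
apply: (@le_trans _ _ (mu [set t | (c'%:E < HL_maximal (F \_ A) t)%E])).
  apply: le_measure; rewrite ?inE//.
  rewrite -[X in measurable X]setTI; apply: emeasurable_fun_o_infty => //.
  exact: measurable_HL_maximal.
apply: (le_trans (maximal_inequality iG c'0)).
(* From the mean square to the mean, by [x <= d / 2 + x ^ 2 / (2 d)]. *)
have rm a : rmean a (fun z => modulus (u (rc p * z))) <= d.
  have c2 := circ_cont_modX 2 cu.
  apply: (@le_trans _ _ (rmean a (fun z => d / 2 + (2 * d)^-1 * modulus (u (rc p * z)) ^+ 2))).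
    apply: le_rmean.
    - exact: circ_cont_mod.
    - move=> z hz; apply: (@ccont_local _ _ (fun z => rc (d / 2) + rc (2 * d)^-1 * rc (modulus (u (rc p * z)) ^+ 2)) _ 1 ltr01).
        by move=> w _; rewrite rcD (rcM (2 * d)^-1).
      apply: ccontD; first exact: ccont_cst.
      by apply: ccontM; [exact: ccont_cst|exact: c2].
    - move=> z _; move: (modulus _) => x.
      rewrite -subr_ge0 (_ : _ - x = (2 * d)^-1 * (x - d) ^+ 2); last by field; rewrite gt_eqF.
      by rewrite mulr_ge0 ?sqr_ge0// invr_ge0 mulr_ge0// ltW.
  rewrite rmeanD; first last.
  - move=> z hz; apply: (@ccont_local _ _ (fun z => rc (2 * d)^-1 * rc (modulus (u (rc p * z)) ^+ 2)) _ 1 ltr01).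
      by move=> w _; rewrite rcM.
    by apply: ccontM; [exact: ccont_cst|exact: c2].
  - exact: circ_cont_cst.
  rewrite rmean_cst rmeanZ//.
  have h : (2 * d)^-1 * rmean a (fun z => modulus (u (rc p * z)) ^+ 2) <= (2 * d)^-1 * d ^+ 2.
    apply: ler_wpM2l; first by rewrite invr_ge0 mulr_ge0// ltW.
    exact: le_trans (hB a p hp) Bd.
  have e : (2 * d)^-1 * d ^+ 2 = d / 2 by field; rewrite gt_eqF.
  by rewrite e in h; lra.
have -> : (\int[mu]_y `|((F \_ A) y)%:E| = (rint (- pi) (3 * pi) F)%:E)%E.
  rewrite -integral_rint// [RHS]integral_mkcond; apply: eq_integral => y _.
  by rewrite !patchE; case: ifP => _; [rewrite gee0_abs// lee_fin|rewrite /= normr0].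
have -> : rint (- pi) (3 * pi) F = 2 * pi * (rmean (- pi) (fun z => modulus (u (rc p * z))) +
    rmean pi (fun z => modulus (u (rc p * z)))).
  rewrite (@rint_split _ (- pi) pi) ?/rmean; [|lra|lra|exact: cFon].
  have -> : - pi + 2 * pi = pi :> R by ring.
  have -> : pi + 2 * pi = 3 * pi :> R by ring.
  by rewrite -mulrDr mulrA divff ?mul1r// gt_eqF// twopi_gt0.
rewrite -EFinM lee_fin.
have rm1 := rm (- pi); have rm2 := rm pi.
apply: (@le_trans _ _ (3 / c' * (2 * pi * (d + d)))).
  apply: ler_wpM2l; first by rewrite divr_ge0// ltW.
  by apply: ler_wpM2l; [rewrite ltW// twopi_gt0|exact: lerD].
rewrite le_eqVlt; apply/orP; left; apply/eqP; rewrite /c' /max_cst.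
move: (HL_cst) K0 (pi) pp => H H0 y y0; field.
by rewrite !gt_eqF.
Qed.

(** Continuity of the measure along radii [p n] increasing to 1: the bound of [max_set_radius] does
    not depend on [p]. *)
Lemma max_set_le u c (B d : R) : hol_disk u -> 0 < c -> 0 < d -> B <= d ^+ 2 ->
  (forall a r, 0 <= r < 1 -> rmean a (fun z => modulus (u (rc r * z)) ^+ 2) <= B) ->
  (mu (angles `&` max_set u c 1) <= (max_cst * d / c)%:E)%E.
Proof.
move=> hu c0 d0 Bd hB; pose p (n : nat) : R := 1 - n.+3%:R^-1.
have hp n : 1 / 2 < p n < 1.
  have : n.+3%:R^-1 < 2^-1 :> R by rewrite ltf_pV2 ?posrE// ltr_nat.
  have : 0 < n.+3%:R^-1 :> R by rewrite invr_gt0.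
  by rewrite /p; move: (n.+3%:R^-1) => x; lra.
pose E n := angles `&` max_set u c (p n).
have mE n : measurable (E n) by apply: max_set_measurable => //; case/andP: (hp n) => _ /ltW.
have UE : \bigcup_n E n = angles `&` max_set u c 1.
  apply/seteqP; split => t.
    move=> [n _ [ht [r /andP[r2 rp] hr]]]; split => //; exists r => //.
    by rewrite r2 (lt_trans rp)//; case/andP: (hp n).
  move=> [ht [r /andP[r2 r1] hr]]; exists (Num.truncn (1 - r)^-1) => //; split => //.
  exists r => //; rewrite r2 /p /=.
  have r0 : 0 < 1 - r by rewrite subr_gt0.
  have h : (1 - r)^-1 < (Num.truncn (1 - r)^-1).+3%:R.
    apply: (lt_le_trans (truncnS_gt _)); rewrite ler_nat.
    exact: (leq_trans (leqnSn _) (leqnSn _)).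
  have : (Num.truncn (1 - r)^-1).+3%:R^-1 < 1 - r.
    by rewrite -[ltRHS]invrK ltf_pV2 ?posrE ?invr_gt0.
  by move: (_.+3%:R^-1) => x; lra.
have ndE : {homo E : n m / (n <= m)%N >-> (n <= m)%O}.
  move=> n m nm; apply/subsetPset => t [ht [r /andP[r2 rp] hr]]; split => //.
  exists r => //; rewrite r2 (lt_le_trans rp)// /p lerD2l lerN2 lef_pV2 ?posrE//.
  by rewrite ler_nat.
have mU : measurable (\bigcup_n E n) by rewrite UE; apply: max_set_measurable.
have := @nondecreasing_cvg_mu _ _ _ mu E mE mU ndE; rewrite UE => /cvg_lim <- //.
apply: lime_le.
  by apply: ereal_nondecreasing_is_cvgn => n m nm; apply: le_measure; [rewrite inE; exact: mE|rewrite inE; exact: mE|apply/subsetPset; exact: ndE].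
by apply: nearW => n; exact: (max_set_radius hu (hp n) c0 d0 Bd hB).
Qed.

(** The factors [r ^ k <= 1] only shrink the coefficients, so one [N], found from the tail of the
    square sum, serves every radius. *)
Lemma rmean_tail f (B d : R) : hol_disk f -> 0 < d ->
  (forall N, \sum_(0 <= k < N) modulus (taylor f k) ^+ 2 <= B) ->
  exists N, forall a r, 0 <= r < 1 ->
    rmean a (fun z => modulus (f (rc r * z) - fpoly (taylor f) N (rc r * z)) ^+ 2) <= d.
Proof.
move=> hf d0 hB; pose S N := \sum_(0 <= k < N) modulus (taylor f k) ^+ 2.
have hS : has_sup (range S) by split; [exists (S 0%N), 0%N|exists B => _ [N _ <-]; exact: hB].
have [_ [N _ <-] hN] := sup_adherent d0 hS.
have SN M : S M <= S N + d.
  have : S M <= sup (range S) by apply: ub_le_sup; [case: hS|exists M].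
  by move: hN; lra.
exists N => a r hr; have ex := taylor_expands hf hr.
have r0 : 0 <= r by case/andP: hr.
have r1 : r <= 1 by case/andP: hr => _ /ltW.
pose b k := taylor f k * rc (r ^+ k).
have bE k : modulus (b k) ^+ 2 = r ^+ k ^+ 2 * modulus (taylor f k) ^+ 2.
  by rewrite modM mod_rc ger0_norm ?exprn_ge0// exprMn mulrC.
have rk k : 0 <= r ^+ k ^+ 2 <= 1 by rewrite sqr_ge0 !exprn_ile1 ?exprn_ge0.
have h1 : rmean a (fun z => modulus (f (rc r * z)) ^+ 2) <= \sum_(0 <= k < N) modulus (b k) ^+ 2 + d.
  apply: (parseval_le a ex) => M; have [MN|NM] := leqP M N.
    rewrite (@big_cat_nat _ _ _ M 0 N)//= -addrA lerDl addr_ge0 ?(ltW d0)//.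
    by apply: sumr_ge0 => k _; exact: sqr_ge0.
  rewrite (@big_cat_nat _ _ _ N 0 M) ?(ltnW NM)//= lerD2l.
  apply: (@le_trans _ _ (\sum_(N <= k < M) modulus (taylor f k) ^+ 2)).
    by apply: ler_sum => k _; rewrite bE ler_piMl ?sqr_ge0//; case/andP: (rk k).
  by have := SN M; rewrite /S (@big_cat_nat _ _ _ N 0 M) ?(ltnW NM)//= lerD2l.
move: h1; rewrite (parseval_identity a N ex) lerD2l.
apply: le_trans; rewrite le_eqVlt; apply/orP; left; apply/eqP/eq_rmean => z _.
by congr (modulus (_ - _) ^+ 2); apply: eq_bigr => k _; rewrite exprMn rcX mulrA.
Qed.

Lemma fpoly_hol (b : nat -> C) N z : hol (fpoly b N) z.
Proof.
rewrite /fpoly; elim: N => [|N IH].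
  have -> : (fun z => \sum_(0 <= k < 0) b k * z ^+ k) = (fun=> 0).
    by apply/funext => w; rewrite big_nil.
  exact: hol_cst.
have -> : (fun z => \sum_(0 <= k < N.+1) b k * z ^+ k) =
    (fun z => \sum_(0 <= k < N) b k * z ^+ k + b N * z ^+ N).
  by apply/funext => w; rewrite big_nat_recr.
apply: holD => //; apply: holM; first exact: hol_cst.
by apply: holX; exact: hol_id.
Qed.

(* A maximal inequality reduces the statement to the Taylor polynomials. *)
Lemma fatou_square f (B : R) : hol_disk f ->
  (forall N, \sum_(0 <= k < N) modulus (taylor f k) ^+ 2 <= B) ->
  mu.-negligible (angles `&` [set t | ~ has_rlim f t]).
Proof.
move=> hf hB.
pose bad (m : nat) := angles `&` [set t | ~ radial_cauchy f t (4 / m.+1%:R)].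
suff hbad m : mu.-negligible (bad m).
  apply: negligibleS (negligible_bigcup hbad) => t [ht nt].
  apply: contrapT => nb; apply: nt; apply: cauchy_has_rlim => e e0.
  apply: contrapT => ne; apply: nb.
  exists (Num.truncn (4 / e)) => //; split => // -[rho r1 hr]; apply: ne.
  exists rho => // r s h1 h2; apply: (le_trans (hr r s h1 h2)).
  by rewrite ler_pdivrMr// mulrC -ler_pdivrMr// ltW// truncnS_gt.
pose c : R := m.+1%:R^-1; have c0 : 0 < c by rewrite invr_gt0.
have key (d : R) : 0 < d -> exists E, [/\ measurable E, bad m `<=` E & (mu E <= d%:E)%E].
  (* Chosen so that the bound [max_cst * d' / c] of [max_set_le] equals [d]. *)
  move=> d0; pose d' := d * c / max_cst.
  have M0 := max_cst_gt0; have d'0 : 0 < d' by apply: divr_gt0; [exact: mulr_gt0|].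
  have [N hN] := rmean_tail hf (exprn_gt0 2 d'0) hB.
  pose P := fpoly (taylor f) N; pose u z := f z - P z.
  have hu : hol_disk u by move=> z hz; apply: holB; [exact: hf|exact: fpoly_hol].
  exists (angles `&` max_set u c 1); split.
  - by apply: max_set_measurable.
  - move=> t [ht nc]; split => //; apply: contrapT => nt; apply: nc.
    have ub r : 1 / 2 <= r < 1 -> modulus (u (rc r * cis t)) <= c.
      by move=> hr; rewrite leNgt; apply/negP => h; apply: nt; exists r.
    have cP : rcont (fun r => P (rc r * cis t)) 1.
      apply: (@rcont_ccont _ P (fun r => rc r * cis t)); last exact/hol_ccont/fpoly_hol.
      apply: (@rcont_ccont _ (fun z => z * cis t) (fun r => rc r)); first exact: rcont_rc.
      by apply: ccontM; [exact: ccont_id|exact: ccont_cst].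
    have [q q0 hq] := cP c c0.
    exists (Num.max (1 / 2) (1 - q)).
      by rewrite gt_max; apply/andP; split; [rewrite ltr_pdivrMr// mul1r ltr1n|lra].
    have pr r : Num.max (1 / 2) (1 - q) < r < 1 -> modulus (u (rc r * cis t)) <= c /\
        modulus (P (rc r * cis t) - P (rc 1 * cis t)) <= c.
      rewrite gt_max => /andP[/andP[h1 h2] h3]; split; first by apply: ub; rewrite ltW.
      by apply/ltW/hq; rewrite ltr0_norm; lra.
    move=> r s /pr[h1 h2] /pr[h3 h4].
    have -> : f (rc r * cis t) - f (rc s * cis t) =
      (u (rc r * cis t) + (P (rc r * cis t) - P (rc 1 * cis t))) -
      (u (rc s * cis t) + (P (rc s * cis t) - P (rc 1 * cis t))).
      by rewrite /u; move: (P _) (P _) (P _) (f _) (f _) => x1 x2 x3 x4 x5; ring.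
    apply: (le_trans (modB _ _)); apply: (le_trans (lerD (modD _ _) (modD _ _))).
    have -> : 4 / m.+1%:R = c + c + (c + c) by rewrite /c; ring.
    exact: lerD (lerD h1 h2) (lerD h3 h4).
  - apply: (le_trans (@max_set_le u c _ d' hu c0 d'0 (lexx _) _)).
      by move=> a r hr; exact: hN.
    by rewrite lee_fin (_ : _ / c = d)// /d'; field; rewrite !gt_eqF.
(* Being negligible requires a measurable null set containing [bad m]: it is the intersection of
   covers of measure at most [1 / (j + 1)]. *)
have /choice[E hE] : forall j : nat, exists E, [/\ measurable E, bad m `<=` E & (mu E <= j.+1%:R^-1%:E)%E].
  by move=> j; apply: key; rewrite invr_gt0.
have mE : measurable (\bigcap_j E j) by apply: bigcapT_measurable => j; case: (hE j).
exists (\bigcap_j E j); split => //; last by move=> t bt j _; case: (hE j) => _ + _; apply.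
have hj j : (mu (\bigcap_j E j) <= j.+1%:R^-1%:E)%E.
  case: (hE j) => mj _; apply: le_trans; apply: le_measure; rewrite ?inE//.
  by move=> t; apply.
apply/eqP; rewrite eq_le measure_ge0 andbT.
apply/lee_addgt0Pr => e e0; rewrite add0e.
apply: (le_trans (hj (Num.truncn e^-1))); rewrite lee_fin.
by rewrite -[leRHS]invrK lef_pV2 ?posrE ?invr_gt0// ltW// truncnS_gt.
Qed.

End Fatou.

(** * Fatou's theorem in H^1 *)

Section FatouHardyOne.
Context {R : realType}.
Local Notation C := (cplx R).
Local Notation mu := (@lebesgue_measure R).
Implicit Types (z w v l : C) (f g u : C -> C) (a r t e s d c M : R).

Lemma radial_limit_ccont f t l H : radial_limit f t l -> ccont H l ->
  radial_limit (fun z => H (f z)) t (H l).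
Proof.
move=> hf cH e /cH[d d0 hd]; have [p p1 hp] := hf _ d0.
by exists p => // r /hp /hd.
Qed.

Lemma radial_limitD f g t l1 l2 : radial_limit f t l1 -> radial_limit g t l2 ->
  radial_limit (fun z => f z + g z) t (l1 + l2).
Proof.
move=> hf hg e e0; have e2 : 0 < e / 2 by rewrite divr_gt0.
have [p p1 hp] := hf _ e2; have [q q1 hq] := hg _ e2.
exists (Num.max p q); first by rewrite gt_max p1.
move=> r; rewrite gt_max => /andP[/andP[r1 r2] r3].
rewrite opprD addrACA; apply: (le_lt_trans (modD _ _)); rewrite (splitr e).
by apply: ltrD; [apply: hp; rewrite r1|apply: hq; rewrite r2].
Qed.

Lemma radial_limitM f g t l1 l2 : radial_limit f t l1 -> radial_limit g t l2 ->
  radial_limit (fun z => f z * g z) t (l1 * l2).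
Proof.
move=> hf hg.
have sub : radial_limit (fun z => (f z - l1) * (g z - l2)) t 0.
  move=> e e0; have [p p1 hp] := hf _ e0; have [q q1 hq] := hg _ ltr01.
  exists (Num.max p q); first by rewrite gt_max p1.
  move=> r; rewrite gt_max => /andP[/andP[r1 r2] r3]; rewrite subr0 modM.
  have h1 : modulus (f (rc r * cis t) - l1) < e by apply: hp; rewrite r1.
  have h2 : modulus (g (rc r * cis t) - l2) < 1 by apply: hq; rewrite r2.
  rewrite -[ltRHS]mulr1; apply: ltr_pM => //; exact: mod_ge0.
have cst (c : C) : radial_limit (fun=> c) t c.
  by move=> e e0; exists 0 => // r _; rewrite subrr mod0.
have cM (c : C) h l : radial_limit h t l -> radial_limit (fun z => c * h z) t (c * l).
  move=> hh; apply: (@radial_limit_ccont _ _ _ (fun z => c * z)) => //.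
  by apply: ccontM; [exact: ccont_cst|exact: ccont_id].
have := radial_limitD sub (radial_limitD (cM l1 _ _ hg) (radial_limitD (cM l2 _ _ hf) (cst (- (l1 * l2))))).
have -> : 0 + (l1 * l2 + (l2 * l1 + - (l1 * l2))) = l1 * l2 by ring.
move=> h e /h[p p1 hp]; exists p => // r /hp.
by have -> : forall x y : C, (x - l1) * (y - l2) + (l1 * y + (l2 * x + - (l1 * l2))) = x * y
  by move=> x y; ring.
Qed.

Lemma bernoulli_sub (e : R) n : 0 <= e <= 1 -> 1 - n%:R * e <= (1 - e) ^+ n.
Proof.
move=> he; elim: n => [|n IH]; first by rewrite mul0r subr0 expr0.
rewrite exprS -natr1; have h : 0 <= 1 - e by lra.
have := ler_wpM2l h IH; have : 0 <= n%:R * e * e by rewrite !mulr_ge0//; lra.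
by rewrite [(n%:R + 1) * e]mulrDl mul1r; move: (n%:R * e) ((1 - e) ^+ n) => y q; nra.
Qed.

Lemma coef_sum_le (x : nat -> R) N (B : R) : (forall k, 0 <= x k) ->
  (forall r, 0 < r < 1 -> \sum_(0 <= k < N) x k * r ^+ k <= B) -> \sum_(0 <= k < N) x k <= B.
Proof.
move=> x0 hB; set S := \sum_(0 <= k < N) x k.
have S0 : 0 <= S by exact: sumr_ge0.
apply/ler_addgt0Pr => e e0.
pose d := Num.min (1 / 2) (e / (N%:R * S + 1)).
have K0 : 0 < N%:R * S + 1 by rewrite ltr_wpDl// mulr_ge0.
have d0 : 0 < d by rewrite lt_min !divr_gt0.
have d2 : d <= 1 / 2 by rewrite ge_min lexx.
have de : N%:R * S * d <= e.
  apply: (@le_trans _ _ ((N%:R * S + 1) * d)); first by rewrite ler_wpM2r ?(ltW d0)// lerDl.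
  by rewrite mulrC -ler_pdivlMr// ge_min lexx orbT.
have hr : 0 < 1 - d < 1 by lra.
have h1 : S * (1 - d) ^+ N <= B.
  apply: le_trans (hB _ hr); rewrite /S big_distrl /= !big_nat; apply: ler_sum => k /andP[_ kN].
  by apply: ler_wpM2l => //; apply: ler_wiXn2l; [lra|lra|exact: ltnW].
have hd : 0 <= d <= 1 by lra.
have := ler_wpM2l S0 (bernoulli_sub N hd); rewrite mulrBr mulr1 => h2.
have -> : S = S - S * (N%:R * d) + N%:R * S * d by ring.
by apply: lerD => //; exact: le_trans h1.
Qed.

Lemma hol_coef_sq_le f (B : R) N : hol_disk f ->
  (forall r, 0 < r < 1 -> rmean 0 (fun z => modulus (f (rc r * z)) ^+ 2) <= B) ->
  \sum_(0 <= k < N) modulus (taylor f k) ^+ 2 <= B.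
Proof.
move=> hf hB; apply: coef_sum_le => [k|r /andP[r0 r1]]; first exact: sqr_ge0.
(* On the circle of radius [sqrt r] the square sum carries exactly the weights [r ^ k] of
   [coef_sum_le]. *)
pose q := Num.sqrt r; have q0 : 0 < q by rewrite sqrtr_gt0.
have qq : q ^+ 2 = r by rewrite sqr_sqrtr// ltW.
have q1 : q < 1 by rewrite -(@ltr_pXn2r _ 2)// ?nnegrE ?ltW// qq expr1n.
have hq : 0 < q < 1 by rewrite q0. have hq' : 0 <= q < 1 by rewrite ltW.
apply: le_trans (hB q hq); apply: le_trans (bessel 0 N (taylor_expands hf hq')).
rewrite le_eqVlt; apply/orP; left; apply/eqP; apply: eq_bigr => k _.
by rewrite modM mod_rc ger0_norm ?exprn_ge0 ?(ltW q0)// exprMn -exprM mulnC exprM qq.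
Qed.

Lemma fatou_bounded f M : hol_disk f -> (forall z, modulus z < 1 -> modulus (f z) <= M) ->
  mu.-negligible (angles `&` [set t | ~ has_rlim f t]).
Proof.
move=> hf hM; have M0 : 0 <= M by apply: le_trans (hM 0 _); rewrite ?mod0 ?ltr01// mod_ge0.
apply: (@fatou_square _ f (M ^+ 2)) => // N; apply: hol_coef_sq_le => // r hr.
have hr' : 0 <= r < 1 by case/andP: hr => /ltW -> ->.
rewrite -(rmean_cst 0 (M ^+ 2)); apply: le_rmean.
- by apply: circ_cont_modX; exact: hol_disk_circ.
- exact: circ_cont_cst.
- move=> z hz; apply: lerXn2r; rewrite ?nnegrE ?mod_ge0//; apply: hM.
  by rewrite modM hz mulr1 mod_rc ger0_norm; case/andP: hr'.
Qed.

(** Taylor coefficients of the Herglotz integral, the mean of [h z (1 + v conj z) / (1 - v conj z)],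
    whose real part is the Poisson integral of [h]. *)
Definition herglotz (h : C -> R) (k : nat) : C :=
  (if k == 0%N then 1 else 2) * cmean 0 (fun z => rc (h z) * conjc z ^+ k).

Lemma herglotz_bound (h : C -> R) k : circ_cont (fun z => rc (h z)) -> (forall z, 0 <= h z) ->
  modulus (herglotz h k) <= 2 * rmean 0 h.
Proof.
move=> ch h0; rewrite modM; apply: ler_pM; rewrite ?mod_ge0//.
  case: ifP => _; first by rewrite mod1 ler1n.
  by rewrite -[2]/(2%:R) -rc_nat mod_rc ger0_norm.
have cX : circ_cont (fun z => rc (h z) * conjc z ^+ k) by apply: circ_contM => //; exact: circ_contXJ.
apply: (le_trans (mod_cmean _ cX)); rewrite le_eqVlt; apply/orP; left; apply/eqP/eq_rmean => z hz.
by rewrite modM modX modJ hz expr1n mulr1 mod_rc ger0_norm.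
Qed.

Lemma Re_cmean a (h : C -> R) (q : C -> C) : circ_cont (fun z => rc (h z) * q z) ->
  complex.Re (cmean a (fun z => rc (h z) * q z)) = rmean a (fun z => h z * complex.Re (q z)).
Proof.
move=> c; rewrite cReM /= mul0r subr0; congr (_ * _); apply: eq_rint => t _.
by rewrite cReM /= mul0r subr0.
Qed.

Lemma Re_herglotz_kernel w : modulus w < 1 -> complex.Re (2 * (1 - w)^-1 - 1) = poisson w.
Proof.
move=> w1; have n0 := sub1_neq0 w1.
have n1 : 1 - conjc w != 0 by apply: sub1_neq0; rewrite modJ.
have -> : poisson w = complex.Re (rc (poisson w)) by [].
rewrite poissonE// (_ : conjc w * (1 - conjc w)^-1 = conjc ((1 - w)^-1) - 1); last first.
  have e (c : C) : 1 - c != 0 -> c * (1 - c)^-1 = (1 - c)^-1 - 1 by move=> hc; field.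
  by rewrite (complex.conjc_inv (1 - w)) conjD conjN (conj_rc 1) (e (conjc w)).
by rewrite !cReD !cReN cReJ mulr2n mulrDl mul1r cReD; ring.
Qed.

(** Stated for partial sums because these involve finitely many coefficients and therefore pass to
    the limit along an ultrafilter. The subtracted term bounds the remainder of the geometric series
    of the kernel. *)
Lemma herglotz_partial (h : C -> R) N v : circ_cont (fun z => rc (h z)) -> (forall z, 0 <= h z) ->
  modulus v < 1 ->
  rmean 0 (fun z => h z * poisson (v * conjc z)) - 2 * rmean 0 h * modulus v ^+ N.+1 / (1 - modulus v) <=
  complex.Re (fpoly (herglotz h) N.+1 v).
Proof.
move=> ch h0 v1; pose q (z : C) : C := 2 * (1 - v * conjc z)^-1 - 1.
have cK := circ_cont_geomJ v1.
have c2 (H : C -> C) (x : C) : circ_cont H -> circ_cont (fun z => x * H z).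
  by move=> cH; apply: circ_contM => //; exact: circ_cont_cst.
have cq : circ_cont q by apply: circ_contD; [exact: c2|exact: circ_cont_cst].
have cX k : circ_cont (fun z => rc (h z) * conjc z ^+ k) by apply: circ_contM => //; exact: circ_contXJ.
have vz z : modulus z = 1 -> modulus (v * conjc z) < 1 by move=> hz; rewrite modM modJ hz mulr1.
have E : cmean 0 (fun z => rc (h z) * q z) = fpoly (herglotz h) N.+1 v +
   cmean 0 (fun z => rc (h z) * (2 * (v * conjc z) ^+ N.+1 * (1 - v * conjc z)^-1)).
  rewrite (@eq_cmean _ _ (fun z => rc (h z) * q z) (fun z =>
    \sum_(0 <= k < N.+1) (if k == 0%N then 1 else 2) * v ^+ k * (rc (h z) * conjc z ^+ k) +
     rc (h z) * (2 * (v * conjc z) ^+ N.+1 * (1 - v * conjc z)^-1))); last first.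
    move=> z hz; rewrite /q {1}(geomE N.+1 (sub1_neq0 (vz z hz))).
    have -> : \sum_(0 <= k < N.+1) (if k == 0%N then 1 else 2) * v ^+ k * (rc (h z) * conjc z ^+ k) =
       rc (h z) * (2 * (\sum_(0 <= k < N.+1) (v * conjc z) ^+ k) - 1).
      elim: (N) => [|n IH]; first by rewrite !big_nat1 eqxx !expr0; ring.
      by rewrite big_nat_recr//= IH [in RHS]big_nat_recr//= exprMn; ring.
    by ring.
  rewrite cmeanD; first last.
  - apply: circ_contM => //; apply: circ_contM => //; apply: c2 => z hz; apply: ccontX.
    by apply: ccontM; [exact: ccont_cst|exact: ccontJ].
  - by apply: circ_cont_sum => k; exact: c2.
  congr (_ + _); rewrite cmean_sum; last by move=> k; exact: c2.
  by apply: eq_bigr => k _; rewrite cmeanZ// /herglotz; ring.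
have -> : rmean 0 (fun z => h z * poisson (v * conjc z)) = complex.Re (cmean 0 (fun z => rc (h z) * q z)).
  rewrite Re_cmean; last exact: circ_contM.
  by apply: eq_rmean => z hz; rewrite /q Re_herglotz_kernel// vz.
rewrite E cReD -addrA gerDl subr_le0.
set T := cmean 0 _; apply: (le_trans (ler_norm _)); apply: (le_trans (Re_le_mod _)).
have cT : circ_cont (fun z => rc (h z) * (2 * (v * conjc z) ^+ N.+1 * (1 - v * conjc z)^-1)).
  apply: circ_contM => //; apply: circ_contM => //; apply: c2 => z hz; apply: ccontX.
  by apply: ccontM; [exact: ccont_cst|exact: ccontJ].
apply: (le_trans (mod_cmean _ cT)).
have -> : 2 * rmean 0 h * modulus v ^+ N.+1 / (1 - modulus v) =
  rmean 0 (fun z => 2 * modulus v ^+ N.+1 / (1 - modulus v) * h z).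
  by rewrite rmeanZ//; ring.
apply: le_rmean; first exact: circ_cont_mod.
  move=> z hz; apply: (@ccont_local _ _ (fun z => rc (2 * modulus v ^+ N.+1 / (1 - modulus v)) * rc (h z)) _ 1 ltr01).
    by move=> w _; rewrite -rcM.
  by apply: ccontM; [exact: ccont_cst|exact: ch].
move=> z hz; rewrite !modM modV modX modM modJ hz mulr1 mod_rc ger0_norm// mulrC.
apply: ler_wpM2r => //; rewrite -[2 in leLHS]/(2%:R) -rc_nat mod_rc ger0_norm//.
apply: ler_wpM2l; first by rewrite mulr_ge0// exprn_ge0// mod_ge0.
have p0 : 0 < modulus (1 - v * conjc z) by rewrite mod_gt0 sub1_neq0// vz.
rewrite lef_pV2 ?posrE ?subr_gt0//.
by have := mod_sub_ge 1 (v * conjc z); rewrite mod1 modM modJ hz mulr1.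
Qed.

Lemma herglotz_majorant g M : hol_disk g ->
  (forall r, 0 <= r < 1 -> rmean 0 (fun z => modulus (g (rc r * z))) <= M) ->
  exists2 U, hol_disk U & forall v, modulus v < 1 -> modulus (g v) <= complex.Re (U v).
Proof.
(* U is a limit, along an ultrafilter, of the Herglotz integrals of |g| on
   circles of radius tending to 1. *)
move=> hg hM; pose r (n : nat) : R := 1 - n.+2%:R^-1.
have hr n : 0 < r n < 1.
  have : n.+2%:R^-1 < 1 :> R by rewrite invf_lt1 ?ltr1n.
  have : 0 < n.+2%:R^-1 :> R by rewrite invr_gt0.
  by rewrite /r; move: (n.+2%:R^-1) => x; lra.
have hr' n : 0 <= r n < 1 by case/andP: (hr n) => /ltW -> ->.
pose h n z := modulus (g (rc (r n) * z)).
have cg n : circ_cont (fun z => g (rc (r n) * z)) by exact: hol_disk_circ.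
have ch n : circ_cont (fun z => rc (h n z)) by exact: circ_cont_mod.
have h0 n z : 0 <= h n z by exact: mod_ge0.
have ub n k : modulus (herglotz (h n) k) <= 2 * M.
  apply: (le_trans (herglotz_bound k (ch n) (h0 n))); apply: ler_wpM2l => //; exact: hM.
have /choice[b hb] : forall k, exists l, uconv (fun n => herglotz (h n) k) l.
  by move=> k; apply: (@bounded_uconv _ _ (2 * M)) => n; exact: ub.
have bM k : modulus (b k) <= 2 * M by exact: (uconv_le (hb k)).
exists (psum b) => [|v v1]; first exact: psum_hol bM.
have hv : 0 <= modulus v < 1 by rewrite mod_ge0.
have M0 : 0 <= M by apply: le_trans (hM 0 _); [apply: rmean_ge0 => z _; exact: mod_ge0|rewrite lexx ltr01].
pose K := 2 * M / (1 - modulus v).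
have K0 : 0 <= K by rewrite divr_ge0 ?mulr_ge0// subr_ge0 ltW.
have part n N : modulus (g (rc (r n) * v)) - K * modulus v ^+ N.+1 <=
    complex.Re (fpoly (herglotz (h n)) N.+1 v).
  apply: le_trans (herglotz_partial N (ch n) (h0 n) v1); apply: lerB.
    have ri : 1 < (r n)^-1 by rewrite invf_gt1; case/andP: (hr n).
    have hg' := @hol_disk_scale _ g (r n) hg _.
    have cP := circ_cont_poisson v1.
    rewrite -(@poisson_formula _ 0 (fun z => g (rc (r n) * z)) _ v ri)//; last first.
      by move=> z hz; apply: hg' => //; case/andP: (hr n).
    have cM : circ_cont (fun z => g (rc (r n) * z) * rc (poisson (v * conjc z))) by exact: circ_contM.
    apply: (le_trans (mod_cmean _ cM)); rewrite le_eqVlt; apply/orP; left; apply/eqP/eq_rmean => z hz.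
    by rewrite modM mod_rc ger0_norm// poisson_ge0// modM modJ hz mulr1.
  rewrite /K [leRHS]mulrAC; apply: ler_wpM2r; first by rewrite invr_ge0 subr_ge0 ltW.
  apply: ler_wpM2r; first by rewrite exprn_ge0// mod_ge0.
  by apply: ler_wpM2l => //; exact: hM.
(* Only [N + 1] coefficients occur, so a single index [n] makes all of them close to their limits
   and [r n] close to 1. *)
have lim N : modulus (g v) - K * modulus v ^+ N.+1 <= complex.Re (fpoly b N.+1 v).
  apply/ler_addgt0Pr => e e0.
  have e2 : 0 < e / 2 by rewrite divr_gt0.
  pose e3 := e / 2 / N.+1%:R; have e30 : 0 < e3 by rewrite divr_gt0.
  have [d d0 hd] := hol_ccont (hg v v1) e2.
  pose n0 := Num.truncn d^-1.
  have hU := ultra_forall N.+1 (fun k => hb k e3 e30).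
  have /ultra_nonempty[n [/= hn nn0]] := ultraI hU (ultra_ge n0).
  have h1 : modulus (g (rc (r n) * v) - g v) < e / 2.
    apply: hd; have -> : rc (r n) * v - v = rc (r n - 1) * v by rewrite (rcB (r n) 1) rc1; ring.
    rewrite modM mod_rc /r addrAC subrr add0r normrN ger0_norm ?invr_ge0//.
    apply: (@le_lt_trans _ _ n.+2%:R^-1); first by rewrite ler_piMr ?invr_ge0// ltW.
    rewrite -[ltRHS]invrK ltf_pV2 ?posrE ?invr_gt0//.
    by apply: (lt_le_trans (truncnS_gt _)); rewrite ler_nat ltnS (leq_trans nn0).
  have h2 : modulus (fpoly (herglotz (h n)) N.+1 v - fpoly b N.+1 v) <= e / 2.
    rewrite /fpoly -sumrB; apply: (le_trans (mod_sum _ _ _)).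
    apply: (@le_trans _ _ (\sum_(0 <= k < N.+1) e3)).
      rewrite !big_nat; apply: ler_sum => k /andP[_ kN]; rewrite -mulrBl modM modX -[leRHS]mulr1.
      apply: ler_pM; rewrite ?exprn_ge0 ?mod_ge0//; first by apply: ltW; exact: hn.
      by rewrite exprn_ile1 ?mod_ge0// ltW.
    by rewrite sumr_const_nat subn0 /e3 -[X in X <= _]mulr_natr divfK.
  have := part n N; have := mod_sub_ge (g v) (g (rc (r n) * v)); rewrite mod_distC.
  have := le_trans (ler_norm _) (Re_le_mod (fpoly (herglotz (h n)) N.+1 v - fpoly b N.+1 v)).
  by rewrite cReB; move: (K * _) => x; lra.
pose K2 := 2 * (2 * M) / (1 - modulus v).
have K20 : 0 <= K2 by rewrite divr_ge0 ?mulr_ge0// subr_ge0 ltW.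
rewrite -subr_le0; apply: (@geom_squeeze _ (modulus v) (K + K2)) => // N.
have t := @psum_tail _ b (2 * M) (modulus v) v N.+1 bM hv (lexx _).
have := le_trans (ler_norm _) (Re_le_mod (fpoly b N.+1 v - psum b v)).
rewrite cReB mod_distC => t2; have {}t := le_trans t2 t.
have l := lim N.
apply: (@le_trans _ _ ((K + K2) * modulus v ^+ N.+1)).
  move: t l; rewrite -/K2 mulrDl.
  by move: (K * modulus v ^+ N.+1) (K2 * modulus v ^+ N.+1) => x y; lra.
apply: ler_wpM2l; first exact: addr_ge0.
by apply: ler_wiXn2l; [exact: mod_ge0|exact: ltW|exact: leqnSn].
Qed.

Lemma limn_einf_ge (u : (\bar R)^nat) (x : \bar R) N :
  (forall n, (N <= n)%N -> (x <= u n)%E) -> (x <= limn_einf u)%E.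
Proof.
move=> h; rewrite limn_einf_lim; apply: lime_ge; first exact: is_cvg_einfs.
exists N => // n /= Nn; apply: le_ereal_inf_tmp => _ [k /= nk <-].
by apply: h; exact: leq_trans nk.
Qed.

Lemma measurable_limn_einf (D : set R) (u : nat -> R -> \bar R) :
  (forall n, measurable_fun D (u n)) -> measurable_fun D (fun t => limn_einf (u ^~ t)).
Proof.
move=> mu_.
have -> : (fun t => limn_einf (u ^~ t)) = -%E \o (fun t => limn_esup ((fun n => -%E \o u n) ^~ t)) by [].
apply: measurableT_comp => //; apply: measurable_fun_limn_esup => n.
have := @measurableT_comp _ _ _ _ _ _ (-%E) D (u n) (@oppe_measurable R setT) (mu_ n).
exact.
Qed.

(** Where [exp(-U)] tends to 0, [Re U] tends to infinity. Fatou's lemma bounds the integral of the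
    lower limit of [Re U] by [2 pi Re U(0)], so this lower limit is finite almost everywhere. *)
Lemma neg_exp_Re_null U : hol_disk U -> (forall v, modulus v < 1 -> 0 <= complex.Re (U v)) ->
  mu.-negligible (angles `&` [set t | radial_limit (fun z => cexp (- U z)) t 0]).
Proof.
move=> hU U0; pose r (n : nat) : R := 1 - n.+2%:R^-1.
have hr n : 0 <= r n < 1.
  have : n.+2%:R^-1 <= 1 :> R by rewrite invf_le1 ?ler1n.
  have : 0 < n.+2%:R^-1 :> R by rewrite invr_gt0.
  by rewrite /r; move: (n.+2%:R^-1) => x; lra.
pose A := `[(0 : R), 0 + 2 * pi]%classic : set R.
have mA : measurable A by exact: measurable_itv.
pose F n t := complex.Re (U (rc (r n) * cis t)).
have cU n : circ_cont (fun z => U (rc (r n) * z)) by exact: hol_disk_circ.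
have cF n : cts_on 0 (0 + 2 * pi) (F n).
  have := @rcont_on_Re _ 0 (0 + 2 * pi) (fun t => U (rc (r n) * cis t)).
  by apply; exact: (@circ_rcont _ (fun z => U (rc (r n) * z))).
have F0 n t : 0 <= F n t.
  by apply: U0; rewrite modM mod_cis mulr1 mod_rc ger0_norm; case/andP: (hr n).
have mF n : measurable_fun A (EFin \o F n).
  by apply/measurable_EFinP; exact: cts_measurable.
pose G t := limn_einf (fun n => (F n t)%:E).
have IF n : (\int[mu]_(t in A) (F n t)%:E = (2 * pi * complex.Re (U 0))%:E)%E.
  rewrite integral_rint//; congr EFin.
  have : complex.Re (cmean 0 (fun z => U (rc (r n) * z))) = complex.Re (U 0).
    congr complex.Re; apply: (@mean_value _ 0 U 1 0) => //.
    - by move=> z /hU/hol_ccont.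
    - by move=> z /hU.
  rewrite cReM /= mul0r subr0 => <-.
  by rewrite mulrA divff ?mul1r// gt_eqF// twopi_gt0.
have G0 t : (0 <= G t)%E by apply: (@limn_einf_ge _ _ 0%N) => n _; rewrite lee_fin.
have mG : measurable_fun A G by exact: measurable_limn_einf.
have iG : mu.-integrable A G.
  apply/integrableP; split => //.
  have -> : (\int[mu]_(x in A) `|G x| = \int[mu]_(x in A) G x)%E.
    by apply: eq_integral => t _; rewrite gee0_abs.
  have := @fatou _ _ _ mu A mA (fun n t => (F n t)%:E) mF _.
  move=> h; apply: le_lt_trans (h _) _; first by move=> n t _; rewrite lee_fin.
  have -> : (fun n => \int[mu]_(x in A) (F n x)%:E)%E = cst ((2 * pi * complex.Re (U 0))%:E).
    by apply/funext => n; exact: IF.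
  by rewrite (cvg_limn_einf_sup (@cvg_cst _ _ _ _ _)) ltry.
have [N [mN N0 hN]] := @integrable_ae _ _ _ mu A mA G iG.
exists N; split => // t [ht hl]; apply: hN => /=.
have tA : A t.
  by move: ht; rewrite /angles /A /= !in_itv /= add0r => /andP[-> /ltW].
suff -> : G t = +oo%E by move=> /(_ tA).
apply/eqyP => K _.
have [p p1 hp] := hl _ (expR_gt0 (- K)).
apply: (@limn_einf_ge _ _ (Num.truncn (1 - p)^-1)) => n hn; rewrite lee_fin.
have rp : p < r n < 1.
  have [_ ->] := andP (hr n); rewrite andbT.
  have p0 : 0 < 1 - p by rewrite subr_gt0.
  have : n.+2%:R^-1 < 1 - p.
    rewrite -[ltRHS]invrK ltf_pV2 ?posrE ?invr_gt0//.
    by apply: (lt_le_trans (truncnS_gt _)); rewrite ler_nat ltnS (leq_trans hn).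
  by rewrite /r; move: (n.+2%:R^-1) => x; lra.
by have := hp _ rp; rewrite subr0 mod_cexp cReN ltr_expR ltrN2 => /ltW.
Qed.

Lemma fatou_hardy1 g M : hol_disk g ->
  (forall r, 0 <= r < 1 -> rmean 0 (fun z => modulus (g (rc r * z))) <= M) ->
  mu.-negligible (angles `&` [set t | ~ has_rlim g t]).
Proof.
move=> hg hM; have [U hU gU] := herglotz_majorant hg hM.
have U0 v : modulus v < 1 -> 0 <= complex.Re (U v).
  by move=> /gU; apply: le_trans; exact: mod_ge0.
(* exp(-U) and g exp(-U) are bounded, so both have radial limits almost
   everywhere; that of exp(-U) vanishes only on a null set. *)
pose E z := cexp (- U z).
have hE : hol_disk E.
  move=> z z1; apply: (@hol_comp _ (fun z => - U z)); last exact: hol_cexp.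
  by apply: holN; exact: hU.
have mE z : modulus (E z) = expR (- complex.Re (U z)) by rewrite mod_cexp cReN.
have E1 z : modulus z < 1 -> modulus (E z) <= 1.
  by move=> z1; rewrite mE -expR0 ler_expR oppr_le0; exact: U0.
have gE1 z : modulus z < 1 -> modulus (g z * E z) <= 1.
  move=> z1; rewrite modM mE; apply: (@le_trans _ _ (complex.Re (U z) * expR (- complex.Re (U z)))).
    by apply: ler_wpM2r; [exact: expR_ge0|exact: gU].
  rewrite expRN ler_pdivrMr ?expR_gt0// mul1r; have := expR_ge1Dx (complex.Re (U z)); lra.
have hgE : hol_disk (fun z => g z * E z) by move=> z z1; apply: holM; [exact: hg|exact: hE].
have n1 := fatou_bounded hE E1.
have n2 := fatou_bounded hgE gE1.
have n3 := neg_exp_Re_null hU U0.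
apply: negligibleS (negligibleU (negligibleU n1 n2) n3) => t [ht ng].
have [|/contrapT[l hl]] := pselect (~ has_rlim E t); first by left; left.
have [|/contrapT[m hm]] := pselect (~ has_rlim (fun z => g z * E z) t); first by left; right.
right; split => //; have [l0|l0] := eqVneq l 0; first by rewrite -l0.
exfalso; apply: ng; exists (m * l^-1).
have h := radial_limitM hm (@radial_limit_ccont _ _ _ (fun z => z^-1) hl (ccontV l0)).
move=> e /h[p p1 hp]; exists p => // r /hp.
rewrite mulfK// -mod_gt0 mE; exact: expR_gt0.
Qed.

End FatouHardyOne.

(** * Hardy-Orlicz spaces and Carleson windows *)

Section DefinitionLinks.
Context {R : realType}.
Local Notation C := (cplx R).
Local Notation mu := (@lebesgue_measure R).
Implicit Types (z w v l xi : C) (f g u : C -> C) (a r t e s d c M : R).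

Lemma left_limit_cvg (G : R -> C) l :
  (forall e, 0 < e -> exists2 p : R, p < 1 & forall r, p < r < 1 -> modulus (G r - l) < e) <->
  (G r @[r --> (1 : R)^'-] --> l).
Proof.
split=> [h|h].
  apply/cvgrPdist_lt => -[e1 e2]; rewrite complex.ltcE /= => /andP[/eqP -> e0].
  have [p p1 hp] := h _ e0; near=> r.
  have : modulus (G r - l) < e1.
    apply: hp; apply/andP; split; near: r; first exact: nbhs_left_gt.
    exact: nbhs_left_lt.
  rewrite mod_distC complex.normc_def complex.ltcE /= eqxx /=.
  by case: (l - _).
move=> e e0; move/cvgrPdist_lt : h => /(_ (rc e)).
have /[swap]/[apply] : 0 < rc e by rewrite complex.ltcE /= eqxx.
rewrite near_withinE => -[/= d d0 hd]; exists (1 - d); first lra.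
move=> r /andP[r1 r2]; have := hd r; rewrite /ball_ /= => /(_ _ r2).
rewrite ger0_norm; last by lra.
have dr : 1 - r < d by lra.
move=> /(_ dr); rewrite complex.normc_def complex.ltcE /= eqxx /= mod_distC.
by case: (l - _).
Unshelve. all: by end_near. Qed.

Lemma real_filter_cvg_radial f t l : radial_limit f t l <->
  (f (real_complex R r * cis t) @[r --> (1 : R)^'-] --> l).
Proof. exact: left_limit_cvg. Qed.

Lemma bv_rlim f t l : radial_limit f t l -> boundary_value f (cis t) = l.
Proof.
move=> /real_filter_cvg_radial h; rewrite /boundary_value.
by apply/cvg_lim => //; exact: norm_hausdorff.
Qed.

(** The default value of [lim] is 0, a point that lies in no Carleson window of height [h < 1];
    [pullback_alpha_carleson] relies on this. *)
Lemma bv_norlim f t : ~ has_rlim f t -> boundary_value f (cis t) = 0.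
Proof.
move=> h; rewrite /boundary_value dvgP//; apply/cvg_ex => -[l hl].
by apply: h; exists l; apply/real_filter_cvg_radial.
Qed.

Lemma radial_limit_closed f t : ccont f (cis t) -> radial_limit f t (f (cis t)).
Proof.
move=> cf e /cf[d d0 hd]; exists (1 - d); first lra.
move=> r /andP[r1 r2]; apply: hd.
have -> : rc r * cis t - cis t = rc (r - 1) * cis t by rewrite (rcB r 1) rc1; ring.
by rewrite modM mod_cis mulr1 mod_rc ltr0_norm; lra.
Qed.

Lemma radial_limit_mod_le f t l M : radial_limit f t l ->
  (forall z, modulus z < 1 -> modulus (f z) <= M) -> modulus l <= M.
Proof.
move=> hl hM; apply/ler_addgt0Pr => e e0; have [p p1 hp] := hl _ e0.
pose r := (1 + Num.max 0 p) / 2.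
have m1 : Num.max 0 p < 1 by rewrite gt_max ltr01.
have m0 : 0 <= Num.max 0 p by rewrite le_max lexx.
have mp : p <= Num.max 0 p by rewrite le_max lexx orbT.
have h := hp r; rewrite /r in h *; have {}h := h ltac:(lra).
have hz : modulus (rc ((1 + Num.max 0 p) / 2) * cis t) < 1.
  by rewrite modM mod_cis mulr1 mod_rc ger0_norm; lra.
have := hM _ hz; have := mod_sub_ge l (f (rc ((1 + Num.max 0 p) / 2) * cis t)).
by rewrite mod_distC; lra.
Qed.

(** The integral of a nonnegative function is a supremum over simple functions below it, which is
    monotone for arbitrary functions. It serves for modulars, whose integrands are not shown to be
    measurable. *)
Lemma ge0_le_integral_nomeas (D : set R) (f g : R -> \bar R) :
  (forall x, D x -> (0 <= f x)%E) -> (forall x, D x -> (f x <= g x)%E) ->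
  (\int[mu]_(x in D) f x <= \int[mu]_(x in D) g x)%E.
Proof.
move=> f0 fg.
have g0 x : D x -> (0 <= g x)%E by move=> Dx; exact: le_trans (f0 x Dx) (fg x Dx).
rewrite integral_mkcond [leRHS]integral_mkcond.
have F0 x : (0 <= (f \_ D) x)%E by rewrite patchE; case: ifPn => //; rewrite inE => /f0.
have G0 x : (0 <= (g \_ D) x)%E by rewrite patchE; case: ifPn => //; rewrite inE => /g0.
rewrite !ge0_integralTE//; apply: ereal_sup_le => _ [h /= hf <-]; exists h => //= x.
apply: (le_trans (hf x)); rewrite !patchE; case: ifPn => //; rewrite inE; exact: fg.
Qed.

Lemma angles_closed : @angles R `<=` `[0, 0 + 2 * pi]%classic.
Proof. by move=> t; rewrite /angles /= !in_itv /= add0r => /andP[-> /ltW]. Qed.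

Lemma angles_integral (F : R -> R) : cts_on 0 (0 + 2 * pi) F ->
  (\int[mu]_(t in angles) (F t)%:E = (rint 0 (0 + 2 * pi) F)%:E)%E.
Proof.
move=> cF; rewrite -integral_rint// /angles add0r integral_itv_bndo_bndc//.
apply/measurable_EFinP; apply: measurable_funS (cts_measurable cF) => //.
by move=> t /=; rewrite !in_itv /= add0r => /andP[-> /ltW].
Qed.

Lemma circle_integral_rmean (u : C -> R) : circ_cont (fun z => rc (u z)) ->
  circle_integral (fun xi => (u xi)%:E) = (rmean 0 u)%:E.
Proof.
move=> cu; rewrite /circle_integral angles_integral; last exact: circ_rc_cts.
by rewrite -EFinM.
Qed.

Lemma mu_angles : mu angles = (2 * pi)%:E.
Proof.
rewrite /angles lebesgue_measure_itv /= lte_fin twopi_gt0.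
by rewrite -EFinB subr0.
Qed.

Lemma hardy1_bounded f : hol_disk f -> (hardy_norm 1 f < +oo)%E ->
  exists M, forall r, 0 <= r < 1 -> rmean 0 (fun z => modulus (f (rc r * z))) <= M.
Proof.
move=> hf; rewrite /hardy_norm invr1.
set S := [set _ | _ in _]; have S0 : (0 <= ereal_sup S)%E.
  apply: (@le_trans _ _ (circle_integral (fun xi => (modulus (f (real_complex R 0 * xi)) `^ 1)%:E))).
    rewrite /circle_integral mule_ge0 ?lee_fin ?inv2pi_ge0//.
    by apply: integral_ge0 => t _; rewrite lee_fin powR_ge0.
  by apply: ereal_sup_ubound; exists 0 => //=; rewrite lexx ltr01.
rewrite poweRe1// => Sfin; exists (fine (ereal_sup S)) => r hr.
rewrite -lee_fin fineK; last by rewrite ge0_fin_numE.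
apply: ereal_sup_ubound; exists r => //.
rewrite -circle_integral_rmean; last by apply: circ_cont_mod; exact: hol_disk_circ.
by congr circle_integral; apply/funext => xi; rewrite powRr1// mod_ge0.
Qed.

Lemma bounded_hardy1 f M : hol_disk f -> (forall z, modulus z < 1 -> modulus (f z) <= M) ->
  hardy_space 1 f.
Proof.
move=> hf hM; split; first exact/analytic_hol.
rewrite /hardy_norm invr1; set S := [set _ | _ in _].
have SM : (ereal_sup S <= M%:E)%E.
  apply: ge_ereal_sup => _ [r /= hr <-].
  rewrite (_ : (fun xi => _) = (fun xi => (modulus (f (rc r * xi)))%:E)); last first.
    by apply/funext => xi; rewrite powRr1// mod_ge0.
  rewrite circle_integral_rmean; last by apply: circ_cont_mod; exact: hol_disk_circ.
  rewrite lee_fin -(rmean_cst 0 M); apply: le_rmean.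
  - by apply: circ_cont_mod; exact: hol_disk_circ.
  - exact: circ_cont_cst.
  - by move=> z hz; apply: hM; rewrite modM hz mulr1 mod_rc ger0_norm; case/andP: hr.
have S0 : (0 <= ereal_sup S)%E.
  apply: (@le_trans _ _ (circle_integral (fun xi => (modulus (f (real_complex R 0 * xi)) `^ 1)%:E))).
    rewrite /circle_integral mule_ge0 ?lee_fin ?inv2pi_ge0//.
    by apply: integral_ge0 => t _; rewrite lee_fin powR_ge0.
  by apply: ereal_sup_ubound; exists 0 => //=; rewrite lexx ltr01.
by rewrite poweRe1//; exact: (le_lt_trans SM (ltry _)).
Qed.

End DefinitionLinks.

(** * Orlicz functions and condition Delta^2 *)

Section OrliczFunction.
Context {R : realType} (Psi : \bar R -> \bar R).
Hypothesis oPsi : orlicz_function Psi.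
Local Open Scope ereal_scope.
Implicit Types (x y t h : R).

Lemma orlicz_contract t x : (0 <= t <= 1)%R -> (0 <= x)%R ->
  Psi (t * x)%R%:E <= t%:E * Psi x%:E.
Proof.
move=> ht x0; have := orlicz_convex oPsi (x := x%:E) (y := 0) (t := t) _ _ ht.
by rewrite lee_fin (orlicz0 oPsi) !mule0 !adde0 -EFinM => /(_ x0 (lexx _)).
Qed.

(** For [x > 0], [Psi x] is the smaller side of the strict convexity inequality at the midpoint of 0
    and [2 x], so it cannot be infinite. *)
Lemma orlicz_fin x : (0 <= x)%R -> Psi x%:E \is a fin_num.
Proof.
move=> x0; rewrite ge0_fin_numE; last by apply: (orlicz_ge0 oPsi); rewrite lee_fin.
have [->|xn] := eqVneq x 0%R; first by rewrite (orlicz0 oPsi) ltry.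
have x2 : (0 <= 2 * x)%R by rewrite mulr_ge0.
have n2 : (2 * x != 0)%R by rewrite mulf_neq0.
have h2 : (0 < (2^-1 : R) < 1)%R by rewrite invr_gt0 ltr0n invf_lt1// ltr1n.
have := orlicz_strictly_convex oPsi x2 (lexx 0%R) n2 h2.
rewrite mulr0 addr0 mulrA mulVf// mul1r => h; apply: (lt_le_trans h); exact: leey.
Qed.

Lemma orlicz1_gt0 : 0 < Psi 1%:E.
Proof.
have h2 : (0 < (2^-1 : R) < 1)%R by rewrite invr_gt0 ltr0n invf_lt1// ltr1n.
have := orlicz_strictly_convex oPsi (ler01) (lexx 0%R) (oner_neq0 R) h2.
rewrite mulr0 addr0 mulr1 (orlicz0 oPsi) mule0 adde0 => h.
have h0 : 0 <= Psi (2^-1)%:E by apply: (orlicz_ge0 oPsi); rewrite lee_fin invr_ge0.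
have := le_lt_trans h0 h; rewrite pmule_rgt0// lte_fin invr_gt0//.
Qed.

Lemma orlicz_unbounded (Y : R) : exists2 x, (1 <= x)%R & forall y, (x <= y)%R -> Y%:E < Psi y%:E.
Proof.
have p1 := orlicz1_gt0; have f1 := orlicz_fin ler01.
pose p := fine (Psi 1%:E); have pE : Psi 1%:E = p%:E by rewrite fineK.
have p0 : (0 < p)%R by rewrite -lte_fin -pE.
exists (Num.max 1 ((`|Y| + 1) / p))%R; first by rewrite le_max lexx.
move=> y; rewrite ge_max => /andP[y1 yY].
have y0 : (0 < y)%R by exact: lt_le_trans y1.
have ht : (0 <= y^-1 <= 1)%R by rewrite invr_ge0 ltW//= invf_le1.
have := orlicz_contract ht (ltW y0); rewrite mulVf ?gt_eqF// pE.
rewrite -(fineK (orlicz_fin (ltW y0))) -EFinM lee_fin lte_fin => h.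
have h1 : (y * p <= fine (Psi y%:E))%R by rewrite -ler_pdivlMl.
apply: lt_le_trans h1; rewrite ler_pdivrMr// in yY; apply: lt_le_trans yY.
by have := ler_norm Y; lra.
Qed.

(** A dyadic search in place of an inverse of [Psi]: starting from [x0], where [Psi x0 <= 1], it
    keeps the last value before a doubling first makes [Psi] exceed [h^-1]. The factor 2 is absorbed
    by the constant [e] of [near_set_small]. *)
Lemma orlicz_doubling h : (0 < h < 1)%R ->
  exists2 x, (0 < x)%R & Psi x%:E <= h^-1%:E /\ h^-1%:E <= Psi (2 * x)%R%:E.
Proof.
move=> /andP[h0 h1]; have f1 := orlicz_fin ler01.
pose p := fine (Psi 1%:E); have pE : Psi 1%:E = p%:E by rewrite fineK.
have p0 : (0 < p)%R by rewrite -lte_fin -pE; exact: orlicz1_gt0.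
pose x0 : R := (p + 1)^-1%R.
have x00 : (0 < x0)%R by rewrite invr_gt0 addr_gt0.
have hi : (1 <= h^-1)%R by rewrite invf_ge1// ltW.
have P0 : Psi x0%:E <= h^-1%:E.
  have hx : (0 <= x0 <= 1)%R by rewrite ltW//= invf_le1 ?lerDr ?ltW// addr_gt0.
  have := orlicz_contract hx ler01; rewrite mulr1 => h2; apply: (le_trans h2).
  rewrite pE -EFinM lee_fin; apply: le_trans hi.
  by rewrite /x0 mulrC ler_pdivrMr ?mul1r ?lerDl// addr_gt0.
have ex : exists k : nat, ~~ (Psi (2 ^+ k * x0)%R%:E <= h^-1%:E).
  have [Y Y1 hY] := orlicz_unbounded h^-1.
  exists (Num.truncn (Y / x0)).+1; rewrite -ltNge; apply: hY.
  rewrite -ler_pdivrMr//; apply: ltW; apply: (lt_le_trans (truncnS_gt _)).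
  by rewrite -natrX ler_nat ltnW// ltn_expl.
case: (ex_minnP ex) => -[|k]; first by rewrite expr0 mul1r P0.
move=> nP hk; exists (2 ^+ k * x0)%R; first by rewrite mulr_gt0// exprn_gt0.
split; last by rewrite mulrA -exprS ltW// ltNge.
by apply: contraT => /hk; rewrite ltnn.
Qed.

(** Each use of Delta^2 squares the bound and multiplies the argument by [A] only: a constant factor
    in the argument of [Psi] is traded for an arbitrarily high power. *)
Lemma Delta2_iter (A X : R) : (1 < A)%R -> (0 <= X)%R ->
  (forall x, (X <= x)%R -> Psi x%:E ^+ 2 <= Psi (A * x)%R%:E) ->
  forall j x y, (X <= x)%R -> (0 <= y)%R -> y%:E <= Psi x%:E ->
    (y ^+ (2 ^ j))%R%:E <= Psi (A ^+ j * x)%R%:E.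
Proof.
move=> A1 X0 hA; elim=> [|j IH] x y Xx y0 yx; first by rewrite expn0 expr1 expr0 mul1r.
have Aj : (1 <= A ^+ j)%R by rewrite exprn_ege1// ltW.
have x0 : (0 <= x)%R by exact: le_trans Xx.
have XA : (X <= A ^+ j * x)%R by apply: (le_trans Xx); rewrite ler_peMl.
rewrite exprS -mulrA; apply: le_trans (hA _ XA).
have h := IH x y Xx y0 yx.
rewrite expnS mulnC exprM expr2 EFinM expe2.
by apply: lee_pmul => //; rewrite lee_fin exprn_ge0.
Qed.

End OrliczFunction.

(** * Peak functions *)

Section TestFunctions.
Context {R : realType}.
Local Notation C := (cplx R).
Local Notation mu := (@lebesgue_measure R).
Implicit Types (z w v l xi : C) (x h : R).

(* Modulus comparable to x within distance h of xi, at most x everywhere. *)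
Definition peak xi x h (z : C) : C :=
  rc x * (rc h * (rc (1 + h) - conjc xi * z)^-1) ^+ 2.

Lemma peak_den xi h z : 0 < h -> modulus xi = 1 -> modulus z <= 1 ->
  h <= modulus (rc (1 + h) - conjc xi * z).
Proof.
move=> h0 hxi hz; have := mod_sub_ge (rc (1 + h)) (conjc xi * z).
by rewrite modM modJ hxi mul1r mod_rc ger0_norm; lra.
Qed.

Lemma peak_hol xi x h z : 0 < h -> modulus xi = 1 -> modulus z <= 1 -> hol (peak xi x h) z.
Proof.
move=> h0 hxi hz; apply: holM; first exact: hol_cst.
apply: holX; apply: holM; first exact: hol_cst.
apply: holV; first by rewrite -mod_gt0; exact: lt_le_trans (peak_den h0 hxi hz).
by apply: holB; [exact: hol_cst|apply: holM; [exact: hol_cst|exact: hol_id]].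
Qed.

Lemma mod_peak xi x h z : 0 <= x -> 0 <= h ->
  modulus (peak xi x h z) = x * (h / modulus (rc (1 + h) - conjc xi * z)) ^+ 2.
Proof. by move=> x0 h0; rewrite modM modX modM modV !mod_rc !ger0_norm. Qed.

Lemma mod_peak_le xi x h z : 0 <= x -> 0 < h -> modulus xi = 1 -> modulus z <= 1 ->
  modulus (peak xi x h z) <= x.
Proof.
move=> x0 h0 hxi hz; rewrite mod_peak ?(ltW h0)// -[leRHS]mulr1; apply: ler_wpM2l => //.
have d := peak_den h0 hxi hz.
rewrite expr_le1// ?ler_pdivrMr ?mul1r//; first exact: lt_le_trans d.
by rewrite divr_ge0 ?ltW// (lt_le_trans h0).
Qed.

(** The denominator is [h - conj xi (l - xi)], of modulus at most [3 h]; the quotient is squared,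
    whence 9. *)
Lemma mod_peak_ge xi x h l : 0 <= x -> 0 < h -> modulus xi = 1 -> modulus l <= 1 ->
  modulus (l - xi) <= 2 * h -> x / 9 <= modulus (peak xi x h l).
Proof.
move=> x0 h0 hxi hl lx; rewrite mod_peak ?(ltW h0)//; apply: ler_wpM2l => //.
have d := peak_den h0 hxi hl; set D := modulus _ in d *.
have D0 : 0 < D by exact: lt_le_trans d.
have D3 : D <= 3 * h.
  have -> : D = modulus (rc h - conjc xi * (l - xi)).
    congr modulus; rewrite rcD rc1 mulrBr [conjc xi * xi]mulrC mulJ hxi expr1n rc1; ring.
  apply: (le_trans (modB _ _)); rewrite modM modJ hxi mul1r mod_rc (ger0_norm (ltW h0)); lra.
have h3 : 3^-1 <= h / D by rewrite ler_pdivlMr// mulrC ler_pdivrMr//; lra.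
have -> : 9^-1 = 3^-1 ^+ 2 :> R by rewrite exprVn -natrX.
by apply: lerXn2r; rewrite ?nnegrE ?divr_ge0 ?invr_ge0// ltW.
Qed.

(** The reason for the square in [peak]: divided by [x h], its modulus on the circle lies below the
    Poisson kernel of the point [xi / (1 + h)], whose mean is 1. *)
Lemma peak_poisson xi h z : 0 < h < 1 -> modulus xi = 1 -> modulus z = 1 ->
  (h / modulus (rc (1 + h) - conjc xi * z)) ^+ 2 * h^-1 <=
  poisson (rc (1 + h)^-1 * xi * conjc z).
Proof.
move=> /andP[h0 h1] hxi hz; have k0 : 0 < 1 + h by lra.
have ki : 0 <= (1 + h)^-1 by rewrite invr_ge0 ltW.
rewrite /poisson !modM mod_rc modJ hxi hz !mulr1 (ger0_norm ki).
have E : modulus (1 - rc (1 + h)^-1 * xi * conjc z) = modulus (rc (1 + h) - conjc xi * z) / (1 + h).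
  rewrite -modJ conjD conjN (conj_rc 1) !conjM conjK conj_rc rc1.
  have -> : rc (1 + h) - conjc xi * z = rc (1 + h) * (1 - rc (1 + h)^-1 * conjc xi * z).
    by rewrite mulrBr mulr1 -!mulrA !mulrA -rcM divff ?gt_eqF// rc1 mul1r.
  by rewrite modM mod_rc gtr0_norm// [RHS]mulrAC divff ?mul1r// gt_eqF.
have d0 : 0 < modulus (rc (1 + h) - conjc xi * z).
  by apply: lt_le_trans (peak_den h0 hxi _) => //; rewrite hz.
rewrite E; move: (modulus _) d0 => D D0.
have -> : (h / D) ^+ 2 * h^-1 = h / D ^+ 2 by field; rewrite !gt_eqF.
have -> : (1 - (1 + h)^-1 ^+ 2) / (D / (1 + h)) ^+ 2 = (h * (2 + h)) / D ^+ 2.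
  by field; rewrite !gt_eqF.
apply: ler_wpM2r; first by rewrite invr_ge0 exprn_ge0// ltW.
nra.
Qed.

End TestFunctions.

Section PeakInHardyOrlicz.
Context {R : realType} (Psi : \bar R -> \bar R).
Hypothesis oPsi : orlicz_function Psi.
Local Notation C := (cplx R).
Local Notation mu := (@lebesgue_measure R).
Implicit Types (z w v l xi : C) (x h : R).

Lemma bv_peak xi x h t : 0 < h -> modulus xi = 1 ->
  boundary_value (peak xi x h) (cis t) = peak xi x h (cis t).
Proof.
move=> h0 hxi; apply/bv_rlim/radial_limit_closed/hol_ccont/peak_hol => //.
by rewrite mod_cis.
Qed.

Lemma measurable_on_angles (F : R -> R) : cts_on 0 (0 + 2 * pi) F -> measurable_fun angles F.
Proof.
move=> cF; apply: measurable_funS (cts_measurable cF) => //; exact: angles_closed.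
Qed.

(** With [q <= 1] the squared quotient in [peak], convexity gives [Psi (q x) <= q Psi x <= q / h],
    and [peak_poisson] puts this below a Poisson kernel. *)
Lemma peak_modular xi x h : 0 < h < 1 -> 0 <= x -> modulus xi = 1 ->
  (Psi x%:E <= h^-1%:E)%E -> (orlicz_modular Psi (boundary_value (peak xi x h)) 1 <= 1)%E.
Proof.
move=> hh x0 hxi hP; have /andP[h0 h1] := hh.
have k0 : 0 < 1 + h by lra.
pose v : C := rc (1 + h)^-1 * xi.
have v1 : modulus v < 1.
  by rewrite modM mod_rc hxi mulr1 ger0_norm ?invr_ge0 ?ltW// invf_lt1// ltrDl.
apply: (@le_trans _ _ (circle_integral (fun z => (poisson (v * conjc z))%:E))); last first.
  rewrite circle_integral_rmean; last exact: circ_cont_poisson.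
  rewrite lee_fin; have := @poisson_formula _ 0 (fun=> 1) 2 v _ _ v1.
  rewrite (@eq_cmean _ _ _ (fun z => rc (poisson (v * conjc z)))) => [|z _]; last by rewrite mul1r.
  rewrite cmean_rc => h2; have [->//] : rc (rmean 0 (fun z => poisson (v * conjc z))) = rc 1.
  by apply: h2 => [|z _]; [rewrite ltr1n|exact: hol_cst].
rewrite /orlicz_modular /circle_integral; apply: lee_wpmul2l; first by rewrite lee_fin inv2pi_ge0.
apply: ge0_le_integral_nomeas => t _.
  by apply: (orlicz_ge0 oPsi); rewrite lee_fin divr1 mod_ge0.
rewrite divr1 bv_peak// mod_peak ?(ltW h0)// mulrC.
set q := _ ^+ 2; have q0 : 0 <= q by exact: sqr_ge0.
have q1 : q <= 1.
  have d := @peak_den _ xi h (cis t) h0 hxi _; rewrite mod_cis in d; have {}d := d (lexx _).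
  rewrite /q expr_le1// ?ler_pdivrMr ?mul1r//; first exact: lt_le_trans d.
  by rewrite divr_ge0 ?ltW// (lt_le_trans h0).
have hq : 0 <= q <= 1 by rewrite q0.
apply: (le_trans (orlicz_contract oPsi hq x0)).
apply: (@le_trans _ _ (q%:E * h^-1%:E)%E); first by apply: lee_wpmul2l.
by rewrite -EFinM lee_fin; apply: peak_poisson => //; exact: mod_cis.
Qed.

Lemma peak_hardy_orlicz xi x h : 0 < h < 1 -> 0 <= x -> modulus xi = 1 ->
  (Psi x%:E <= h^-1%:E)%E ->
  hardy_orlicz_space Psi (peak xi x h) /\ (hardy_orlicz_norm Psi (peak xi x h) <= 1)%E.
Proof.
move=> hh x0 hxi hP; have /andP[h0 h1] := hh.
have m1 := peak_modular hh x0 hxi hP.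
split; last by apply: ereal_inf_lbound; exists 1.
split.
  apply: (@bounded_hardy1 _ _ x) => [z z1|z z1]; first by apply: peak_hol => //; exact: ltW.
  by apply: mod_peak_le => //; exact: ltW.
split; last by exists 1; split => //; exact: le_lt_trans m1 (ltry _).
have cP : rcont_on 0 (0 + 2 * pi) (fun t => peak xi x h (cis t)).
  apply: circ_rcont => z hz; apply/hol_ccont/peak_hol => //; by rewrite hz.
rewrite /circle_measurable.
have -> : (fun t => complex.Re (boundary_value (peak xi x h) (cis t))) = (fun t => complex.Re (peak xi x h (cis t))).
  by apply/funext => t; rewrite bv_peak.
have -> : (fun t => complex.Im (boundary_value (peak xi x h) (cis t))) = (fun t => complex.Im (peak xi x h (cis t))).
  by apply/funext => t; rewrite bv_peak.
by split; apply: measurable_on_angles; [exact: rcont_on_Re|exact: rcont_on_Im].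
Qed.

(** A norm below [e] provides an admissible constant [K < e], and on [B] the integrand of the
    modular is then at least [Psi (c / e)]. *)
Lemma luxemburg_markov (D : C -> C) (B : set R) (c e : R) : 0 < e -> 0 <= c ->
  measurable B -> B `<=` angles ->
  (forall t, B t -> c <= modulus (D (cis t))) -> (luxemburg_norm Psi D < e%:E)%E ->
  (Psi (c / e)%:E * mu B <= (2 * pi)%:E)%E.
Proof.
move=> e0 c0 mB Ba hB /ereal_inf_lt[_ [K [K0 mK] <-]]; rewrite lte_fin => Ke.
have P0 : (0 <= Psi (c / e)%:E)%E by apply: (orlicz_ge0 oPsi); rewrite lee_fin divr_ge0// ltW.
have h1 : (Psi (c / e)%:E * mu B <= \int[mu]_(t in angles) Psi (modulus (D (cis t)) / K)%:E)%E.
  apply: (@le_trans _ _ (\int[mu]_(t in angles) ((cst (Psi (c / e)%:E)) \_ B) t)%E).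
    rewrite -integral_mkcondr setIidr// integral_cst//.
  apply: ge0_le_integral_nomeas => t _; first by rewrite patchE; case: ifP.
  rewrite patchE; case: ifPn => [|_]; last by apply: (orlicz_ge0 oPsi); rewrite lee_fin divr_ge0 ?mod_ge0// ltW.
  rewrite inE => /hB h; apply: (orlicz_nondecreasing oPsi).
    by rewrite lee_fin divr_ge0// ltW.
  rewrite lee_fin; apply: ler_pM => //; first by rewrite invr_ge0 ltW.
  by rewrite lef_pV2 ?posrE// ltW.
apply: (le_trans h1); move: mK; rewrite /orlicz_modular /circle_integral => mK.
have p2 : (0 <= (2 * pi)%:E :> \bar R)%E by rewrite lee_fin ltW// twopi_gt0.
have := lee_wpmul2l p2 mK; rewrite mule1 muleA -EFinM divff ?mul1e//.
by rewrite gt_eqF// twopi_gt0.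
Qed.

End PeakInHardyOrlicz.

(** * Compactness on H^Psi and the angles where phi is near a point *)

Section NearSets.
Context {R : realType} (Psi : \bar R -> \bar R) (phi : cplx R -> cplx R).
Hypothesis oPsi : orlicz_function Psi.
Hypothesis sphi : analytic_self_map phi.
Local Notation C := (cplx R).
Local Notation mu := (@lebesgue_measure R).
Implicit Types (z w v l xi : C) (x h e d : R).

(* lebesgue_measure is an outer measure on arbitrary sets; near_set is not known
   to be measurable. *)
Lemma mu_le (A B : set R) : A `<=` B -> (mu A <= mu B)%E.
Proof. by move=> AB; apply: le_outer_measure. Qed.

Lemma mu_U (A B : set R) : (mu (A `|` B) <= mu A + mu B)%E.
Proof. exact: outer_measureU2. Qed.

(** Expressed with an actual radial limit, so that the default value of [boundary_value] is never
    counted. *)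
Definition near_set xi d : set R :=
  angles `&` [set t | exists2 l, radial_limit phi t l & modulus (l - xi) <= d].

Lemma self_map_hol : hol_disk phi.
Proof. by have [/analytic_hol] := sphi. Qed.

Lemma self_map_lt z : modulus z < 1 -> modulus (phi z) < 1.
Proof. by have [_] := sphi; apply. Qed.

Lemma self_map_limit_le t l : radial_limit phi t l -> modulus l <= 1.
Proof. by move=> /radial_limit_mod_le; apply=> z /self_map_lt /ltW. Qed.

Lemma self_map_no_rlim : mu.-negligible (angles `&` [set t | ~ has_rlim phi t]).
Proof.
by apply: (@fatou_bounded _ _ 1 self_map_hol) => z /self_map_lt /ltW.
Qed.

Lemma orlicz_no_rlim g : hardy_orlicz_space Psi g ->
  mu.-negligible (angles `&` [set t | ~ has_rlim g t]).
Proof.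
move=> [[/analytic_hol hg ng] _]; have [M hM] := hardy1_bounded hg ng.
exact: fatou_hardy1 hM.
Qed.

Lemma measurable_far (u w : C -> C) (c : R) : 0 <= c -> circle_measurable u -> circle_measurable w ->
  measurable (angles `&` [set t | c <= modulus (u (cis t) - w (cis t))]).
Proof.
move=> c0 [u1 u2] [w1 w2].
pose q t := (complex.Re (u (cis t)) - complex.Re (w (cis t))) ^+ 2 +
            (complex.Im (u (cis t)) - complex.Im (w (cis t))) ^+ 2.
have mq : measurable_fun angles q.
  by apply: measurable_funD; apply: measurable_funX; apply: measurable_funB.
have -> : angles `&` [set t | c <= modulus (u (cis t) - w (cis t))] =
          angles `&` q @^-1` `[c ^+ 2, +oo[%classic.
  congr (_ `&` _); apply/seteqP; split=> t /=; rewrite in_itv /= andbT /q -cReB -cImB -mod_sqr.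
    by move=> h; apply: lerXn2r => //; rewrite nnegrE ?mod_ge0.
  by rewrite ler_pXn2r// nnegrE ?mod_ge0.
by apply: mq => //; exact: angles_measurable.
Qed.

(* At an angle of near_set the first peak is at least twice the second, so one
   of the two is far from g; Markov's inequality bounds both events. *)
Lemma near_set_measure g xi1 xi2 x1 x2 h1 h2 e :
  hardy_orlicz_space Psi g -> 0 < e -> 0 < h1 -> 0 < h2 -> modulus xi1 = 1 -> modulus xi2 = 1 ->
  0 <= x1 -> 0 <= x2 -> 18 * x2 <= x1 ->
  circle_measurable (boundary_value (fun z => peak xi1 x1 h1 (phi z))) ->
  circle_measurable (boundary_value (fun z => peak xi2 x2 h2 (phi z))) ->
  (hardy_orlicz_norm Psi (fun z => peak xi1 x1 h1 (phi z) - g z)%R < e%:E)%E ->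
  (hardy_orlicz_norm Psi (fun z => peak xi2 x2 h2 (phi z) - g z)%R < e%:E)%E ->
  (Psi (x1 / 36 / e)%:E * mu (near_set xi1 (2 * h1)) <= (4 * pi)%:E)%E.
Proof.
move=> Xg e0 h10 h20 m1 m2 x10 x20 x21 c1 c2 n1 n2.
(* The boundary value of a difference is the difference of the boundary values where both radial
   limits exist; [N] covers the other angles. For [g] this uses Fatou's theorem in H^1. *)
have [N [mN N0 sN]] := negligibleU self_map_no_rlim (orlicz_no_rlim Xg).
have [[hg _] [cg _]] := Xg.
have c0 : 0 <= x1 / 36 by rewrite divr_ge0.
(* On [near_set] the first peak is at least [x1 / 9] and the second at most [x2 <= x1 / 18]. They
   differ by at least [x1 / 18], so one of them is at distance at least [x1 / 36] from [g]. *)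
pose S xi x h := (angles `&` [set t | x1 / 36 <= modulus
  (boundary_value (fun z => peak xi x h (phi z)) (cis t) - boundary_value g (cis t))]) `\` N.
have lims t : angles t -> ~ N t -> exists2 l, radial_limit phi t l & has_rlim g t.
  move=> ta nN; have hp : has_rlim phi t.
    by apply: contrapT => h; apply: nN; apply: sN; left.
  by case: hp => l hl; exists l => //; apply: contrapT => h; apply: nN; apply: sN; right.
have plim xi x h t l : 0 < h -> modulus xi = 1 -> radial_limit phi t l ->
    radial_limit (fun z => peak xi x h (phi z)) t (peak xi x h l).
  move=> h0 hxi hl; apply: (radial_limit_ccont hl); apply/hol_ccont/peak_hol => //.
  exact: self_map_limit_le hl.
have markov xi x h : 0 < h -> modulus xi = 1 ->
    circle_measurable (boundary_value (fun z => peak xi x h (phi z))) ->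
    (hardy_orlicz_norm Psi (fun z => peak xi x h (phi z) - g z)%R < e%:E)%E ->
    measurable (S xi x h) /\ (Psi (x1 / 36 / e)%:E * mu (S xi x h) <= (2 * pi)%:E)%E.
  move=> h0 hxi mF nF; have mS : measurable (S xi x h).
    by apply: measurableD => //; exact: measurable_far.
  split=> //; apply: (luxemburg_markov oPsi (D := boundary_value (fun z => peak xi x h (phi z) - g z))) => //.
    by move=> t [[]].
  move=> t [[ta /= ht] nN]; have [l hl [lg hlg]] := lims t ta nN.
  have hF := plim xi x h t l h0 hxi hl.
  have hD : radial_limit (fun z => peak xi x h (phi z) - g z) t (peak xi x h l - lg).
    apply: radial_limitD => //; exact: (radial_limit_ccont hlg (H := fun w => - w) (ccontN (@ccont_id _ _))).
  by rewrite (bv_rlim hD); move: ht; rewrite (bv_rlim hF) (bv_rlim hlg).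
have [mS1 p1] := markov xi1 x1 h1 h10 m1 c1 n1.
have [mS2 p2] := markov xi2 x2 h2 h20 m2 c2 n2.
have P0 : (0 <= Psi (x1 / 36 / e)%:E)%E.
  by apply: (orlicz_ge0 oPsi); rewrite lee_fin divr_ge0// ltW.
have sub : near_set xi1 (2 * h1) `<=` (S xi1 x1 h1 `|` S xi2 x2 h2) `|` N.
  move=> t [ta [l hl lx]]; case: (pselect (N t)) => [|nN]; [by right|left].
  have [l' hl' [lg hlg]] := lims t ta nN.
  have l1 := self_map_limit_le hl.
  have b1 := bv_rlim (plim xi1 x1 h1 t l h10 m1 hl).
  have b2 := bv_rlim (plim xi2 x2 h2 t l h20 m2 hl).
  have big := mod_peak_ge x10 h10 m1 l1 lx.
  have small := mod_peak_le x20 h20 m2 l1.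
  have tri := mod_sub_ge (peak xi1 x1 h1 l) (peak xi2 x2 h2 l).
  have tri2 : modulus (peak xi1 x1 h1 l - peak xi2 x2 h2 l) <=
      modulus (peak xi1 x1 h1 l - lg) + modulus (peak xi2 x2 h2 l - lg).
    have -> : peak xi1 x1 h1 l - peak xi2 x2 h2 l = (peak xi1 x1 h1 l - lg) - (peak xi2 x2 h2 l - lg) by ring.
    exact: modB.
  rewrite /S; case: (leP (x1 / 36) (modulus (peak xi1 x1 h1 l - lg))) => h; [left|right].
    by split=> //; split=> //=; rewrite b1 (bv_rlim hlg).
  split=> //; split=> //=; rewrite b2 (bv_rlim hlg).
  move: h big small tri tri2 x21 x10; clear; lra.
apply: (@le_trans _ _ (Psi (x1 / 36 / e)%:E * (mu (S xi1 x1 h1) + mu (S xi2 x2 h2)))%E).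
  apply: lee_wpmul2l => //; apply: (le_trans (mu_le sub)).
  apply: (le_trans (mu_U _ _)); rewrite N0 adde0; exact: mu_U.
rewrite ge0_muleDr//; apply: (le_trans (leeD p1 p2)).
by rewrite -EFinD lee_fin; lra.
Qed.

Hypothesis D2 : Delta2_up Psi.
Hypothesis Kphi : compact_operator (hardy_orlicz_space Psi) (hardy_orlicz_norm Psi)
  (composition_operator phi).

Lemma mu_near_set xi d : (mu (near_set xi d) <= (2 * pi)%:E)%E.
Proof. by rewrite -mu_angles; apply: mu_le => t []. Qed.

Lemma Delta2_threshold : exists A X : R, [/\ 1 < A, 0 <= X &
  forall x, X <= x -> (Psi x%:E ^+ 2 <= Psi (A * x)%R%:E)%E].
Proof.
have [A [A1 [M [Mr hM]]]] := D2; exists A, (Num.max 0 (M + 1)); split => //.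
  by rewrite le_max lexx.
by move=> x; rewrite ge_max => /andP[_ Mx]; apply: hM; lra.
Qed.

(** If every constant [n + 1] fails, at [h n] and [xi n] say, then [h n] tends to 0 because
    [near_set] has measure at most [2 pi]; since [Psi (2 * x n) >= 1 / h n], the heights [x n] tend
    to infinity. Peaks of very different heights are thus available along the convergent
    subsequence. *)
Lemma near_set_small (alpha : R) : 0 < alpha -> exists2 K : R, 0 <= K &
  forall h xi, 0 < h < 1 -> modulus xi = 1 ->
    (mu (near_set xi (2 * h)) <= (K * h `^ alpha)%:E)%E.
Proof.
move=> al0; apply: contrapT => nK.
have ex (n : nat) : exists hx : R * C, [/\ 0 < hx.1 < 1, modulus hx.2 = 1 &
    ((n.+1%:R * hx.1 `^ alpha)%:E < mu (near_set hx.2 (2 * hx.1)))%E].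
  apply: contrapT => nn; apply: nK; exists n.+1%:R => // h xi hh hxi.
  by rewrite leNgt; apply/negP => lt; apply: nn; exists (h, xi).
have [hx hhx] := choice ex.
pose h n := (hx n).1; pose xi n := (hx n).2.
have h01 n : 0 < h n < 1 by have [] := hhx n.
have h0 n : 0 < h n by case/andP: (h01 n).
have xi1 n : modulus (xi n) = 1 by have [] := hhx n.
have big n : ((n.+1%:R * h n `^ alpha)%:E < mu (near_set (xi n) (2 * h n)))%E by have [] := hhx n.
have exx n : exists x, 0 < x /\ ((Psi x%:E <= (h n)^-1%:E)%E /\ ((h n)^-1%:E <= Psi (2 * x)%R%:E)%E).
  by have [x x0 hx'] := orlicz_doubling oPsi (h01 n); exists x.
have [x hxx] := choice exx.
have x0 n : 0 < x n by have [] := hxx n.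
have x1 n : (Psi (x n)%:E <= (h n)^-1%:E)%E by have [_ []] := hxx n.
have x2 n : ((h n)^-1%:E <= Psi (2 * x n)%R%:E)%E by have [_ []] := hxx n.
pose F n := peak (xi n) (x n) (h n).
have XF n : hardy_orlicz_space Psi (F n) /\ (hardy_orlicz_norm Psi (F n) <= 1)%E.
  by apply: peak_hardy_orlicz => //; exact: ltW.
have [XT _ cT] := Kphi; have [k kinc [g Xg cg]] := cT F XF.
have kge n : (n <= k n)%N by elim: n => // n IH; exact: leq_ltn_trans (kinc n n.+1 (ltnSn n)).
have mF n : circle_measurable (boundary_value (fun z => F n (phi z))).
  by have [_ []] := XT _ (proj1 (XF n)).
have hsmall (c : R) : 0 < c -> exists N, forall n, (N <= n)%N -> h n `^ alpha <= c.
  move=> c0; have [N hN] : exists N : nat, 2 * pi / c <= N.+1%:R.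
    exists (Num.truncn (2 * pi / c)); apply: ltW; apply: Num.Theory.truncnS_gt.
  exists N => n Nn; have := lt_le_trans (big n) (mu_near_set _ _).
  rewrite lte_fin => lt; have n0 : (0 : R) < n.+1%:R by [].
  have : 2 * pi / c <= n.+1%:R by apply: (le_trans hN); rewrite ler_nat.
  rewrite ler_pdivrMr// => h2; have := lt_le_trans lt h2.
  by rewrite ltr_pM2l// => /ltW.
have xbig (Y : R) : exists N, forall n, (N <= n)%N -> Y <= x n.
  pose Z := Num.max 1 Y; pose p := fine (Psi (2 * Z)%:E).
  have Z1 : 1 <= Z by rewrite le_max lexx.
  have pE : Psi (2 * Z)%:E = p%:E by rewrite fineK// (orlicz_fin oPsi)//; lra.
  have q0 : 0 < `|p| + 1 by rewrite ltr_wpDl.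
  have c0 : 0 < ((`|p| + 1)^-1) `^ alpha by rewrite powR_gt0// invr_gt0.
  have [N hN] := hsmall _ c0; exists N => n /hN; apply: contraTT; rewrite -!ltNge => xY.
  have : (Psi (2 * x n)%R%:E <= Psi (2 * Z)%:E)%E.
    apply: (orlicz_nondecreasing oPsi); rewrite lee_fin; first by rewrite mulr_ge0// ltW.
    by apply: ler_wpM2l => //; rewrite le_max (ltW xY) orbT.
  rewrite pE => /(le_trans (x2 n)); rewrite lee_fin => hp.
  apply: gt0_ltr_powR => //; rewrite ?nnegrE ?invr_ge0 ?ltW//.
  rewrite -[ltRHS]invrK ltf_pV2 ?posrE ?invr_gt0//.
  by apply: (le_lt_trans hp); rewrite (le_lt_trans (ler_norm p))// ltrDl.
have [A [X [A1 X0 hA]]] := Delta2_threshold.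
(* Then [2 ^ j > j > alpha], so that [h ^ (2 ^ j) <= h ^ alpha] for [h < 1]. *)
pose j := (Num.truncn alpha).+1.
have Aj : 0 < A ^+ j by rewrite exprn_gt0// (lt_trans ltr01).
(* As [72 = 36 * 2], the argument [x n / 36 / e] of [near_set_measure] becomes [A ^ j * (2 * x n)],
   the one that [Delta2_iter] controls. *)
pose e := (72 * A ^+ j)^-1; have e0 : 0 < e by rewrite invr_gt0 mulr_gt0.
have [N0 hN0] : exists N0, forall n, (N0 <= n)%N ->
    (hardy_orlicz_norm Psi (fun z => (F (k n) (phi z) - g z)%R) < e%:E)%E.
  have [|N0 _ hN0] := cg [set y | (y < e%:E)%E]; last by exists N0 => n /hN0.
  exact: (@nbhs_open_ereal_lt _ 0 (fun=> e)).
(* The peak of index [k N0] stays fixed as the lower one; the other is taken at least 18 times as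
   high. *)
have [N1 hN1] := xbig (18 * x (k N0)); have [N2 hN2] := xbig X.
(* Makes the factor [n + 1] of [big] at least the [4 pi] of [near_set_measure], which is the final
   contradiction. *)
have [N3 hN3] : exists N : nat, 4 * pi <= N.+1%:R :> R.
  by exists (Num.truncn (4 * pi : R)); apply: ltW; apply: Num.Theory.truncnS_gt.
pose n := k (maxn N0 (maxn N1 (maxn N2 N3))).
have [n0 n1 n2 n3] : [/\ (N0 <= maxn N0 (maxn N1 (maxn N2 N3)))%N, (N1 <= n)%N, (N2 <= n)%N & (N3 <= n)%N].
  have := kge (maxn N0 (maxn N1 (maxn N2 N3))); rewrite -/n => {}kge; split; lia.
have m0 m : 0 <= x m by exact: ltW.
have := near_set_measure Xg e0 (h0 n) (h0 (k N0)) (xi1 n) (xi1 _) (m0 n) (m0 _)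
  (hN1 _ n1) (mF n) (mF _) (hN0 _ n0) (hN0 _ (leqnn _)).
have -> : x n / 36 / e = A ^+ j * (2 * x n).
  by rewrite /e invrK; field.
have X2 : X <= 2 * x n by have := hN2 _ n2; have := x0 n; lra.
have hi0 : 0 <= (h n)^-1 by rewrite invr_ge0 ltW.
have := Delta2_iter A1 X0 hA j X2 hi0 (x2 n).
set P := Psi _; set E := near_set _ _ => hP hE.
have hp : h n ^+ (2 ^ j) <= h n `^ alpha.
  rewrite -powR_mulrn ?(ltW (h0 n))//; apply: ger_powR; first by rewrite h0 ltW//; case/andP: (h01 n).
  apply: ltW; apply: lt_le_trans (Num.Theory.truncnS_gt _) _.
  by rewrite ler_nat ltnW// ltn_expl.
have : (((h n)^-1 ^+ (2 ^ j))%:E * mu E <= (4 * pi)%:E)%E.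
  apply: le_trans hE; apply: lee_wpmul2r => //; exact: measure_ge0.
rewrite exprVn lee_pdivrMl ?exprn_gt0// => mE.
have := lt_le_trans (big n) mE; rewrite -EFinM lte_fin; apply/negP; rewrite -leNgt.
rewrite mulrC; apply: ler_pM => //.
- by have := pi_gt0 R; lra.
- by rewrite exprn_ge0// ltW.
- by apply: (le_trans hN3); rewrite ler_nat.
Qed.

End NearSets.

(** * Carleson windows *)

Section CarlesonWindow.
Context {R : realType}.
Local Notation C := (cplx R).
Local Notation mu := (@lebesgue_measure R).
Implicit Types (z w l xi : C) (h a s t : R).

Lemma sin_le_norm a : 0 <= a -> `|sin a| <= a.
Proof.
rewrite le_eqVlt => /orP[/eqP <-|a0]; first by rewrite sin0 normr0.
have [c _] := MVT a0 (fun x _ => is_derive_sin x) (continuous_subspaceT (@continuous_sin R)).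
by rewrite sin0 !subr0 => ->; rewrite normrM (gtr0_norm a0) ler_piMl ?cos_max// ltW.
Qed.

Lemma cis_lipschitz1 t : modulus (cis t - 1) <= `|t|.
Proof.
have E : modulus (cis t - 1) ^+ 2 = (2 * sin (t / 2)) ^+ 2.
  have t2 : t = (t / 2) *+ 2 by rewrite -mulr_natr; field.
  rewrite mod_sqr cReB cImB /= subr0 {1 2}t2 cos_mulr2n sin_mulr2n.
  have := cos2Dsin2 (t / 2); move: (cos _) (sin _) => c s.
  move=> cs; have -> : c ^+ 2 *+ 2 - 1 - 1 = - (2 * s ^+ 2).
    by rewrite mulr2n; move: cs; clear; lra.
  have -> : (- (2 * s ^+ 2)) ^+ 2 + (c * s *+ 2) ^+ 2 = 4 * s ^+ 2 * (c ^+ 2 + s ^+ 2).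
    by rewrite [c * s *+ 2]mulr2n; ring.
  by rewrite cs; ring.
have -> : modulus (cis t - 1) = `|2 * sin (t / 2)|.
  by have := congr1 Num.sqrt E; rewrite !sqrtr_sqr ger0_norm ?mod_ge0.
have : `|sin (t / 2)| <= `|t / 2|.
  have [t0|t0] := leP 0 (t / 2); first by rewrite [leRHS]ger0_norm// sin_le_norm.
  by rewrite [leRHS]ltr0_norm// -[X in `|X|]opprK normrN -sinN sin_le_norm// oppr_ge0 ltW.
rewrite !normrM [`|2^-1|]gtr0_norm ?invr_gt0// [`|2|]gtr0_norm//; lra.
Qed.

Lemma carg_polar z : z != 0 -> z = rc (modulus z) * cis (carg z).
Proof.
rewrite -mod_gt0 => m0; set m := modulus z in m0 *.
have hx : -1 <= complex.Re z / m <= 1.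
  rewrite -ler_norml normrM normfV (gtr0_norm m0) ler_pdivrMr// mul1r; exact: Re_le_mod.
have sE : Num.sqrt (1 - (complex.Re z / m) ^+ 2) = `|complex.Im z / m|.
  rewrite -sqrtr_sqr; congr Num.sqrt; rewrite !exprMn; have := mod_sqr z; rewrite -/m => e.
  have -> : complex.Im z ^+ 2 = m ^+ 2 - complex.Re z ^+ 2 by rewrite e; ring.
  by field; rewrite gt_eqF.
rewrite normrM normfV (gtr0_norm m0) in sE.
have mK x : m * (x / m) = x by field; rewrite gt_eqF.
rewrite /carg -/m; case: leP => i0; apply: C_eq; rewrite ?cReM ?cImM /= mul0r ?subr0 ?addr0.
- by rewrite acosK// mK.
- by rewrite sin_acos// sE ger0_norm// mK.
- by rewrite cosN acosK// mK.
- by rewrite sinN sin_acos// sE ltr0_norm// mulNr opprK mK.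
Qed.

(** One [h] comes from the argument, as [cis] is 1-Lipschitz, and one from the modulus: hence the
    radius [2 * h] given to [near_set]. *)
Lemma window_near xi h z : 0 < h < 1 -> modulus xi = 1 -> carleson_window xi h z ->
  modulus (z - xi) <= 2 * h.
Proof.
move=> /andP[h0 h1] hxi [z1 zh za].
pose w := z * conjc xi.
have wm : modulus w = modulus z by rewrite modM modJ hxi mulr1.
have w0 : w != 0 by rewrite -mod_gt0 wm; lra.
have -> : z - xi = (w - 1) * xi.
  by rewrite mulrBl mul1r -mulrA [conjc xi * xi]mulrC mulJ hxi expr1n rc1 mulr1.
rewrite modM hxi mulr1.
have -> : w - 1 = (cis (carg w) - 1) - rc (1 - modulus z) * cis (carg w).
  by rewrite {1}(carg_polar w0) wm (rcB 1) rc1; ring.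
apply: (le_trans (modB _ _)); rewrite modM mod_rc mod_cis mulr1.
have lip := cis_lipschitz1 (carg w); rewrite /disk /= in z1; rewrite -/w in za.
rewrite ger0_norm; last by move: z1; clear; lra.
by move: lip za zh; clear; lra.
Qed.

End CarlesonWindow.

(** * The pullback measure and the region near the circle *)

Section PullbackCarleson.
Context {R : realType} (phi : cplx R -> cplx R).
Hypothesis sphi : analytic_self_map phi.
Local Notation C := (cplx R).
Local Notation mu := (@lebesgue_measure R).
Implicit Types (z w l xi : C) (h : R).

Hypothesis small : forall alpha : R, 0 < alpha -> exists2 K : R, 0 <= K &
  forall h xi, 0 < h < 1 -> modulus xi = 1 ->
    (mu (near_set phi xi (2 * h)) <= (K * h `^ alpha)%:E)%E.

Lemma pullback_alpha_carleson (alpha : R) : 0 < alpha -> alpha_carleson alpha (pullback_measure phi).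
Proof.
move=> /small[K K0 hK]; exists ((2 * pi)^-1 * K) => h hh.
apply: ge_ereal_sup => _ [xi hxi <-].
rewrite /pullback_measure /circle_measure -mulrA EFinM.
apply: lee_wpmul2l; first by rewrite lee_fin inv2pi_ge0.
apply: le_trans (hK h xi hh hxi); apply: mu_le => t [ta [_ /= W]]; split => //.
have [[l hl]|/bv_norlim b0] := pselect (has_rlim phi t).
  by exists l => //; apply: (window_near hh hxi); rewrite -(bv_rlim hl).
by move: W; rewrite b0 => -[_]; rewrite mod0; move: hh; clear; lra.
Qed.

Definition outer_set h : set R :=
  angles `&` [set t | exists2 l, radial_limit phi t l & 1 - h < modulus l].

Lemma mu_union_le (A : nat -> set R) (c : R) N : 0 <= c -> (forall j, (mu (A j) <= c%:E)%E) ->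
  (mu [set t | exists2 j, (j < N)%N & A j t] <= (N%:R * c)%:E)%E.
Proof.
move=> c0 hA; elim: N => [|N IH].
  rewrite mul0r [X in mu X](_ : _ = set0) ?measure0//.
  by apply/seteqP; split=> t // -[].
apply: (@le_trans _ _ (mu ([set t | exists2 j, (j < N)%N & A j t] `|` A N))).
  apply: mu_le => t [j]; rewrite ltnS leq_eqVlt => /orP[/eqP ->|jN] At; [by right|left].
  by exists j.
apply: (le_trans (mu_U _ _)); rewrite -natr1 mulrDl mul1r EFinD; exact: leeD.
Qed.

(** The circle is covered by [N] points at spacing [h]. Their number, of order [1 / h], costs one
    power of [h], so the hypothesis is used with [alpha + 1]; the constant comes from
    [N h <= 2 pi + h]. *)
Lemma outer_set_small (alpha : R) : 0 < alpha -> exists2 K : R, 0 <= K &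
  forall h, 0 < h < 1 -> (mu (outer_set h) <= (K * h `^ alpha)%:E)%E.
Proof.
move=> al0; have [|K K0 hK] := small (alpha := alpha + 1); first by rewrite addr_gt0.
exists ((2 * pi + 1) * K); first by rewrite mulr_ge0// addr_ge0// ltW// twopi_gt0.
move=> h hh; have /andP[h0 h1] := hh.
pose N := (Num.truncn (2 * pi / h)).+1.
have c0 : 0 <= K * h `^ (alpha + 1) by rewrite mulr_ge0// powR_ge0.
pose A (j : nat) := near_set phi (cis (- pi + j%:R * h)) (2 * h).
have hA j : (mu (A j) <= (K * h `^ (alpha + 1))%:E)%E by apply: hK => //; exact: mod_cis.
apply: (@le_trans _ _ (mu [set t | exists2 j, (j < N)%N & A j t])).
  apply: mu_le => t [ta [l hl lh]].
  have m0 : 0 < modulus l by lra.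
  have l1 := self_map_limit_le sphi hl.
  pose u := l * rc (modulus l)^-1.
  have u1 : modulus u = 1 by rewrite modM mod_rc gtr0_norm ?invr_gt0// divff// gt_eqF.
  have [s hs us] := circ_polar u1.
  have s0 : 0 <= (s + pi) / h by apply: divr_ge0; [case/andP: hs; lra|exact: ltW].
  exists (Num.truncn ((s + pi) / h)).
    rewrite ltnS; apply: le_truncn; apply: ler_wpM2r; first by rewrite invr_ge0 ltW.
    by lra.
  split => //; exists l => //; set j := Num.truncn _.
  have jle : j%:R * h <= s + pi by rewrite -ler_pdivlMr// truncn_le.
  have jgt : s + pi < j%:R * h + h.
    by have := truncnS_gt ((s + pi) / h); rewrite -/j ltr_pdivrMr// -natr1 mulrDl mul1r.
  set a := - pi + j%:R * h.
  (* The limit [l] is within [h] of its radial projection [u = cis s], and [u] is within [h] of the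
     grid point [cis a]. *)
  have -> : l - cis a = (cis (s - a) - 1) * cis a - rc (1 - modulus l) * u.
    have lu : l = rc (modulus l) * u.
      rewrite /u mulrCA -rcM divff ?gt_eqF// rc1 mulr1//.
    rewrite mulrBl mul1r -cisD subrK -us (rcB 1) rc1 {1}lu; ring.
  apply: (le_trans (modB _ _)); rewrite [modulus (_ * cis a)]modM [modulus (_ * u)]modM mod_cis u1 !mulr1 mod_rc.
  have := cis_lipschitz1 (s - a); have sa : 0 <= s - a <= h by rewrite /a; lra.
  rewrite (ger0_norm (proj1 (andP sa))) ger0_norm; last by lra.
  by case/andP: sa; lra.
apply: (le_trans (mu_union_le N c0 hA)); rewrite lee_fin.
have -> : h `^ (alpha + 1) = h `^ alpha * h.
  by rewrite powRD ?(powRr1 (ltW h0))//; apply/implyP => _; rewrite gt_eqF.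
have Nle : N%:R * h <= 2 * pi + 1.
  have : (Num.truncn (2 * pi / h))%:R <= 2 * pi / h :> R.
    by rewrite truncn_le; apply: divr_ge0; rewrite ltW// twopi_gt0.
  rewrite ler_pdivlMr// /N -natr1 mulrDl mul1r; lra.
have := powR_ge0 h alpha; move: (h `^ alpha) => p p0.
have -> : N%:R * (K * (p * h)) = (N%:R * h) * (K * p) by ring.
by rewrite -[leRHS]mulrA; apply: ler_wpM2r => //; exact: mulr_ge0.
Qed.

End PullbackCarleson.

(** * Mean squares and boundary values *)

Section BoundaryMean.
Context {R : realType}.
Local Notation C := (cplx R).
Local Notation mu := (@lebesgue_measure R).
Implicit Types (z w l xi : C) (f : C -> C) (r s q c t : R).

(** The coefficient of index [k] enters the mean square with weight [r ^ (2 k)]. *)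
Lemma rmean_sq_mono f r s : hol_disk f -> 0 <= r -> r <= s -> s < 1 ->
  rmean 0 (fun z => modulus (f (rc r * z)) ^+ 2) <= rmean 0 (fun z => modulus (f (rc s * z)) ^+ 2).
Proof.
move=> hf r0 rs s1.
have hr : 0 <= r < 1 by rewrite r0 (le_lt_trans rs).
have hs : 0 <= s < 1 by rewrite s1 (le_trans r0).
apply: (@parseval_le _ 0 (fun z => f (rc r * z)) _ _ (taylor_expands hf hr)) => N.
apply: le_trans (bessel 0 N (taylor_expands hf hs)); apply: ler_sum => k _.
rewrite !modM [leLHS]exprMn [leRHS]exprMn; apply: ler_wpM2l; first by rewrite sqr_ge0.
rewrite !mod_rc !normrX -!exprM !ger0_norm ?(le_trans r0)//; apply: lerXn2r => //.
by rewrite nnegrE (le_trans r0).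
Qed.

Lemma limn_einf_le (u : (\bar R)^nat) (x : \bar R) N :
  (forall n, (N <= n)%N -> (u n <= x)%E) -> (limn_einf u <= x)%E.
Proof.
move=> h; rewrite limn_einf_lim; apply: lime_le; first exact: is_cvg_einfs.
exists N => // n /= Nn; apply: le_trans (h _ Nn).
by apply: ereal_inf_lbound; exists n => /=.
Qed.

(* Fatou's lemma for 1 - |f|^2 on circles of radius tending to 1. *)
Lemma boundary_square_le f q c r : hol_disk f -> (forall z, modulus z < 1 -> modulus (f z) <= 1) ->
  0 <= q <= 1 -> 0 <= c -> 0 <= r < 1 ->
  (mu (angles `&` [set t | exists2 l, radial_limit f t l & (q < modulus l ^+ 2)%R]) <= c%:E)%E ->
  rmean 0 (fun z => modulus (f (rc r * z)) ^+ 2) <= q + c / (2 * pi).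
Proof.
move=> hf f1 /andP[q0 q1] c0 /andP[r0 r1] hc.
pose rr (n : nat) : R := 1 - n.+2%:R^-1.
have hr n : 0 <= rr n < 1.
  have : n.+2%:R^-1 <= 1 :> R by rewrite invf_le1 ?ler1n.
  have : 0 < n.+2%:R^-1 :> R by rewrite invr_gt0.
  by rewrite /rr; move: (n.+2%:R^-1) => x; lra.
have rr_gt p n : p < 1 -> (Num.truncn (1 - p)^-1 <= n)%N -> p < rr n.
  move=> p1 hn; have p0 : 0 < 1 - p by rewrite subr_gt0.
  have : n.+2%:R^-1 < 1 - p.
    rewrite -[ltRHS]invrK ltf_pV2 ?posrE ?invr_gt0//.
    by apply: (lt_le_trans (truncnS_gt _)); rewrite ler_nat ltnS (leq_trans hn).
  by rewrite /rr; move: (n.+2%:R^-1) => x; lra.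
have fr n t : modulus (f (rc (rr n) * cis t)) <= 1.
  by apply: f1; rewrite modM mod_cis mulr1 mod_rc ger0_norm; case/andP: (hr n).
pose F n t := 1 - modulus (f (rc (rr n) * cis t)) ^+ 2.
have cc s : 0 <= s < 1 -> circ_cont (fun z => rc (modulus (f (rc s * z)) ^+ 2)).
  by move=> hs; apply: circ_cont_modX; exact: hol_disk_circ.
have cc1 n : circ_cont (fun z => rc (1 - modulus (f (rc (rr n) * z)) ^+ 2)).
  have -> : (fun z => rc (1 - modulus (f (rc (rr n) * z)) ^+ 2)) =
    (fun z => 1 + - rc (modulus (f (rc (rr n) * z)) ^+ 2)).
    by apply/funext => z; rewrite (rcB 1) rc1.
  by apply: circ_contD; [exact: circ_cont_cst|apply: circ_contN; exact: cc].
have cF n : cts_on 0 (0 + 2 * pi) (F n).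
  exact: (@circ_rc_cts _ (fun z => 1 - modulus (f (rc (rr n) * z)) ^+ 2)).
have F0 n t : 0 <= F n t.
  by rewrite subr_ge0 expr_le1// mod_ge0.
have mF n : measurable_fun angles (EFin \o F n).
  by apply/measurable_EFinP; exact: measurable_on_angles.
pose G t := limn_einf (fun n => (F n t)%:E).
have G0 t : (0 <= G t)%E by apply: (@limn_einf_ge _ _ _ 0%N) => n _; rewrite lee_fin.
have mG : measurable_fun angles G by exact: measurable_limn_einf.
have mA := @angles_measurable R.
pose m := rmean 0 (fun z => modulus (f (rc r * z)) ^+ 2).
have up : (\int[mu]_(t in angles) G t <= (2 * pi * (1 - m))%:E)%E.
  apply: le_trans (@fatou _ _ _ mu angles mA (fun n t => (F n t)%:E) mF _) _.
    by move=> n t _; rewrite lee_fin.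
  apply: (@limn_einf_le _ _ (Num.truncn (1 - r)^-1)) => n hn.
  rewrite angles_integral// lee_fin.
  have -> : rint 0 (0 + 2 * pi) (F n) = 2 * pi * rmean 0 (fun z => 1 - modulus (f (rc (rr n) * z)) ^+ 2).
    by rewrite /rmean mulrA divff ?mul1r// gt_eqF// twopi_gt0.
  apply: ler_wpM2l; first by rewrite ltW// twopi_gt0.
  have -> : rmean 0 (fun z => 1 - modulus (f (rc (rr n) * z)) ^+ 2) =
      1 - rmean 0 (fun z => modulus (f (rc (rr n) * z)) ^+ 2).
    have := rmeanD 0 (cc1 n) (cc _ (hr n)).
    rewrite (@eq_rmean _ _ _ (fun=> 1)) => [|z _]; last by rewrite subrK.
    by rewrite rmean_cst; move: (rmean _ _) (rmean _ _) => x y; lra.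
  rewrite lerB// /m; apply: rmean_sq_mono => //; last by case/andP: (hr n).
  exact/ltW/rr_gt.
(* Up to a null set, [B] lies in the set of the hypothesis: where a radial limit [l] exists with
   [|l|^2 <= q], the lower limit [G] is at least [1 - q]. *)
pose B := angles `&` [set t | (G t < (1 - q)%:E)%E].
have mB : measurable B.
  exact: emeasurable_fun_infty_o.
have [N [mN N0 sN]] := fatou_bounded hf f1.
have Bc : (mu B <= c%:E)%E.
  apply: (@le_trans _ _ (mu ((angles `&` [set t | exists2 l, radial_limit f t l & (q < modulus l ^+ 2)%R]) `|` N))).
    apply: mu_le => t [ta /= Gt]; have [[l hl]|nl] := pselect (has_rlim f t); last by right; apply: sN.
    left; split => //; exists l => //; rewrite ltNge; apply/negP => lq.
    move: Gt; apply/negP; rewrite -leNgt; apply/lee_addgt0Pr => e e0.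
    rewrite -leeBlDr// -EFinB.
    have e2 : 0 < e / 2 by rewrite divr_gt0.
    have [p p1 hp] := hl _ e2.
    apply: (@limn_einf_ge _ _ _ (Num.truncn (1 - p)^-1)) => n /(rr_gt _ _ p1) pn.
    have := hp (rr n); rewrite pn; case/andP: (hr n) => _ -> /(_ isT) h1.
    have h2 := mod_sub_ge (f (rc (rr n) * cis t)) l.
    have h3 := radial_limit_mod_le hl f1.
    rewrite lee_fin /F; have := fr n t; have := mod_ge0 (f (rc (rr n) * cis t)); have := mod_ge0 l.
    move: h1 h2 h3 lq; move: (modulus (_ - l)) (modulus l) (modulus (f _)) => d x y; move: e0; clear=> e0.
    by have [yx|yx] := leP y x; nra.
  by apply: (le_trans (mu_U _ _)); rewrite N0 adde0.
have low : ((1 - q)%:E * mu (angles `\` B) <= \int[mu]_(t in angles) G t)%E.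
  have mD : measurable (angles `\` B) by exact: measurableD.
  apply: (@le_trans _ _ (\int[mu]_(t in angles) ((cst (1 - q)%:E) \_ (angles `\` B)) t)%E).
    rewrite -integral_mkcondr setIidr ?integral_cst//; exact: subDsetl.
  apply: ge0_le_integral_nomeas => t ta.
    by rewrite patchE; case: ifP => //; rewrite lee_fin subr_ge0.
  rewrite patchE; case: ifPn => // /set_mem[_ nB] /=.
  by rewrite leNgt; apply/negP => lt; apply: nB.
have Dc : ((2 * pi - c)%:E <= mu (angles `\` B))%E.
  rewrite EFinB leeBlDr// -mu_angles.
  apply: (@le_trans _ _ (mu ((angles `\` B) `|` B))).
    by apply: mu_le => t ta; case: (pselect (B t)) => [|nB]; [right|left].
  by apply: (le_trans (mu_U _ _)); exact: leeD.
(* This gives [2 pi m <= 2 pi q + (1 - q) c], and [(1 - q) c <= c]. *)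
have : ((1 - q)%:E * (2 * pi - c)%:E <= (2 * pi * (1 - m))%:E)%E.
  apply: le_trans up; apply: le_trans low; apply: lee_wpmul2l => //.
  by rewrite lee_fin subr_ge0.
rewrite -EFinM lee_fin => fin.
have := @twopi_gt0 R; rewrite -/m; move: fin c0 q0 q1; move: (2 * pi) => p; clear=> fin c0 q0 q1 p0.
have -> : q + c / p = (q * p + c) / p by field; rewrite gt_eqF.
by rewrite ler_pdivlMr//; nra.
Qed.

End BoundaryMean.

(** * Decay of the mean squares of the powers of phi *)

Section PowerDecay.
Context {R : realType} (phi : cplx R -> cplx R).
Hypothesis sphi : analytic_self_map phi.
Local Notation C := (cplx R).
Local Notation mu := (@lebesgue_measure R).
Implicit Types (z w l xi : C) (h r y : R).

Hypothesis small : forall alpha : R, 0 < alpha -> exists2 K : R, 0 <= K &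
  forall h xi, 0 < h < 1 -> modulus xi = 1 ->
    (mu (near_set phi xi (2 * h)) <= (K * h `^ alpha)%:E)%E.

(** From [exp(y / (q + 1)) >= y / (q + 1)], raised to the power [q + 1]. *)
Lemma exp_decay q y : 0 < y -> expR (- y) <= q.+1%:R ^+ q.+1 / y ^+ q.+1.
Proof.
move=> y0; have q0 : 0 < q.+1%:R :> R by [].
have -> : expR (- y) = (expR (y / q.+1%:R) ^+ q.+1)^-1.
  by rewrite -expRM_natl mulrC -mulrA mulVf ?mulr1 ?expRN// gt_eqF.
rewrite -expr_div_n -[leRHS]invrK lef_pV2 ?posrE ?invr_gt0 ?exprn_gt0 ?expR_gt0 ?divr_gt0//.
rewrite -exprVn invf_div; apply: lerXn2r; rewrite ?nnegrE ?expR_ge0 ?divr_ge0 ?(ltW y0)//.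
by apply: le_trans (expR_ge1Dx _); rewrite lerDr.
Qed.

Lemma power_mean_split n h K r : 0 < h < 1 -> 0 <= K -> (mu (outer_set phi h) <= K%:E)%E ->
  0 <= r < 1 ->
  rmean 0 (fun z => modulus (phi (rc r * z)) ^+ (2 * n)) <= (1 - h) ^+ (2 * n) + K / (2 * pi).
Proof.
move=> /andP[h0 h1] K0 hK hr; have ph := self_map_hol sphi.
pose f z := phi z ^+ n.
have hf : hol_disk f by move=> z z1; apply: holX; exact: ph.
have f1 z : modulus z < 1 -> modulus (f z) <= 1.
  by move=> z1; rewrite modX exprn_ile1 ?mod_ge0//; apply/ltW; exact: self_map_lt z1.
have -> : (fun z => modulus (phi (rc r * z)) ^+ (2 * n)) = (fun z => modulus (f (rc r * z)) ^+ 2).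
  by apply/funext => z; rewrite modX -exprM mulnC.
have k0 : 0 <= 1 - h by lra.
apply: boundary_square_le => //.
  by rewrite exprn_ge0//= exprn_ile1//; lra.
have [N [mN N0 sN]] := self_map_no_rlim sphi.
apply: (@le_trans _ _ (mu (outer_set phi h `|` N))); last first.
  by apply: (le_trans (mu_U _ _)); rewrite N0 adde0.
apply: mu_le => t [ta [l hl lq]].
have [[l' hl']|nl] := pselect (has_rlim phi t); last by right; apply: sN.
left; split => //; exists l' => //; rewrite ltNge; apply/negP => le.
have hf' := radial_limit_ccont hl' (ccontX n (@ccont_id _ l')).
move: lq; rewrite -(bv_rlim hl) (bv_rlim hf') modX -exprM mulnC; apply/negP; rewrite -leNgt.
by apply: lerXn2r => //; rewrite nnegrE ?mod_ge0.
Qed.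

(** The height [h = 1 / sqrt(n + 2)] controls both terms of [power_mean_split]: [(1 - h) ^ (2 n)] is
    at most [exp(2 - sqrt(n + 2))], and [h ^ (2 (j + 1))] is the inverse of [(n + 2) ^ (j + 1)].
    Taking [n + 2] rather than [n + 1] keeps [h < 1] at [n = 0]. *)
Lemma power_mean_decay j : exists2 K : R, 0 <= K & forall n r, 0 <= r < 1 ->
  rmean 0 (fun z => modulus (phi (rc r * z)) ^+ (2 * n)) <= K / n.+1%:R ^+ j.+1.
Proof.
pose q := (2 * j).+1.
have [|K K0 hK] := outer_set_small sphi small (alpha := q.+1%:R); first by [].
exists (expR 2 * q.+1%:R ^+ q.+1 + K / (2 * pi)) => [|n r hr].
  rewrite addr_ge0// ?mulr_ge0 ?expR_ge0 ?exprn_ge0// ?invr_ge0; exact/ltW/twopi_gt0.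
pose y : R := Num.sqrt n.+2%:R.
have n2 : 0 < n.+2%:R :> R by [].
have y0 : 0 < y by rewrite sqrtr_gt0.
have yy : y ^+ 2 = n.+2%:R by rewrite sqr_sqrtr// ltW.
have y1 : 1 < y by rewrite -(@ltr_pXn2r _ 2)// ?nnegrE ?ltW// yy expr1n ltr1n.
have hh : 0 < y^-1 < 1 by rewrite invr_gt0 y0 invf_lt1.
have yq : y ^+ q.+1 = n.+2%:R ^+ j.+1 by rewrite -yy -exprM; congr (_ ^+ _); rewrite /q; lia.
have nn : (n.+2%:R ^+ j.+1)^-1 <= (n.+1%:R ^+ j.+1)^-1 :> R.
  rewrite lef_pV2 ?posrE ?exprn_gt0//; apply: lerXn2r; rewrite ?nnegrE// ler_nat//.
apply: (le_trans (power_mean_split n hh _ (hK _ hh) hr)); first by rewrite mulr_ge0// powR_ge0.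
rewrite [leRHS]mulrDl; apply: lerD; last first.
  rewrite powR_mulrn ?invr_ge0 ?(ltW y0)// exprVn yq [leLHS]mulrAC; apply: ler_wpM2l => //.
  by rewrite divr_ge0// ltW// twopi_gt0.
apply: (@le_trans _ _ (expR 2 * expR (- y))).
  apply: (@le_trans _ _ (expR (- y^-1) ^+ (2 * n))).
    apply: lerXn2r; rewrite ?nnegrE ?expR_ge0//; first by case/andP: hh; lra.
    by have := expR_ge1Dx (- y^-1).
  rewrite -expRM_natl -expRD ler_expR.
  have : y^-1 * n.+2%:R = y by rewrite -yy expr2 mulrA mulVf ?mul1r// gt_eqF.
  rewrite -addn2 natrD natrM; case/andP: hh; move: (y^-1) (ler0n R n) => v.
  move: (n%:R) => m; clear; nra.
rewrite -mulrA; apply: ler_wpM2l; first exact: expR_ge0.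
apply: (le_trans (exp_decay q y0)); rewrite yq; exact: ler_wpM2l.
Qed.

End PowerDecay.

(** * The Hardy space H^2 *)

Arguments conjc : simpl never.

Section SquareSums.
Context {R : realType}.
Local Notation C := (cplx R).
Implicit Types (z w : C) (f g h F G : C -> C) (r e d : R) (N M k : nat).

Definition psq f N : R := \sum_(0 <= k < N) modulus (taylor f k) ^+ 2.

Definition sq_le f (B : R) : Prop := forall N, psq f N <= B.

(* H^2 and the square of its norm, read off the Taylor coefficients. *)
Definition H2 f : Prop := hol_disk f /\ exists B, sq_le f B.

Definition sqn f : R := sup (range (psq f)).

Lemma psq_ge0 f N : 0 <= psq f N.
Proof. by apply: sumr_ge0 => k _; exact: sqr_ge0. Qed.

Lemma psqS f N : psq f N.+1 = psq f N + modulus (taylor f N) ^+ 2.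
Proof. by rewrite /psq big_nat_recr. Qed.

Lemma psq_mono f N M : (N <= M)%N -> psq f N <= psq f M.
Proof.
move=> /subnKC <-; elim: (M - N)%N => [|n IH]; first by rewrite addn0.
by rewrite addnS psqS (le_trans IH)// lerDl sqr_ge0.
Qed.

Lemma sqn_ub f N : H2 f -> psq f N <= sqn f.
Proof.
move=> [_ [B hB]]; apply: ub_le_sup; last by exists N.
by exists B => _ [M _ <-]; exact: hB.
Qed.

Lemma sqn_le f (B : R) : sq_le f B -> sqn f <= B.
Proof. by move=> hB; apply: ge_sup; [exists (psq f 0), 0%N|move=> _ [N _ <-]; exact: hB]. Qed.

Lemma sqn_sq_le f : H2 f -> sq_le f (sqn f).
Proof. by move=> hf N; exact: sqn_ub. Qed.

Lemma sqn_ge0 f : H2 f -> 0 <= sqn f.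
Proof. by move=> /(sqn_ub 0); apply: le_trans; exact: psq_ge0. Qed.

Lemma sqn_approx f e : H2 f -> 0 < e -> exists N, forall M, (N <= M)%N -> sqn f - e <= psq f M.
Proof.
move=> [_ [B hB]] e0; have hs : has_sup (range (psq f)).
  by split; [exists (psq f 0), 0%N|exists B => _ [M _ <-]; exact: hB].
have [_ [N _ <-] hN] := sup_adherent e0 hs.
by exists N => M NM; apply: (le_trans (ltW hN)); exact: psq_mono.
Qed.

Lemma mean_sq_le f (B : R) r : hol_disk f -> sq_le f B -> 0 <= r < 1 ->
  rmean 0 (fun z => modulus (f (rc r * z)) ^+ 2) <= B.
Proof.
move=> hf hB hr; apply: (@parseval_le _ 0 (fun z => f (rc r * z)) _ _ (taylor_expands hf hr)) => N.
apply: le_trans (hB N); apply: ler_sum => k _; rewrite modM exprMn; apply: ler_piMr; first by rewrite sqr_ge0.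
by case/andP: hr => r0 r1; rewrite mod_rc normrX ger0_norm// -exprM exprn_ile1// ltW.
Qed.

Lemma circle_integral_sq f r : hol_disk f -> 0 <= r < 1 ->
  circle_integral (fun xi => (modulus (f (real_complex R r * xi)) `^ 2)%:E) =
  (rmean 0 (fun z => modulus (f (rc r * z)) ^+ 2))%:E.
Proof.
move=> hf hr; rewrite -circle_integral_rmean; last by apply: circ_cont_modX; exact: hol_disk_circ.
by congr circle_integral; apply/funext => z; rewrite powR_mulrn// mod_ge0.
Qed.

Lemma hardy_norm2_ge f (c : R) : hol_disk f -> (hardy_norm 2 f <= c%:E)%E -> sq_le f (c ^+ 2).
Proof.
rewrite /hardy_norm => hf; set S := ereal_sup _ => Sc.
have Sr r : 0 <= r < 1 -> ((rmean 0 (fun z => modulus (f (rc r * z)) ^+ 2))%:E <= S)%E.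
  by move=> hr; rewrite -circle_integral_sq//; apply: ereal_sup_ubound; exists r.
have S0 : (0 <= S)%E.
  apply: le_trans (Sr 0 _); last by rewrite lexx ltr01.
  by rewrite lee_fin; apply: rmean_ge0 => z _; exact: sqr_ge0.
have Sc2 : (S <= (c ^+ 2)%:E)%E.
  move: S0 Sc; case: (S) => [s| |]//; last by rewrite poweRyr ?invr_eq0.
  rewrite /= !lee_fin => s0; rewrite powR12_sqrt// => sc.
  by rewrite -(sqr_sqrtr s0); apply: lerXn2r => //; rewrite nnegrE ?sqrtr_ge0// (le_trans _ sc)// sqrtr_ge0.
move=> N; apply: hol_coef_sq_le => // r hr; rewrite -lee_fin; apply: le_trans Sc2.
by apply: Sr; case/andP: hr => /ltW -> ->.
Qed.

Lemma hardy_norm2_le f (c : R) : hol_disk f -> 0 <= c -> sq_le f (c ^+ 2) -> (hardy_norm 2 f <= c%:E)%E.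
Proof.
rewrite /hardy_norm => hf c0 hB; set S := ereal_sup _.
have Sc2 : (S <= (c ^+ 2)%:E)%E.
  apply: ge_ereal_sup => _ [r hr <-]; rewrite circle_integral_sq// lee_fin; exact: mean_sq_le.
have S0 : (0 <= S)%E.
  apply: (@le_trans _ _ (rmean 0 (fun z => modulus (f (rc 0 * z)) ^+ 2))%:E).
    by rewrite lee_fin; apply: rmean_ge0 => z _; exact: sqr_ge0.
  by rewrite -circle_integral_sq ?lexx ?ltr01//; apply: ereal_sup_ubound; exists 0 => //=; rewrite lexx ltr01.
move: S0 Sc2; case: (S) => [s| |]//; rewrite !lee_fin => s0 sc.
rewrite powR12_sqrt//.
by rewrite -(ger0_norm c0) -sqrtr_sqr ler_sqrt// sqr_ge0.
Qed.

Lemma hardy_space2 f : hardy_space 2 f <-> H2 f.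
Proof.
split=> [[/analytic_hol hf nf]|[hf [B hB]]].
  split => //; exists (fine (hardy_norm 2 f) ^+ 2); apply: hardy_norm2_ge => //.
  by rewrite fineK// ge0_fin_numE// /hardy_norm poweR_ge0.
split; first exact/analytic_hol.
have B0 : 0 <= B by apply: le_trans (hB 0%N); exact: psq_ge0.
apply: (@le_lt_trans _ _ (Num.sqrt B)%:E); last exact: ltry.
by apply: hardy_norm2_le => //; rewrite ?sqrtr_ge0 ?sqr_sqrtr.
Qed.

Lemma taylor_lin (a : C) f g k : hol_disk f -> hol_disk g ->
  taylor (fun z => a * f z + g z) k = a * taylor f k + taylor g k.
Proof.
move=> hf hg; rewrite /taylor.
have h2 : 0 <= (2^-1 : R) < 1 by rewrite invr_ge0 ler0n invf_lt1// ltr1n.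
have c F : hol_disk F -> circ_cont (fun z => F (rc 2^-1 * z) * conjc z ^+ k).
  by move=> hF; apply: circ_contM; [exact: hol_disk_circ|exact: circ_contXJ].
rewrite (@eq_cmean _ 0 _ (fun z => a * (f (rc 2^-1 * z) * conjc z ^+ k) + g (rc 2^-1 * z) * conjc z ^+ k)).
  rewrite cmeanD ?cmeanZ; [ring|exact: c| |exact: c].
  by apply: circ_contM; [exact: circ_cont_cst|exact: c].
by move=> z _; ring.
Qed.

Lemma hol_disk_lin (a : C) f g : hol_disk f -> hol_disk g -> hol_disk (fun z => a * f z + g z).
Proof.
move=> hf hg z z1; apply: holD; last exact: hg.
by apply: holM; [exact: hol_cst|exact: hf].
Qed.

(** Young's inequality with a weight: [d = 1] suffices for boundedness, while a small [d] keeps the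
    factor of the first term near 1 in [maximizer_ex]. *)
Lemma mod_sqD_le w z d : 0 < d ->
  modulus (w + z) ^+ 2 <= (1 + d) * modulus w ^+ 2 + (1 + d^-1) * modulus z ^+ 2.
Proof.
move=> d0; apply: (@le_trans _ _ ((modulus w + modulus z) ^+ 2)).
  by apply: lerXn2r; rewrite ?nnegrE ?addr_ge0 ?mod_ge0// modD.
move: (modulus w) (modulus z) => x y.
rewrite -subr_ge0 (_ : _ - _ = d^-1 * (d * x - y) ^+ 2); last by field; rewrite gt_eqF.
by rewrite mulr_ge0 ?sqr_ge0// invr_ge0 ltW.
Qed.

Lemma sq_le_lin (a : C) f g (B D : R) d : hol_disk f -> hol_disk g -> 0 < d -> sq_le f B -> sq_le g D ->
  sq_le (fun z => a * f z + g z) ((1 + d) * modulus a ^+ 2 * B + (1 + d^-1) * D).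
Proof.
move=> hf hg d0 hB hD N; have di : 0 < d^-1 by rewrite invr_gt0.
apply: (@le_trans _ _ ((1 + d) * modulus a ^+ 2 * psq f N + (1 + d^-1) * psq g N)).
  rewrite /psq !big_distrr -big_split /=; apply: ler_sum => k _.
  have := mod_sqD_le (a * taylor f k) (taylor g k) d0.
  by rewrite taylor_lin// [modulus (a * _)]modM exprMn [(1 + d) * (_ * _)]mulrA.
by apply: lerD; apply: ler_wpM2l => //; [apply: mulr_ge0; rewrite ?sqr_ge0//|]; exact: addr_ge0 ler01 (ltW _).
Qed.

Lemma H2_lin (a : C) f g : H2 f -> H2 g -> H2 (fun z => a * f z + g z).
Proof.
move=> [hf [B hB]] [hg [D hD]]; split; first exact: hol_disk_lin.
by eexists; apply: (sq_le_lin a hf hg ltr01 hB hD).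
Qed.

Lemma taylor_fpoly (b : nat -> C) N k : taylor (fpoly b N) k = if (k < N)%N then b k else 0.
Proof.
have h2 : 0 < (2^-1 : R) < 1 by rewrite invr_gt0 ltr0n invf_lt1// ltr1n.
pose c k : C := if (k < N)%N then b k else 0.
suff : c = taylor (fpoly b N) by move=> /(congr1 (fun u => u k)).
apply: (@taylor_uniq _ _ 2^-1) => //; first by move=> z _; exact: fpoly_hol.
split; first by apply: hol_disk_circ; [move=> z _; exact: fpoly_hol|case/andP: h2 => /ltW -> ->].
move=> e e0; exists N => M NM z _.
have -> : fpoly (fun k => c k * rc (2^-1 ^+ k)) M z = fpoly b N (rc 2^-1 * z).
  rewrite /fpoly (big_cat_nat _ NM)//= [X in _ + X]big1_seq ?addr0; last first.
    by move=> j /=; rewrite mem_index_iota /c => /andP[Nj _]; rewrite ltnNge Nj !mul0r.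
  by rewrite !big_nat; apply: eq_bigr => j /andP[_ jN]; rewrite /c jN exprMn rcX mulrA.
by rewrite subrr mod0 ltW.
Qed.

Lemma H2_fpoly (b : nat -> C) N : H2 (fpoly b N).
Proof.
split; first by move=> z _; exact: fpoly_hol.
exists (psq (fpoly b N) N) => M; have [MN|NM] := leqP M N; first exact: psq_mono.
rewrite /psq (big_cat_nat _ (ltnW NM))//= [X in _ + X]big1_seq ?addr0// => j /=.
rewrite mem_index_iota => /andP[Nj _]; rewrite taylor_fpoly ltnNge Nj mod0 expr0n//.
Qed.

Lemma polar_ex z : exists2 u : C, modulus u = 1 & z = rc (modulus z) * u.
Proof.
have [->|z0] := eqVneq z 0; first by exists 1; rewrite ?mod1// mod0 mul0r.
by exists (cis (carg z)); [exact: mod_cis|exact: carg_polar].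
Qed.

Lemma fpoly_near f z e : hol_disk f -> modulus z < 1 -> 0 < e ->
  exists N0, forall N, (N0 <= N)%N -> modulus (f z - fpoly (taylor f) N z) <= e.
Proof.
move=> hf z1 e0; have [u u1 zu] := polar_ex z.
have hr : 0 <= modulus z < 1 by rewrite mod_ge0.
have [_ /(_ e e0)[N0 hN]] := taylor_expands hf hr.
exists N0 => N /hN/(_ u u1); rewrite -zu.
suff -> : fpoly (fun k => taylor f k * rc (modulus z ^+ k)) N u = fpoly (taylor f) N z by [].
by apply: eq_bigr => k _; rewrite [in RHS]zu exprMn rcX mulrA.
Qed.

Lemma taylor0_eq0 f z : hol_disk f -> (forall k, taylor f k = 0) -> modulus z < 1 -> f z = 0.
Proof.
move=> hf f0 z1; apply/eqP; rewrite -mod_eq0 eq_le mod_ge0 andbT; apply/ler_addgt0Pr => e e0.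
have [N /(_ N (leqnn N))] := fpoly_near hf z1 e0.
by rewrite /fpoly big1 ?subr0 ?add0r// => k _; rewrite f0 mul0r.
Qed.

End SquareSums.

(** * The inner product through Taylor coefficients *)

Section InnerProduct.
Context {R : realType}.
Local Notation C := (cplx R).
Implicit Types (z w : C) (f g h F G : C -> C) (r e d : R) (N M k : nat) (b c : nat -> C).

Lemma uconv_uniq (s : nat -> C) l l' : uconv s l -> uconv s l' -> l = l'.
Proof.
move=> sl sl'; apply/eqP; rewrite -subr_eq0 -mod_eq0 eq_le mod_ge0 andbT; apply/ler_addgt0Pr => e e0.
have e2 : 0 < e / 2 by rewrite divr_gt0.
have [n [/= h1 h2]] := ultra_nonempty (ultraI (sl _ e2) (sl' _ e2)).
have -> : l - l' = (s n - l') - (s n - l) by ring.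
by apply: (le_trans (modB _ _)); lra.
Qed.

Lemma uconv_lin (a : C) (s t : nat -> C) l m : uconv s l -> uconv t m ->
  uconv (fun n => a * s n + t n) (a * l + m).
Proof.
move=> sl tm e e0; have e2 : 0 < e / 2 by rewrite divr_gt0.
have a0 : 0 < modulus a + 1 by rewrite ltr_wpDl// mod_ge0.
have ea : 0 < e / 2 / (modulus a + 1) by rewrite divr_gt0.
apply: ultraS (ultraI (sl _ ea) (tm _ e2)) => n [/= h1 h2].
have -> : a * s n + t n - (a * l + m) = a * (s n - l) + (t n - m) by ring.
apply: (le_lt_trans (modD _ _)); rewrite modM (splitr e); apply: ler_ltD => //.
move: h1; rewrite ltr_pdivlMr// => h1; have := mod_ge0 (s n - l); have := mod_ge0 a.
by move: (modulus a) (modulus _) h1 => x y; nra.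
Qed.

Lemma uconv_conj (s : nat -> C) l : uconv s l -> uconv (fun n => conjc (s n) : C) (conjc l).
Proof. by move=> sl e /sl; apply: ultraS => n /=; rewrite -conjN -conjD modJ. Qed.

(* Partial sums of the inner product. *)
Definition cps f g N : C := \sum_(0 <= k < N) taylor f k * conjc (taylor g k).

Definition tail f N : R := sqn f - psq f N.

Lemma cps_cauchy f g d N M : H2 f -> H2 g -> 0 < d -> (N <= M)%N ->
  modulus (cps f g M - cps f g N) <= d * tail f N + d^-1 * tail g N.
Proof.
move=> hf hg d0 NM; have di : 0 < d^-1 by rewrite invr_gt0.
rewrite /cps (big_cat_nat _ NM)//= addrAC subrr add0r.
apply: (le_trans (mod_sum _ _ _)).
have E F : H2 F -> \sum_(N <= k < M) modulus (taylor F k) ^+ 2 <= tail F N.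
  by move=> hF; rewrite lerBrDl /psq -(big_cat_nat _ NM)//; exact: sqn_ub.
apply: (@le_trans _ _ (d * \sum_(N <= k < M) modulus (taylor f k) ^+ 2 +
   d^-1 * \sum_(N <= k < M) modulus (taylor g k) ^+ 2)); last first.
  by apply: lerD; apply: ler_wpM2l (E _ _) => //; exact: ltW.
rewrite !big_distrr -big_split /=; apply: ler_sum => k _; rewrite modM modJ.
move: (modulus (taylor f k)) (modulus (taylor g k)) (mod_ge0 (taylor f k)) (mod_ge0 (taylor g k)) => x y x0 y0.
have : 0 <= d^-1 * (d * x - y) ^+ 2 by rewrite mulr_ge0 ?sqr_ge0// ltW.
have -> : d^-1 * (d * x - y) ^+ 2 = d * x ^+ 2 + d^-1 * y ^+ 2 - 2 * (x * y).
  by field; rewrite gt_eqF.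
have : 0 <= x * y by exact: mulr_ge0.
by move: (d * _) (d^-1 * _) (x * y) => p q s; lra.
Qed.

Lemma cps_limit f g : H2 f -> H2 g -> exists l, uconv (cps f g) l /\ forall d N, 0 < d ->
  modulus (l - cps f g N) <= d * tail f N + d^-1 * tail g N.
Proof.
move=> hf hg; have [|l hl] := @bounded_uconv _ (cps f g) (1 * tail f 0 + 1^-1 * tail g 0).
  move=> n; have := cps_cauchy hf hg ltr01 (leq0n n).
  by rewrite {2}/cps big_nil subr0.
exists l; split => // d N d0; apply/ler_addgt0Pr => e e0.
have [n [/= h1 h2]] := ultra_nonempty (ultraI (hl _ e0) (ultra_ge N)).
have := cps_cauchy hf hg d0 h2.
have -> : l - cps f g N = (cps f g n - cps f g N) - (cps f g n - l) by ring.
by move=> h; apply: (le_trans (modB _ _)); apply: lerD => //; exact: ltW.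
Qed.

(** Partial sums [S], [T] are orthogonal to the remainders, so the left side is the mean of
    [(F - S) conj(G - T)]; its factors are measured by [parseval_identity]. *)
Lemma parseval_polar F G b c N : expands F b -> expands G c ->
  modulus (cmean 0 (fun z => F z * conjc (G z)) - \sum_(0 <= k < N) b k * conjc (c k)) <=
  (rmean 0 (fun z => modulus (F z) ^+ 2) - \sum_(0 <= k < N) modulus (b k) ^+ 2) +
  (rmean 0 (fun z => modulus (G z) ^+ 2) - \sum_(0 <= k < N) modulus (c k) ^+ 2).
Proof.
move=> eF eG; have [cF _] := eF; have [cG _] := eG.
pose S := fpoly b N; pose T := fpoly c N.
have cS : circ_cont S by exact: circ_cont_fpoly.
have cT : circ_cont T by exact: circ_cont_fpoly.
have cFS : circ_cont (fun z => F z - S z) by apply: circ_contD => //; exact: circ_contN.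
have cGT : circ_cont (fun z => G z - T z) by apply: circ_contD => //; exact: circ_contN.
have cM H K : circ_cont H -> circ_cont K -> circ_cont (fun z => H z * conjc (K z)).
  by move=> cH cK; apply: circ_contM => //; exact: circ_contJ.
have FT : cmean 0 (fun z => F z * conjc (T z)) = \sum_(0 <= k < N) b k * conjc (c k).
  by rewrite (@cmean_fpolyJ _ 0 F c b)//; move=> n _; exact: expands_coef.
have ST : cmean 0 (fun z => S z * conjc (T z)) = \sum_(0 <= k < N) b k * conjc (c k).
  by rewrite (@cmean_fpolyJ _ 0 S c b)//; move=> n nN; exact: cmean_fpoly_coef.
have SG : cmean 0 (fun z => S z * conjc (G z)) = \sum_(0 <= k < N) b k * conjc (c k).
  rewrite (@eq_cmean _ _ _ (fun z => conjc (G z * conjc (S z)))); last first.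
    by move=> z _; rewrite conjM conjK mulrC.
  rewrite cmean_conj ?(@cmean_fpolyJ _ 0 G b c)//; [|by move=> n _; exact: expands_coef|exact: cM].
  by rewrite conj_sum; apply: eq_bigr => k _; rewrite conjM conjK mulrC.
have -> : cmean 0 (fun z => F z * conjc (G z)) - \sum_(0 <= k < N) b k * conjc (c k) =
    cmean 0 (fun z => (F z - S z) * conjc (G z - T z)).
  rewrite (@eq_cmean _ 0 (fun z => (F z - S z) * _) (fun z => (F z * conjc (G z) + S z * conjc (T z)) -
     (F z * conjc (T z) + S z * conjc (G z)))); last first.
    by move=> z _; rewrite conjD conjN; ring.
  rewrite cmeanB ?cmeanD ?FT ?ST ?SG; [ring| | | | | |];
    by [exact: cM|apply: circ_contD; exact: cM].
rewrite (parseval_identity 0 N eF) (parseval_identity 0 N eG) -/S -/T.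
rewrite ![_ + rmean _ _ - _]addrAC !subrr !add0r -rmeanD; first 1 last.
- exact: circ_cont_modX.
- exact: circ_cont_modX.
apply: le_trans (mod_cmean 0 (cM _ _ cFS cGT)) _.
apply: le_rmean.
- by apply: circ_cont_mod; exact: cM.
- have -> : (fun z => rc (modulus (F z - S z) ^+ 2 + modulus (G z - T z) ^+ 2)) =
     (fun z => rc (modulus (F z - S z) ^+ 2) + rc (modulus (G z - T z) ^+ 2)).
    by apply/funext => z; rewrite rcD.
  by apply: circ_contD; exact: circ_cont_modX.
move=> z _; rewrite modM modJ; move: (modulus _) (modulus _) => x y.
by have := sqr_ge0 (x - y); have := sqr_ge0 (x + y); rewrite !expr2; nra.
Qed.

Lemma circle_integralC_cmean (u : C -> C) : circ_cont u -> circle_integralC u = cmean 0 u.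
Proof.
move=> cu; rewrite /circle_integralC /cmean; congr (_ * _).
have cr : rcont_on 0 (0 + 2 * pi) (fun t => u (cis t)) by exact: circ_rcont.
rewrite /cint /Rintegral (angles_integral (F := fun t => complex.Re (u (cis t)))); last exact: rcont_on_Re.
by rewrite (angles_integral (F := fun t => complex.Im (u (cis t)))); last exact: rcont_on_Im.
Qed.

Lemma one_sub_sq_le r k N : 0 <= r <= 1 -> (k <= N)%N -> 1 - r ^+ k ^+ 2 <= (2 * N)%:R * (1 - r).
Proof.
move=> hr kN; have hr' : 0 <= 1 - r <= 1 by lra.
have := bernoulli_sub (k * 2) hr'; rewrite subKr -exprM => h.
apply: (@le_trans _ _ ((k * 2)%:R * (1 - r))); first by move: h; lra.
by apply: ler_wpM2r; [case/andP: hr'|rewrite ler_nat mulnC leq_mul2l kN orbT].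
Qed.

(** On the circle of radius [r] the coefficient of index [k] is multiplied by [r ^ k]. Below [N]
    each product of coefficients loses a fraction at most [2 N (1 - r)], and beyond [N] the tails
    are small. The circle means therefore converge to the limit of the sums [cps], and [hardy_inner]
    inherits the error bound of [cps_limit]. *)
Lemma hardy_innerP f g : H2 f -> H2 g -> uconv (cps f g) (hardy_inner f g) /\
  forall d N, 0 < d -> modulus (hardy_inner f g - cps f g N) <= d * tail f N + d^-1 * tail g N.
Proof.
move=> hf hg; have [l [ul hl]] := cps_limit hf hg.
suff -> : hardy_inner f g = l by [].
have [df _] := hf; have [dg _] := hg.
rewrite /hardy_inner; apply/cvg_lim; first exact: norm_hausdorff.
apply/left_limit_cvg => e e0; have e8 : 0 < e / 8 by rewrite divr_gt0.
have [N1 hN1] := sqn_approx hf e8; have [N2 hN2] := sqn_approx hg e8.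
pose N := maxn N1 N2.
have tf : tail f N <= e / 8 by rewrite lerBlDr -lerBlDl hN1// leq_maxl.
have tg : tail g N <= e / 8 by rewrite lerBlDr -lerBlDl hN2// leq_maxr.
pose K := psq f N + psq g N; have K0 : 0 <= K by rewrite addr_ge0 ?psq_ge0.
pose q := (2 * N)%:R * K + 1; have q0 : 0 < q by rewrite ltr_wpDl// mulr_ge0.
exists (1 - Num.min 1 (e / 8 / q)) => [|r /andP[rp r1]].
  by rewrite ltrBlDr ltrDl lt_min ltr01 divr_gt0.
have rm : 1 - r < Num.min 1 (e / 8 / q) by lra.
move: rm; rewrite lt_min => /andP[r0 rq].
have r00 : 0 <= r by lra.
have hr : 0 <= r < 1 by rewrite r00.
have hr1 : 0 <= r <= 1 by rewrite r00 ltW.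
have eta : (2 * N)%:R * (1 - r) * K <= e / 8.
  move: rq; rewrite ltr_pdivlMr// /q => rq.
  have : 0 <= 1 - r by lra.
  by move: rq; move: ((2 * N)%:R) (1 - r) => x y; nra.
rewrite circle_integralC_cmean; last first.
  by apply: circ_contM; [|apply: circ_contJ]; exact: hol_disk_circ.
have := parseval_polar N (taylor_expands df hr) (taylor_expands dg hr).
set X := cmean _ _; set cs := \sum_(0 <= k < N) _ * _; set pf := \sum_(0 <= k < N) _; set pg := \sum_(0 <= k < N) _.
have mf := mean_sq_le df (sqn_sq_le hf) hr; have mg := mean_sq_le dg (sqn_sq_le hg) hr.
have wk k : 0 <= 1 - r ^+ k ^+ 2.
  by rewrite subr_ge0 expr_le1// ?exprn_ile1 ?exprn_ge0// ltW.
have loss F : psq F N - \sum_(0 <= k < N) modulus (taylor F k * rc (r ^+ k)) ^+ 2 <=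
    (2 * N)%:R * (1 - r) * psq F N.
  rewrite /psq -sumrB big_distrr /= !big_nat; apply: ler_sum => k /andP[_ kN].
  rewrite modM mod_rc exprMn real_normK ?num_real// -[X in X - _]mulr1 -mulrBr mulrC.
  by apply: ler_wpM2r; [exact: sqr_ge0|apply: one_sub_sq_le => //; exact: ltnW].
have lf := loss f; have lg := loss g.
have lc : modulus (cs - cps f g N) <= (2 * N)%:R * (1 - r) * K.
  rewrite /cs /cps -sumrB; apply: (le_trans (mod_sum _ _ _)).
  rewrite /K /psq -big_split big_distrr /= !big_nat; apply: ler_sum => k /andP[_ kN].
  rewrite conjM conj_rc.
  have -> : taylor f k * rc (r ^+ k) * (conjc (taylor g k) * rc (r ^+ k)) - taylor f k * conjc (taylor g k) =
     - (taylor f k * conjc (taylor g k) * rc (1 - r ^+ k ^+ 2)).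
    by rewrite (rcB 1) rc1 [rc (_ ^+ 2)]rcX; ring.
  rewrite modN [modulus (_ * rc _)]modM [modulus (taylor f k * _)]modM modJ mod_rc ger0_norm// mulrC.
  have := one_sub_sq_le hr1 (ltnW kN); have := wk k.
  move: (modulus (taylor f k)) (modulus (taylor g k)) (mod_ge0 (taylor f k)) (mod_ge0 (taylor g k)) => x y x0 y0.
  have : x * y <= x ^+ 2 + y ^+ 2 by have := sqr_ge0 (x - y); have := sqr_ge0 (x + y); rewrite !expr2; nra.
  move=> xy w0 w1; apply: ler_pM => //; exact: mulr_ge0.
move=> pol; have hl1 := hl 1 N ltr01; rewrite invr1 !mul1r in hl1.
have -> : X - l = (X - cs) + ((cs - cps f g N) - (l - cps f g N)) by ring.
apply: (le_lt_trans (modD _ _)); have m2 := modB (cs - cps f g N) (l - cps f g N).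
have eK : (2 * N)%:R * (1 - r) * K = (2 * N)%:R * (1 - r) * psq f N + (2 * N)%:R * (1 - r) * psq g N.
  by rewrite /K mulrDr.
move: pol m2 hl1 lc lf lg mf mg eta eK tf tg e0; rewrite /tail -/pf -/pg; clear.
move: (modulus (X - cs)) (modulus (cs - cps f g N)) (modulus (l - cps f g N)) (modulus (_ - _)) => x1 x2 x3 x4.
move: (rmean _ _) (rmean _ _) ((2 * N)%:R * (1 - r) * K) ((2 * N)%:R * (1 - r) * psq f N) ((2 * N)%:R * (1 - r) * psq g N) => a1 a2 a3 a4 a5.
move: (sqn f) (sqn g) (psq f N) (psq g N) pf pg => b1 b2 b3 b4 b5 b6.
by lra.
Qed.

Lemma hardy_inner_lin (a : C) f g h : H2 f -> H2 g -> H2 h ->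
  hardy_inner (fun z => a * f z + g z) h = a * hardy_inner f h + hardy_inner g h.
Proof.
move=> hf hg hh; have [u _] := hardy_innerP (H2_lin a hf hg) hh.
apply: (uconv_uniq u); have [u1 _] := hardy_innerP hf hh; have [u2 _] := hardy_innerP hg hh.
have := uconv_lin a u1 u2; congr (uconv _ _); apply/funext => n.
rewrite /cps big_distrr -big_split /=; apply: eq_bigr => k _.
rewrite taylor_lin; [|by case: hf|by case: hg].
by move: (taylor f k) (taylor g k) (conjc _) => x y w; ring.
Qed.

Lemma hardy_inner_conj f g : H2 f -> H2 g -> hardy_inner g f = conjc (hardy_inner f g).
Proof.
move=> hf hg; have [u _] := hardy_innerP hg hf; apply: (uconv_uniq u).
have [/uconv_conj v _] := hardy_innerP hf hg; move: v; congr (uconv _ _); apply/funext => n.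
by rewrite /cps conj_sum; apply: eq_bigr => k _; rewrite conjM conjK mulrC.
Qed.

Lemma hardy_inner_sqn f : H2 f -> hardy_inner f f = rc (sqn f).
Proof.
move=> hf; have [u _] := hardy_innerP hf hf; apply: (uconv_uniq u) => e e0.
have e2 : 0 < e / 2 by rewrite divr_gt0.
have [N hN] := sqn_approx hf e2; apply: ultraS (ultra_ge N) => n /hN h /=.
have -> : cps f f n = rc (psq f n) by rewrite /cps rc_sum; apply: eq_bigr => k _; rewrite mulJ.
by rewrite -rcB mod_rc ltr_norml; have := sqn_ub n hf; lra.
Qed.

Lemma hardy_inner_linr (a : C) f g h : H2 f -> H2 g -> H2 h ->
  hardy_inner h (fun z => a * f z + g z) = conjc a * hardy_inner h f + hardy_inner h g.
Proof.
move=> hf hg hh; have hl := H2_lin a hf hg.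
by rewrite (hardy_inner_conj hl hh) hardy_inner_lin// conjD conjM -!hardy_inner_conj.
Qed.

Lemma sqn_lin_expand (a : C) f g : H2 f -> H2 g ->
  sqn (fun z => a * f z + g z) =
  modulus a ^+ 2 * sqn f + 2 * complex.Re (a * hardy_inner f g) + sqn g.
Proof.
move=> hf hg; have hl := H2_lin a hf hg; apply: rc_inj; rewrite -hardy_inner_sqn//.
rewrite hardy_inner_lin// !hardy_inner_linr// !hardy_inner_sqn// (hardy_inner_conj hf hg).
have E (A B D F : R) : rc (A * B + 2 * D + F) = rc A * rc B + rc 2 * rc D + rc F.
  by rewrite (rcD (_ + _)) (rcD (A * _)) (rcM A) (rcM 2).
rewrite E -mulJ.
have -> : rc 2 * rc (complex.Re (a * hardy_inner f g)) = a * hardy_inner f g + conjc (a * hardy_inner f g).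
  by apply: C_eq; rewrite ?(cReM, cImM, cReD, cImD, cReJ, cImJ) /=; ring.
rewrite (conjM a); move: (conjc a) (conjc (hardy_inner f g)) (hardy_inner f g) (rc (sqn f)) (rc (sqn g)) => x y w p q; ring.
Qed.

Lemma sqn_lin_le (a : C) f g d : H2 f -> H2 g -> 0 < d ->
  sqn (fun z => a * f z + g z) <= (1 + d) * modulus a ^+ 2 * sqn f + (1 + d^-1) * sqn g.
Proof.
move=> hf hg d0; apply: sqn_le; apply: sq_le_lin => //; [by case: hf|by case: hg| |]; exact: sqn_sq_le.
Qed.

Lemma H2_cst0 : H2 (fun=> 0 : C).
Proof.
have -> : (fun=> 0 : C) = fpoly (fun=> 0) 0 by apply/funext => z; rewrite /fpoly big_nil.
exact: H2_fpoly.
Qed.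

Lemma hardy_inner0l f : H2 f -> hardy_inner (fun=> 0) f = 0.
Proof.
move=> hf; have := hardy_inner_lin (- 1) H2_cst0 H2_cst0 hf.
have -> : (fun z : C => - 1 * 0 + 0 : C) = (fun=> 0) by apply/funext => z; rewrite mulr0 addr0.
by rewrite mulN1r addNr.
Qed.

Lemma H2_sum (c : nat -> C) (F : nat -> C -> C) N : (forall i, (i < N)%N -> H2 (F i)) ->
  H2 (fun z => \sum_(0 <= i < N) c i * F i z).
Proof.
elim: N => [|N IH] hF.
  by rewrite (_ : (fun z => _) = (fun=> 0)); [exact: H2_cst0|apply/funext => z; rewrite big_nil].
rewrite (_ : (fun z => _) = (fun z => c N * F N z + \sum_(0 <= i < N) c i * F i z)).
  by apply: H2_lin; [exact: hF|apply: IH => i iN; exact/hF/ltnW].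
by apply/funext => z; rewrite big_nat_recr//= addrC.
Qed.

Lemma hardy_inner_sum (c : nat -> C) (F : nat -> C -> C) N h : (forall i, (i < N)%N -> H2 (F i)) -> H2 h ->
  hardy_inner (fun z => \sum_(0 <= i < N) c i * F i z) h = \sum_(0 <= i < N) c i * hardy_inner (F i) h.
Proof.
move=> + hh; elim: N => [|N IH] hF.
  rewrite big_nil (_ : (fun z => _) = (fun=> 0)); first exact: hardy_inner0l.
  by apply/funext => z; rewrite big_nil.
have hF' i : (i < N)%N -> H2 (F i) by move=> iN; exact/hF/ltnW.
rewrite [RHS]big_nat_recr//= -IH//.
have -> : (fun z => \sum_(0 <= i < N.+1) c i * F i z) =
    (fun z => c N * F N z + \sum_(0 <= i < N) c i * F i z).
  by apply/funext => z; rewrite big_nat_recr//= addrC.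
by rewrite hardy_inner_lin; [exact: addrC|exact: hF|exact: H2_sum|].
Qed.

End InnerProduct.

(** * Point evaluations and weak limits *)

Section WeakLimits.
Context {R : realType}.
Local Notation C := (cplx R).
Implicit Types (z w : C) (f g h : C -> C) (F : nat -> C -> C) (r e d t : R) (N M k n : nat).

Lemma discriminant_le (A s D : R) : 0 <= D -> (forall t, 0 <= A - 2 * t * s + t ^+ 2 * D) -> s ^+ 2 <= A * D.
Proof.
rewrite le_eqVlt => /predU1P[<-|D0] h.
  have [->|s0] := eqVneq s 0; first by rewrite expr0n mulr0.
  have := h ((A + 1) / (2 * s)).
  have -> : A - 2 * ((A + 1) / (2 * s)) * s + ((A + 1) / (2 * s)) ^+ 2 * 0 = - 1 by field.
  by rewrite oppr_ge0 ler10.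
have := h (s / D).
have -> : A - 2 * (s / D) * s + (s / D) ^+ 2 * D = A - s ^+ 2 / D by field; rewrite gt_eqF.
by rewrite subr_ge0 ler_pdivrMr.
Qed.

Lemma geom_segment (u : R) N M : (N <= M)%N -> (\sum_(N <= k < M) u ^+ k) * (1 - u) = u ^+ N - u ^+ M.
Proof.
move=> NM; rewrite -(subnKC NM); elim: (M - N)%N => [|n IH]; first by rewrite addn0 big_geq// mul0r subrr.
by rewrite addnS big_nat_recr ?leq_addr//= mulrDl IH exprS; ring.
Qed.

(** Cauchy-Schwarz between the coefficients of index at least [N] and the powers of [w], through
    [discriminant_le] applied to partial sums. *)
Lemma point_estimate f (B : R) N w : hol_disk f -> sq_le f B ->
  (forall k, (k < N)%N -> taylor f k = 0) -> modulus w < 1 ->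
  modulus (f w) ^+ 2 <= B * ((modulus w ^+ 2) ^+ N / (1 - modulus w ^+ 2)).
Proof.
move=> hf hB f0 w1; set x := modulus w; have x0 : 0 <= x by exact: mod_ge0.
have u1 : 0 < 1 - x ^+ 2 by rewrite subr_gt0 expr_lt1.
have D0 : 0 <= (x ^+ 2) ^+ N / (1 - x ^+ 2) by rewrite divr_ge0 ?(ltW u1)// !exprn_ge0.
have part M : (N <= M)%N -> \sum_(N <= k < M) (x ^+ 2) ^+ k <= (x ^+ 2) ^+ N / (1 - x ^+ 2).
  move=> NM; rewrite ler_pdivlMr//.
  by rewrite geom_segment// lerBlDr lerDl !exprn_ge0.
have pol M : (N <= M)%N -> modulus (fpoly (taylor f) M w) ^+ 2 <= B * ((x ^+ 2) ^+ N / (1 - x ^+ 2)).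
  move=> NM; set s := modulus _; apply: discriminant_le => // t.
  have s0 : 0 <= s by exact: mod_ge0.
  have sle : s <= \sum_(N <= k < M) modulus (taylor f k) * x ^+ k.
    rewrite /s /fpoly (big_cat_nat _ NM)//= big_nat_cond big1 ?add0r => [|k /andP[/andP[_ kN] _]]; last first.
      by rewrite f0// mul0r.
    by apply: (le_trans (mod_sum _ _ _)); apply: ler_sum => k _; rewrite [modulus (_ * _)]modM modX.
  have : 0 <= \sum_(N <= k < M) (modulus (taylor f k) - `|t| * x ^+ k) ^+ 2.
    by apply: sumr_ge0 => k _; exact: sqr_ge0.
  have -> : \sum_(N <= k < M) (modulus (taylor f k) - `|t| * x ^+ k) ^+ 2 =
      \sum_(N <= k < M) modulus (taylor f k) ^+ 2
      - 2 * `|t| * (\sum_(N <= k < M) modulus (taylor f k) * x ^+ k)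
      + t ^+ 2 * (\sum_(N <= k < M) (x ^+ 2) ^+ k).
    rewrite !big_distrr -sumrN -!big_split /=; apply: eq_bigr => k _.
    by rewrite -[t ^+ 2]real_normK ?num_real// -exprM mulnC exprM; ring.
  have q1 : \sum_(N <= k < M) modulus (taylor f k) ^+ 2 <= B.
    apply: le_trans (hB M); rewrite /psq [leRHS](big_cat_nat _ NM)//= lerDr.
    by apply: sumr_ge0 => k _; exact: sqr_ge0.
  have q2 := ler_wpM2l (sqr_ge0 t) (part M NM).
  have q3 := ler_wpM2l (normr_ge0 t) sle.
  have q4 : t * s <= `|t| * s by apply: ler_wpM2r => //; exact: ler_norm.
  move: q1 q2 q3 q4; move: (\sum_(_ <= _ < _) _) (\sum_(_ <= _ < _) _) (\sum_(_ <= _ < _) _) => a b c.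
  rewrite -[2 * `|t| * _]mulrA -[2 * t * _]mulrA.
  move: (t ^+ 2 * _) (t ^+ 2 * _) (`|t| * s) (`|t| * _) (t * s) => p1 p2 p3 p4 p5; lra.
apply/ler_addgt0Pr => e e0; pose d := Num.min 1 (e / (2 * modulus (f w) + 1)).
have m0 := mod_ge0 (f w); have k0 : 0 < 2 * modulus (f w) + 1 by rewrite ltr_wpDl// mulr_ge0.
have d0 : 0 < d by rewrite lt_min ltr01 divr_gt0.
have [N0 hN] := fpoly_near hf w1 d0.
have NM : (N <= maxn N0 N)%N by exact: leq_maxr.
have := hN (maxn N0 N) (leq_maxl _ _); have := pol _ NM.
have := mod_sub_ge (f w) (fpoly (taylor f) (maxn N0 N) w); have := mod_ge0 (fpoly (taylor f) (maxn N0 N) w).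
have de : d * (2 * modulus (f w) + 1) <= e by rewrite -ler_pdivlMr// ge_min lexx orbT.
have d1 : d <= 1 by rewrite ge_min lexx.
move: (modulus (fpoly _ _ _)) (modulus (f w - _)) (modulus (f w)) (B * _) m0 de d0 d1 => a b c D; clear.
move=> c0 de d0 d1 a0 cab aD bd.
have [ca|ca] := leP c a; first by have : c ^+ 2 <= a ^+ 2 by [apply: lerXn2r; rewrite ?nnegrE]; move=> ?; nra.
nra.
Qed.

Lemma bounded_sq_le f (M : R) : hol_disk f -> (forall z, modulus z < 1 -> modulus (f z) <= M) -> sq_le f (M ^+ 2).
Proof.
move=> hf hM N; have M0 : 0 <= M by apply: le_trans (hM 0 _); rewrite ?mod0 ?ltr01// mod_ge0.
apply: hol_coef_sq_le => // r /andP[r0 r1]; have hr : 0 <= r < 1 by rewrite ltW.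
rewrite -(rmean_cst 0 (M ^+ 2)); apply: le_rmean.
- by apply: circ_cont_modX; exact: hol_disk_circ.
- exact: circ_cont_cst.
move=> z hz; apply: lerXn2r; rewrite ?nnegrE ?mod_ge0//; apply: hM.
by rewrite modM hz mulr1 mod_rc ger0_norm// ltW.
Qed.

Lemma coef_le f (B : R) k : sq_le f B -> modulus (taylor f k) <= 1 + B.
Proof.
move=> hB; have := hB k.+1; rewrite psqS => h.
have := psq_ge0 f k; have := mod_ge0 (taylor f k); move: (modulus _) (psq f k) h => x p; nra.
Qed.

(** Weak compactness of the balls of H^2: the ultralimits of the coefficients define a power series,
    and each finite square sum passes to the limit. *)
Lemma weak_limit F (B : R) : (forall n, hol_disk (F n)) -> (forall n, sq_le (F n) B) ->
  exists f, [/\ hol_disk f, sq_le f B & forall k, uconv (fun n => taylor (F n) k) (taylor f k)].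
Proof.
move=> hF hB; have B0 : 0 <= B by apply: le_trans (hB 0%N 0%N); exact: psq_ge0.
have ex k : exists l, uconv (fun n => taylor (F n) k) l.
  by apply: (@bounded_uconv _ _ (1 + B)) => n; exact: coef_le.
have [b hb] := choice ex.
have bB k : modulus (b k) <= 1 + B by apply: uconv_le (hb k) _ => n; exact: coef_le.
exists (psum b); rewrite /sq_le /psq (taylor_psum bB); split; [exact: psum_hol bB| |exact: hb].
move=> N; apply/ler_addgt0Pr => e e0.
pose q := 2 * (1 + B) + 1; have q0 : 0 < q by rewrite /q; lra.
pose d := Num.min 1 (e / (N%:R * q + 1)).
have K0 : 0 < N%:R * q + 1 by rewrite ltr_wpDl// mulr_ge0// ltW.
have d0 : 0 < d by rewrite lt_min ltr01 divr_gt0.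
have d1 : d <= 1 by rewrite ge_min lexx.
have de : N%:R * q * d <= e.
  apply: (@le_trans _ _ ((N%:R * q + 1) * d)); first by rewrite ler_wpM2r ?(ltW d0)// lerDl.
  by rewrite mulrC -ler_pdivlMr// ge_min lexx orbT.
have [n hn] := ultra_nonempty (ultra_forall N (fun k => hb k d d0)).
apply: (@le_trans _ _ (\sum_(0 <= k < N) (modulus (taylor (F n) k) ^+ 2 + q * d))).
  rewrite !big_nat; apply: ler_sum => k /andP[_ kN].
  have := hn k kN; rewrite /= mod_distC => h; have := mod_sub_ge (b k) (taylor (F n) k).
  have := coef_le k (hB n); have := mod_ge0 (b k); have := mod_ge0 (taylor (F n) k); rewrite /q.
  move: h; move: (modulus (b k - _)) (modulus (taylor _ _)) (modulus (b k)) d1 d0 B0 => c x y; clear=> d1 d0 B0 cd x0 y0 xB yxc.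
  have [yx|yx] := leP y x; first by have : y ^+ 2 <= x ^+ 2 by [apply: lerXn2r; rewrite ?nnegrE]; move=> ?; nra.
  nra.
rewrite big_split /=; apply: lerD; first exact: hB.
by rewrite sumr_const_nat subn0 -mulr_natl mulrA.
Qed.

(** Orthogonality survives weak limits: up to an error controlled by the tail of [g], the inner
    product depends on finitely many coefficients, and these converge. *)
Lemma hardy_inner_weak0 F f g (B : R) : (forall n, H2 (F n)) -> (forall n, sq_le (F n) B) -> H2 f -> H2 g ->
  sq_le f B -> (forall k, uconv (fun n => taylor (F n) k) (taylor f k)) ->
  (forall n, hardy_inner (F n) g = 0) -> hardy_inner f g = 0.
Proof.
move=> hF hB hf hg fB uF F0; have B0 : 0 <= B by apply: le_trans (hB 0%N 0%N); exact: psq_ge0.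
apply/eqP; rewrite -mod_eq0 eq_le mod_ge0 andbT; apply/ler_addgt0Pr => e e0; rewrite add0r.
pose d := e / (8 * (B + 1)); have d0 : 0 < d by rewrite divr_gt0// mulr_gt0//; lra.
have dB : d * (4 * B) <= e / 2.
  have -> : e / 2 = d * (4 * (B + 1)) by rewrite /d; field; rewrite gt_eqF//; lra.
  by apply: ler_wpM2l; [exact: ltW|lra].
have e4 : 0 < d * (e / 4) by rewrite mulr_gt0// divr_gt0.
have [N hN] := sqn_approx hg e4.
have tg : d^-1 * tail g N <= e / 4.
  by rewrite mulrC ler_pdivrMr// mulrC lerBlDr -lerBlDl hN.
pose K := \sum_(0 <= k < N) modulus (taylor g k) + 1.
have K1 : 0 < K by rewrite ltr_wpDl// sumr_ge0// => k _; exact: mod_ge0.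
have eK : 0 < e / 4 / K by rewrite divr_gt0// divr_gt0.
have [n hn] := ultra_nonempty (ultra_forall N (fun k => uF k _ eK)).
pose G z := - 1 * F n z + f z.
have hG : H2 G by exact: H2_lin.
have GB : sqn G <= 4 * B.
  apply: (le_trans (sqn_lin_le (-1) (hF n) hf ltr01)); rewrite modN mod1 invr1 expr1n mulr1.
  have := sqn_le (hB n); have := sqn_le fB; lra.
have -> : hardy_inner f g = hardy_inner G g by rewrite hardy_inner_lin// F0 mulr0 add0r.
have [_ /(_ d N d0)] := hardy_innerP hG hg.
have cG : modulus (cps G g N) <= e / 4.
  rewrite /cps; apply: (le_trans (mod_sum _ _ _)).
  apply: (@le_trans _ _ (\sum_(0 <= k < N) (e / 4 / K) * modulus (taylor g k))).
    rewrite !big_nat; apply: ler_sum => k /andP[_ kN]; rewrite [modulus (_ * _)]modM modJ.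
    apply: ler_wpM2r; first exact: mod_ge0.
    rewrite taylor_lin; [|by case: (hF n)|by case: hf].
    by have := hn k kN; rewrite /= mulN1r mod_distC addrC => /ltW.
  rewrite -big_distrr /= mulrC mulrA ler_pdivrMr// mulrC; apply: ler_wpM2l; first by rewrite ltW// divr_gt0.
  by rewrite lerDl.
have tG : tail G N <= 4 * B by rewrite /tail; have := psq_ge0 G N; lra.
have := mod_sub_ge (hardy_inner G g) (cps G g N); have := ler_wpM2l (ltW d0) tG.
move: (d * tail _ _) (d^-1 * _) (modulus _) (modulus _) (modulus _) cG dB tg => a b c x y; lra.
Qed.

End WeakLimits.

(** * The composition operator on H^2 *)

Section CompositionHardy.
Context {R : realType} (phi : cplx R -> cplx R).
Hypothesis sphi : analytic_self_map phi.
Local Notation C := (cplx R).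
Implicit Types (z w : C) (f g h : C -> C) (F : nat -> C -> C) (r e d t : R) (N M k n j : nat).

Hypothesis decay : forall j, exists2 K : R, 0 <= K & forall n r, 0 <= r < 1 ->
  rmean 0 (fun z => modulus (phi (rc r * z)) ^+ (2 * n)) <= K / n.+1%:R ^+ j.+1.

Local Notation T := (composition_operator phi).

Lemma hol_disk_composition f : hol_disk f -> hol_disk (T f).
Proof.
move=> hf z z1; apply: (@hol_comp _ phi f); first exact: self_map_hol.
apply: hf; exact: self_map_lt.
Qed.

(** Telescoping: [1 / (k + 1) ^ 2 <= 2 / (k + 1) - 2 / (k + 2)]. *)
Lemma inv_square_sum N M : (N <= M)%N -> \sum_(N <= k < M) (k.+1%:R ^+ 2)^-1 <= 2 / N.+1%:R :> R.
Proof.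
move=> NM; suff : \sum_(N <= k < M) (k.+1%:R ^+ 2)^-1 <= 2 / N.+1%:R - 2 / M.+1%:R :> R.
  by move=> h; apply: (le_trans h); rewrite lerBlDr lerDl divr_ge0.
rewrite -(subnKC NM); elim: (M - N)%N => [|n IH]; first by rewrite addn0 big_geq// subrr.
rewrite addnS big_nat_recr ?leq_addr//=; apply: (le_trans (lerD IH (lexx _))).
have m1 : 1 <= (N + n).+1%:R :> R by rewrite ler1n.
rewrite -addrA lerD2l -[(N + n).+2%:R]natr1; move: ((N + n).+1%:R) m1 => m m1.
have m0 : 0 < m by lra.
rewrite -subr_ge0 (_ : _ - _ = (m - 1) / (m ^+ 2 * (m + 1))); last first.
  by field; rewrite !gt_eqF// addr_gt0.
by apply: divr_ge0; [lra|apply: mulr_ge0; [exact: sqr_ge0|lra]].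
Qed.

(* With u = |phi|^2, point_estimate bounds |f o phi|^2 by B u^N / (1 - u), the
   sum of the geometric series whose terms have mean controlled by D. *)
Lemma composition_sq_le f (B D : R) N : hol_disk f -> sq_le f B ->
  (forall k, (k < N)%N -> taylor f k = 0) ->
  (forall r M, 0 <= r < 1 -> (N <= M)%N ->
     \sum_(N <= k < M) rmean 0 (fun z => modulus (phi (rc r * z)) ^+ (2 * k)) <= D) ->
  sq_le (T f) (B * D).
Proof.
move=> hf hB f0 hD n; have B0 : 0 <= B by apply: le_trans (hB 0%N); exact: psq_ge0.
apply: hol_coef_sq_le; first exact: hol_disk_composition.
move=> r /andP[r0 r1]; have hr : 0 <= r < 1 by rewrite ltW.
have hp := self_map_hol sphi.
pose u z := modulus (phi (rc r * z)) ^+ 2.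
have p1 z : modulus z = 1 -> modulus (phi (rc r * z)) < 1.
  by move=> hz; apply: (self_map_lt sphi); rewrite modM hz mulr1 mod_rc ger0_norm// ltW.
have u1 z : modulus z = 1 -> 0 <= u z < 1.
  by move=> /p1 h; rewrite sqr_ge0 /u expr_lt1// mod_ge0.
have cu : circ_cont (fun z => rc (u z)) by apply: circ_cont_modX; exact: hol_disk_circ.
have n0 z : modulus z = 1 -> 1 - rc (u z) != 0.
  by move=> /u1 h; rewrite -rc1 -(rcB 1) rc_neq0 subr_eq0; apply/eqP => e; move: h; rewrite -e ltxx andbF.
have ci : circ_cont (fun z => (1 - rc (u z))^-1).
  move=> z hz; apply: (@ccont_comp _ (fun z => 1 - rc (u z)) (fun w => w^-1)).
    by apply: ccontB; [exact: ccont_cst|exact: cu].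
  exact/ccontV/n0.
have cX k : circ_cont (fun z => rc (u z ^+ k)).
  rewrite (_ : (fun z => _) = (fun z => rc (u z) ^+ k)); last by apply/funext => z; rewrite rcX.
  by move=> z hz; apply: ccontX; exact: cu.
have cq k : circ_cont (fun z => rc (u z ^+ k / (1 - u z))).
  rewrite (_ : (fun z => _) = (fun z => rc (u z ^+ k) * (1 - rc (u z))^-1)); first exact: circ_contM.
  by apply/funext => z; rewrite (rcM _ (_^-1)) rcV (rcB 1).
have step k : rmean 0 (fun z => u z ^+ k / (1 - u z)) =
    rmean 0 (fun z => modulus (phi (rc r * z)) ^+ (2 * k)) + rmean 0 (fun z => u z ^+ k.+1 / (1 - u z)).
  rewrite (@eq_rmean _ 0 (fun z => modulus _ ^+ (2 * k)) (fun z => u z ^+ k)); last first.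
    by move=> z _; rewrite exprM.
  rewrite -rmeanD//; apply: eq_rmean => z /u1 /andP[a0 a1].
  by rewrite exprS; move: (_ ^+ k) => q; field; rewrite subr_eq0 gt_eqF.
have geom M : (N <= M)%N -> rmean 0 (fun z => u z ^+ N / (1 - u z)) =
    \sum_(N <= k < M) rmean 0 (fun z => modulus (phi (rc r * z)) ^+ (2 * k)) +
    rmean 0 (fun z => u z ^+ M / (1 - u z)).
  move=> NM; rewrite -(subnKC NM); elim: (M - N)%N => [|m IH].
    by rewrite addn0 big_geq// add0r.
  by rewrite addnS big_nat_recr ?leq_addr//= -addrA -step.
have [M0 M00 hM0] := circ_cont_bounded ci.
(* The remainder of the geometric series from [L] on is at most [M0], a bound of [1 / (1 - u)] on
   the circle, times the mean of [u ^ L], which [decay 0] sends to 0. *)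
have small : rmean 0 (fun z => u z ^+ N / (1 - u z)) <= D.
  apply/ler_addgt0Pr => e e0; have [K K0 hK] := decay 0.
  have [M hM] : exists M : nat, M0 * K / e < M.+1%:R.
    by exists (Num.truncn (M0 * K / e)); exact: truncnS_gt.
  pose L := maxn N M; rewrite (geom L (leq_maxl _ _)); apply: lerD; first exact: hD (leq_maxl _ _).
  apply: (@le_trans _ _ (M0 * (K / L.+1%:R))); last first.
    have h : M.+1%:R <= L.+1%:R :> R by rewrite ler_nat ltnS leq_maxr.
    rewrite mulrA ler_pdivrMr// [e * _]mulrC -ler_pdivrMr//; apply/ltW; exact: lt_le_trans h.
  have := hK L r hr; rewrite expr1 => /(ler_wpM2l M00); apply: le_trans.
  rewrite -rmeanZ; last first.
    rewrite (_ : (fun z => _) = (fun z => rc (u z ^+ L))); first exact: cX.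
    by apply/funext => z; rewrite exprM.
  apply: le_rmean => //.
    rewrite (_ : (fun z => _) = (fun z => rc M0 * rc (u z ^+ L))); last first.
      by apply/funext => z; rewrite -rcM exprM.
    by apply: circ_contM; [exact: circ_cont_cst|].
  move=> z hz; have /andP[a0 a1] := u1 z hz; rewrite exprM -/(u z) mulrC.
  apply: ler_wpM2r; first exact: exprn_ge0.
  have := hM0 z hz; rewrite modV -rc1 -(rcB 1) mod_rc ger0_norm// subr_ge0 ltW//.
apply: (@le_trans _ _ (B * rmean 0 (fun z => u z ^+ N / (1 - u z)))); last exact: ler_wpM2l.
rewrite -rmeanZ//; apply: le_rmean.
- by apply: circ_cont_modX; apply: hol_disk_circ => //; exact: hol_disk_composition.
- rewrite (_ : (fun z => _) = (fun z => rc B * rc (u z ^+ N / (1 - u z)))); last first.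
    by apply/funext => z; rewrite -rcM.
  by apply: circ_contM; [exact: circ_cont_cst|].
by move=> z hz; exact: (point_estimate hf hB f0 (p1 z hz)).
Qed.

Lemma composition_tail j : exists2 K : R, 0 <= K & forall f (B : R) N, hol_disk f -> sq_le f B ->
  (forall k, (k < N)%N -> taylor f k = 0) -> sq_le (T f) (B * (K / N.+1%:R ^+ j.+1)).
Proof.
(* The exponent of the decay is [j + 3]: two units make the series converge and [j + 1] give the
   rate. *)
have [K K0 hK] := decay j.+2; exists (2 * K); first exact: mulr_ge0.
move=> f B N hf hB f0; apply: (composition_sq_le hf hB f0) => r M hr NM.
apply: (@le_trans _ _ (\sum_(N <= k < M) K / N.+1%:R ^+ j.+1 * (k.+1%:R ^+ 2)^-1)).
  rewrite !big_nat; apply: ler_sum => k /andP[Nk _]; apply: (le_trans (hK k r hr)).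
  rewrite -mulrA; apply: ler_wpM2l => //.
  have -> : k.+1%:R ^+ j.+3 = k.+1%:R ^+ j.+1 * k.+1%:R ^+ 2 :> R by rewrite -exprD addn2.
  rewrite -invfM lef_pV2 ?posrE ?mulr_gt0 ?exprn_gt0//.
  apply: ler_wpM2r; first exact: sqr_ge0.
  by apply: lerXn2r; rewrite ?nnegrE// ler_nat ltnS.
have kn : 0 <= K / N.+1%:R ^+ j.+1 by rewrite divr_ge0// exprn_ge0.
rewrite -big_distrr /=; apply: (le_trans (ler_wpM2l kn (inv_square_sum NM))).
rewrite -[2 * K / _]mulrA mulrC; move: (K / _) kn => q q0.
rewrite mulrAC ler_pdivrMr//; apply: ler_peMr; first exact: mulr_ge0.
by rewrite ler1n.
Qed.

Lemma composition_bounded : exists2 K : R, 0 <= K &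
  forall f, H2 f -> H2 (T f) /\ sqn (T f) <= K * sqn f.
Proof.
have [K K0 hK] := composition_tail 0; exists K => // f hf; have [df _] := hf.
have h : sq_le (T f) (K * sqn f).
  by have := hK f (sqn f) 0%N df (sqn_sq_le hf) _; rewrite expr1n divr1 mulrC; apply.
by split; [split; [exact: hol_disk_composition|exists (K * sqn f)]|exact: sqn_le].
Qed.

(** The Taylor polynomial with the first [N] coefficients is uniformly small on the disk, hence so
    is its composition with [phi]; on the rest, [composition_tail] gains [1 / (N + 1)] for all [n]
    at once. *)
Lemma composition_weak_strong F (B : R) : (forall n, hol_disk (F n)) -> (forall n, sq_le (F n) B) ->
  (forall k, uconv (fun n => taylor (F n) k) 0) ->
  forall e, 0 < e -> free_ultra [set n | sq_le (T (F n)) e].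
Proof.
move=> hF hB u0 e e0; have B0 : 0 <= B by apply: le_trans (hB 0%N 0%N); exact: psq_ge0.
have [K K0 hK] := composition_tail 0.
have [N hN] : exists N : nat, 4 * B * K / e < N.+1%:R.
  by exists (Num.truncn (4 * B * K / e)); exact: truncnS_gt.
pose d := Num.sqrt (e / 4) / N.+1%:R.
have d0 : 0 < d by rewrite divr_gt0// sqrtr_gt0 divr_gt0.
apply: ultraS (ultra_forall N (fun k => u0 k d d0)) => n hn /=.
pose p := fpoly (taylor (F n)) N; pose h z := - 1 * p z + F n z.
have [hp _] := H2_fpoly (taylor (F n)) N.
have hh : hol_disk h by exact: hol_disk_lin.
have th k : taylor h k = if (k < N)%N then 0 else taylor (F n) k.
  by rewrite taylor_lin// taylor_fpoly; case: ifP => _; rewrite ?mulr0 ?add0r// mulN1r addNr.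
have hBh : sq_le h B.
  move=> M; apply: le_trans (hB n M); apply: ler_sum => k _; rewrite th.
  by case: ifP => // _; rewrite mod0 expr0n sqr_ge0.
have Th : sq_le (T h) (e / 4).
  move=> M; have := hK h B N hh hBh _ M; rewrite expr1 => /(_ _)/le_trans; apply.
    by move=> k kN; rewrite th kN.
  rewrite mulrA ler_pdivrMr//; move: hN; rewrite ltr_pdivrMr// mulrC => hN.
  by move: hN; move: (N.+1%:R) => m; clear; lra.
have Tp : sq_le (T p) (e / 4).
  have -> : e / 4 = Num.sqrt (e / 4) ^+ 2 by rewrite sqr_sqrtr// divr_ge0// ltW.
  apply: bounded_sq_le; first exact: hol_disk_composition.
  move=> z z1; rewrite /composition_operator /p /fpoly; apply: (le_trans (mod_sum _ _ _)).
  apply: (@le_trans _ _ (\sum_(0 <= k < N) d)).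
    rewrite !big_nat; apply: ler_sum => k /andP[_ kN]; rewrite [modulus (_ * _)]modM.
    apply: (@le_trans _ _ (modulus (taylor (F n) k) * 1)).
      by apply: ler_wpM2l; rewrite ?mod_ge0// modX exprn_ile1 ?mod_ge0//; exact/ltW/(self_map_lt sphi).
    by rewrite mulr1; have := hn k kN; rewrite /= subr0 => /ltW.
  rewrite sumr_const_nat subn0 -[leLHS]mulr_natr /d; move: (sqrtr_ge0 (e / 4)); move: (Num.sqrt _) => s s0.
  by rewrite mulrAC ler_pdivrMr//; apply: ler_wpM2l => //; rewrite ler_nat.
have := sq_le_lin 1 (hol_disk_composition hp) (hol_disk_composition hh) ltr01 Tp Th.
have -> : (fun z => 1 * T p z + T h z) = T (F n).
  by apply/funext => z; rewrite /composition_operator /h mul1r mulN1r addrA subrr add0r.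
move=> le M; apply: (le_trans (le M)); rewrite mod1 invr1 expr1n; lra.
Qed.

Lemma composition_compact : compact_operator (hardy_space 2) (hardy_norm 2) T.
Proof.
have [K K0 hK] := composition_bounded.
split=> [f /hardy_space2/hK[/hardy_space2]//|//|F hF].
have HF n : H2 (F n) by apply/hardy_space2; case: (hF n).
have BF n : sq_le (F n) 1.
  by have := @hardy_norm2_ge _ (F n) 1 (proj1 (HF n)) (proj2 (hF n)); rewrite expr1n.
have [f [df fB uf]] := weak_limit (fun n => proj1 (HF n)) BF.
have hf : H2 f by split => //; exists 1.
pose G n z := - 1 * f z + F n z.
have hG n : hol_disk (G n) by apply: hol_disk_lin => //; case: (HF n).
have BG n : sq_le (G n) 4.
  move=> M; have := sq_le_lin (-1) df (proj1 (HF n)) ltr01 fB (BF n) M.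
  by rewrite modN mod1 invr1 expr1n; move: (psq _ _) => x; lra.
have uG k : uconv (fun n => taylor (G n) k) 0.
  move=> e /(uf k); apply: ultraS => n /=; rewrite taylor_lin//; last by case: (HF n).
  by rewrite mulN1r subr0 addrC.
have near m n : exists i, (m < i)%N /\ sq_le (T (G i)) (n.+1%:R^-1 ^+ 2).
  have e0 : 0 < n.+1%:R^-1 ^+ 2 :> R by rewrite exprn_gt0// invr_gt0.
  have [i [/= h1 h2]] := ultra_nonempty (ultraI (ultra_ge m.+1) (composition_weak_strong hG BG uG e0)).
  by exists i.
have [c hc] := choice (fun mn : nat * nat => near mn.1 mn.2).
(* Passage from the ultrafilter to a subsequence: each index exceeds the previous one and makes the
   error at most [1 / (n + 1)]. *)
pose k := fix k n := if n is n'.+1 then c (k n', n) else c (0%N, 0%N).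
have kS n : k n.+1 = c (k n, n.+1) by [].
have k1 n : (k n < k n.+1)%N by rewrite kS; have [] := hc (k n, n.+1).
have k2 n : sq_le (T (G (k n))) (n.+1%:R^-1 ^+ 2).
  by case: n => [|n]; [have [] := hc (0%N, 0%N)|rewrite kS; have [] := hc (k n, n.+1)].
exists k; first by apply: homo_ltn => //; exact: ltn_trans.
exists (T f); first by apply/hardy_space2; have [] := hK f hf.
have E n : (fun z => T (F (k n)) z - T f z) = T (G (k n)).
  by apply/funext => z; rewrite /composition_operator /G mulN1r addrC.
have cv : (n.+1%:R^-1)%:E @[n --> \oo] --> (0 : R)%:E.
  by apply: cvg_EFin; [exact: nearW|exact: cvg_harmonic].
apply: (squeeze_cvge _ (cvg_cst 0%E) cv); apply: nearW => n; rewrite E /hardy_norm poweR_ge0 /=.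
by apply: hardy_norm2_le => //; exact: hol_disk_composition.
Qed.

End CompositionHardy.

(** * Dimension counts and orthogonal vectors *)

Section OrthogonalFamilies.
Context {R : realType}.
Local Notation C := (cplx R).
Implicit Types (z w : C) (f g h u : C -> C) (e : nat -> C -> C) (c : nat -> C) (N M k n i j : nat).

(** Used both for a polynomial orthogonal to [n] given vectors and for a combination of [n + 1]
    eigenvectors with vanishing first coefficients. *)
Lemma kernel_vector n (A : nat -> nat -> C) : exists c, (exists2 i, (i < n.+1)%N & c i != 0) /\
  forall j, (j < n)%N -> \sum_(0 <= i < n.+1) c i * A i j = 0.
Proof.
pose M : 'M[R[i]]_(n.+1, n) := \matrix_(i < n.+1, j < n) (A i j : R[i]).
have /rowV0Pn[v /sub_kermxP vM v0] : kermx M != 0.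
  by rewrite -mxrank_eq0 mxrank_ker subn_eq0 -ltnNge ltnS rank_leq_col.
exists (fun i => (v 0 (inord i) : C)); split.
  have [i vi] : exists i : 'I_n.+1, v 0 i != 0.
    apply: contrapT => h; move/eqP: v0; apply; apply/rowP => i; rewrite mxE; apply/eqP.
    by apply: contrapT => vi; apply: h; exists i; apply/negP.
  by exists i; rewrite ?inord_val.
move=> j jn; have := congr1 (fun B : 'rV_n => B 0 (Ordinal jn)) vM.
rewrite !mxE big_mkord => s; rewrite -[RHS]s; apply: eq_bigr => i _.
by rewrite mxE inord_val.
Qed.

Lemma H2_power i : H2 (fun z : C => z ^+ i).
Proof.
have -> : (fun z : C => z ^+ i) = fpoly (fun k => (k == i)%:R) i.+1; last exact: H2_fpoly.
apply/funext => z; rewrite /fpoly big_nat_recr//= eqxx mul1r big_nat big1 ?add0r// => k /andP[_ ki].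
by rewrite ltn_eqF// mul0r.
Qed.

Lemma sqn0 : sqn (fun=> 0 : C) = 0.
Proof. by apply: rc_inj; rewrite -hardy_inner_sqn ?hardy_inner0l//; exact: H2_cst0. Qed.

Lemma scale_addr0 (a : C) f : (fun z => a * f z) = (fun z => a * f z + (fun=> 0) z).
Proof. by apply/funext => z; rewrite addr0. Qed.

Lemma H2_scale (a : C) f : H2 f -> H2 (fun z => a * f z).
Proof. by move=> hf; rewrite scale_addr0; exact: H2_lin H2_cst0. Qed.

Lemma sqn_scale (a : C) f : H2 f -> sqn (fun z => a * f z) = modulus a ^+ 2 * sqn f.
Proof.
move=> hf; rewrite scale_addr0 (sqn_lin_expand a hf H2_cst0).
have -> : hardy_inner f (fun=> 0) = 0.
  rewrite (hardy_inner_conj H2_cst0 hf) hardy_inner0l//; exact: (conj_rc 0).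
by rewrite sqn0 mulr0 mulr0 !addr0.
Qed.

Lemma hardy_inner_scale (a : C) f g : H2 f -> H2 g -> hardy_inner (fun z => a * f z) g = a * hardy_inner f g.
Proof.
move=> hf hg; rewrite scale_addr0 (hardy_inner_lin a hf H2_cst0 hg).
by rewrite hardy_inner0l// addr0.
Qed.

Lemma taylor_sum c (F : nat -> C -> C) N k : (forall i, (i < N)%N -> H2 (F i)) ->
  taylor (fun z => \sum_(0 <= i < N) c i * F i z) k = \sum_(0 <= i < N) c i * taylor (F i) k.
Proof.
elim: N => [|N IH] hF.
  rewrite big_nil (_ : (fun z => _) = fpoly (fun=> 0) 0) ?taylor_fpoly//.
  by apply/funext => z; rewrite /fpoly !big_nil.
have hF' i : (i < N)%N -> H2 (F i) by move=> iN; exact/hF/ltnW.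
rewrite [RHS]big_nat_recr//= -IH//.
have -> : (fun z => \sum_(0 <= i < N.+1) c i * F i z) =
    (fun z => c N * F N z + \sum_(0 <= i < N) c i * F i z).
  by apply/funext => z; rewrite big_nat_recr//= addrC.
by rewrite taylor_lin; [exact: addrC|case: (hF N (ltnSn N))|case: (H2_sum c hF')].
Qed.

Definition orthogonal_to e n f : Prop := forall i, (i < n)%N -> hardy_inner f (e i) = 0.

Lemma normalize f : H2 f -> 0 < sqn f -> exists2 a : C, modulus a ^+ 2 = (sqn f)^-1 & sqn (fun z => a * f z) = 1.
Proof.
move=> hf f0; have E : modulus (rc (Num.sqrt (sqn f))^-1) ^+ 2 = (sqn f)^-1.
  by rewrite mod_rc real_normK ?num_real// exprVn sqr_sqrtr// ltW.
by exists (rc (Num.sqrt (sqn f))^-1) => //; rewrite sqn_scale// E mulVf// gt_eqF.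
Qed.

(** Such a vector exists among the polynomials of degree at most [n]. Thus the successive choice of
    eigenvectors never stops, even where the operator vanishes on the orthogonal complement. *)
Lemma unit_orthogonal e n : (forall i, (i < n)%N -> H2 (e i)) ->
  exists u, [/\ H2 u, orthogonal_to e n u & sqn u = 1].
Proof.
move=> he; have [c [[i0 i0n c0] hc]] := kernel_vector n (fun i j => hardy_inner (fun z => z ^+ i) (e j)).
pose f := fpoly c n.+1; have hf : H2 f by exact: H2_fpoly.
have of_ : orthogonal_to e n f.
  by move=> j jn; rewrite -[RHS](hc j jn) -(hardy_inner_sum c (fun i _ => H2_power i) (he j jn)).
have f0 : 0 < sqn f.
  apply: (lt_le_trans _ (sqn_ub i0.+1 hf)); rewrite psqS taylor_fpoly i0n.
  by rewrite ltr_wpDl ?psq_ge0// exprn_gt0// mod_gt0.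
have [a _ a1] := normalize hf f0.
exists (fun z => a * f z); split; [exact: H2_scale| |exact: a1].
by move=> j jn; rewrite (hardy_inner_scale a hf (he j jn)) of_// mulr0.
Qed.

End OrthogonalFamilies.

(** * Vectors at which the norm is attained *)

Section Maximizer.
Context {R : realType} (phi : cplx R -> cplx R).
Hypothesis sphi : analytic_self_map phi.
Local Notation C := (cplx R).
Implicit Types (z w : C) (f g h u : C -> C) (e : nat -> C -> C) (N M k n i j : nat).

Hypothesis decay : forall j, exists2 K : R, 0 <= K & forall n r, 0 <= r < 1 ->
  rmean 0 (fun z => modulus (phi (rc r * z)) ^+ (2 * n)) <= K / n.+1%:R ^+ j.+1.

Local Notation T := (composition_operator phi).

Lemma H2_composition f : H2 f -> H2 (T f).
Proof. by move=> hf; have [K _ /(_ f hf)[]] := composition_bounded sphi decay. Qed.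

(** A maximizing sequence has a weak limit [f], orthogonal to the given vectors by
    [hardy_inner_weak0]; [composition_weak_strong] makes the images converge in norm, so the
    supremum is attained at [f]. *)
Lemma maximizer_ex e n : (forall i, (i < n)%N -> H2 (e i)) ->
  exists u, [/\ H2 u, orthogonal_to e n u, sqn u = 1 &
    forall f, H2 f -> orthogonal_to e n f -> sqn (T f) <= sqn (T u) * sqn f].
Proof.
move=> he; have [u0 [hu0 ou0 u01]] := unit_orthogonal he.
have [K K0 hK] := composition_bounded sphi decay.
pose W f := H2 f /\ orthogonal_to e n f.
pose S := [set sqn (T f) | f in [set f | W f /\ sqn f <= 1]].
have Sub f : W f -> sqn f <= 1 -> sqn (T f) <= sup S.
  move=> hf f1; apply: ub_le_sup; last by exists f.
  exists K => _ [g [[hg _] g1] <-]; have [_ h] := hK g hg; apply: (le_trans h).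
  by rewrite ler_piMr.
have scale f : W f -> sqn (T f) <= sup S * sqn f.
  move=> [hf of_]; have := sqn_ge0 hf; rewrite le_eqVlt => /predU1P[f0|f0].
    by have [_] := hK f hf; rewrite -f0 !mulr0.
  have [a aE a1] := normalize hf f0.
  have := @Sub (fun z => a * f z); rewrite a1 => /(_ _ (lexx 1)).
  have -> : sqn (T (fun z => a * f z)) = (sqn f)^-1 * sqn (T f).
    by rewrite -aE -(sqn_scale a (H2_composition hf)).
  rewrite ler_pdivrMl// mulrC; apply; split; first exact: H2_scale.
  by move=> j jn; rewrite hardy_inner_scale ?of_ ?mulr0//; exact: he.
(* Here the operator vanishes on the orthogonal complement, and any unit vector of it is a
   maximizer. *)
have [s0|s0] := leP (sup S) 0.
  exists u0; split => // f hf of_; apply: (le_trans (scale f (conj hf of_))).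
  apply: (@le_trans _ _ 0).
    exact: mulr_le0_ge0 s0 (sqn_ge0 hf).
  exact: mulr_ge0 (sqn_ge0 (H2_composition hu0)) (sqn_ge0 hf).
have hS : has_sup S.
  split; first by exists (sqn (T u0)), u0 => //; split; [split|rewrite u01].
  exists K => _ [g [[hg _] g1] <-]; have [_ h] := hK g hg; apply: (le_trans h).
  by rewrite ler_piMr.
have ex m : exists f, W f /\ sqn f <= 1 /\ sup S - m.+1%:R^-1 < sqn (T f).
  have m0 : 0 < m.+1%:R^-1 :> R by rewrite invr_gt0.
  by have [_ [f [Wf f1] <-] h] := sup_adherent m0 hS; exists f.
have [F hF] := choice ex.
have HF m : H2 (F m) by have [[]] := hF m.
have BF m : sq_le (F m) 1 by move=> N; apply: le_trans (sqn_ub N (HF m)) _; have [_ []] := hF m.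
have [f [df fB uf]] := weak_limit (fun m => proj1 (HF m)) BF.
have hf : H2 f by split => //; exists 1.
have of_ : orthogonal_to e n f.
  move=> j jn; apply: (hardy_inner_weak0 HF BF hf (he j jn) fB uf) => m.
  by have [[_ om] _] := hF m; exact: om.
pose G m z := - 1 * f z + F m z.
have hG m : H2 (G m) by exact: H2_lin.
have BG m : sq_le (G m) 4.
  move=> M; have := sq_le_lin (-1) df (proj1 (HF m)) ltr01 fB (BF m) M.
  by rewrite modN mod1 invr1 expr1n; move: (psq _ _) => x; lra.
have uG k : uconv (fun m => taylor (G m) k) 0.
  move=> d /(uf k); apply: ultraS => m /=; rewrite taylor_lin//; last by case: (HF m).
  by rewrite mulN1r subr0 addrC.
have sT : sup S <= sqn (T f).
  apply/ler_addgt0Pr => d d0.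
  have hTf := H2_composition hf; have Tf0 := sqn_ge0 hTf.
  (* A small weight on [sqn (T f)] in [sqn_lin_le]; the large factor [1 + del^-1] falls on
     [sqn (T (G m))], which tends to 0 along the ultrafilter. *)
  pose del := d / (3 * (sqn (T f) + 1)).
  have del0 : 0 < del by rewrite divr_gt0// mulr_gt0// ltr_wpDl.
  have deld : del * sqn (T f) <= d / 3.
    have -> : d / 3 = del * (sqn (T f) + 1) by rewrite /del; field; rewrite gt_eqF// ltr_wpDl.
    by apply: ler_wpM2l; [exact: ltW|rewrite lerDl].
  have di : 0 < 1 + del^-1 by rewrite addr_gt0// invr_gt0.
  have eta0 : 0 < d / 3 / (1 + del^-1) by rewrite divr_gt0// divr_gt0.
  have [M hM] : exists M : nat, 3 / d < M.+1%:R.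
    by exists (Num.truncn (3 / d)); exact: truncnS_gt.
  have [m [/= h1 h2]] := ultra_nonempty (ultraI (ultra_ge M)
    (composition_weak_strong sphi decay (fun m => proj1 (hG m)) BG uG eta0)).
  have [_ [_ big]] := hF m.
  have m3 : m.+1%:R^-1 <= d / 3.
    rewrite -[leRHS]invf_div lef_pV2 ?posrE ?divr_gt0//; apply: (le_trans (ltW hM)).
    by rewrite ler_nat ltnS.
  have := sqn_lin_le 1 hTf (H2_composition (hG m)) del0.
  have -> : (fun z => 1 * T f z + T (G m) z) = T (F m).
    by apply/funext => z; rewrite /composition_operator /G mul1r mulN1r addrA subrr add0r.
  rewrite mod1 expr1n mulr1 mulrDl mul1r.
  have := ler_wpM2l (ltW di) (sqn_le h2); rewrite mulrCA divff ?mulr1 ?gt_eqF//.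
  have arith (S' x y w v p q : R) : S' - x < v -> x <= d / 3 -> w <= d / 3 ->
      q <= d / 3 -> v <= p + w + q -> S' <= p + d by clear; lra.
  by move=> q1 q2; exact: arith big m3 deld q1 q2.
(* A weak limit could have lost norm, but [sup S <= sqn (T f) <= sup S * sqn f] with [sup S > 0]
   excludes it. *)
have f1 : sqn f = 1.
  apply/eqP; rewrite eq_le (sqn_le fB) /= -(ler_pM2l s0) mulr1.
  exact: (le_trans sT (scale f (conj hf of_))).
exists f; split => // g hg og; apply: (le_trans (scale g (conj hg og))).
exact: ler_wpM2r (sqn_ge0 hg) _ _ sT.
Qed.

End Maximizer.

(** * Singular numbers of the composition operator *)

Section SingularNumbers.
Context {R : realType} (phi : cplx R -> cplx R).
Hypothesis sphi : analytic_self_map phi.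
Local Notation C := (cplx R).
Implicit Types (z w : C) (f g h u : C -> C) (e : nat -> C -> C) (N M k n i j : nat).

Hypothesis decay : forall j, exists2 K : R, 0 <= K & forall n r, 0 <= r < 1 ->
  rmean 0 (fun z => modulus (phi (rc r * z)) ^+ (2 * n)) <= K / n.+1%:R ^+ j.+1.

Local Notation T := (composition_operator phi).
Let HT := H2_composition sphi decay.

Definition maximizing_sequence e : Prop := forall n, [/\ H2 (e n), orthogonal_to e n (e n), sqn (e n) = 1 &
  forall f, H2 f -> orthogonal_to e n f -> sqn (T f) <= sqn (T (e n)) * sqn f].

Lemma maximizing_sequence_ex : exists e, maximizing_sequence e.
Proof.
have ex (p : nat * (nat -> C -> C)) : exists u, (forall i, (i < p.1)%N -> H2 (p.2 i)) ->
    [/\ H2 u, orthogonal_to p.2 p.1 u, sqn u = 1 &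
      forall f, H2 f -> orthogonal_to p.2 p.1 f -> sqn (T f) <= sqn (T u) * sqn f].
  have [h|h] := pselect (forall i, (i < p.1)%N -> H2 (p.2 i)); last by exists (p.2 0%N).
  by have [u hu] := maximizer_ex sphi decay h; exists u.
have [pick hpick] := choice ex.
(* The table [pre n] holds the first [n] vectors, so that course-of-values recursion becomes plain
   recursion; [pick] is total, its specification being conditional on the table lying in H^2. *)
pose pre := fix pre n : nat -> C -> C :=
  if n is n'.+1 then fun i => if i == n' then pick (n', pre n') else pre n' i else fun=> fun=> 0.
pose e n := pick (n, pre n).
have preE n i : (i < n)%N -> pre n i = e i.
  elim: n => // n IH; rewrite ltnS leq_eqVlt /= => /orP[/eqP ->|ltin]; first by rewrite eqxx.
  by rewrite ltn_eqF// IH.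
have oE n f : orthogonal_to (pre n) n f <-> orthogonal_to e n f.
  by split=> h i ltin; have := h i ltin; rewrite preE.
have HE n : H2 (e n).
  elim/ltn_ind: n => n IH; have [] // := hpick (n, pre n) => i /= ltin; rewrite preE//; exact: IH.
exists e => n; have hn i : (i < n)%N -> H2 (pre n i) by move=> ltin; rewrite preE.
have [h1 h2 h3 h4] : [/\ H2 (e n), orthogonal_to (pre n) n (e n), sqn (e n) = 1 &
  forall f, H2 f -> orthogonal_to (pre n) n f -> sqn (T f) <= sqn (T (e n)) * sqn f] := hpick (n, pre n) hn.
split; first exact: h1.
- by apply (proj1 (oE n (e n))).
- exact: h3.
- by move=> f hf of_; exact: (h4 f hf (proj2 (oE n f) of_)).
Qed.

(** If [beta] is not 0, taking [a = - (q + 1) conj beta / |beta|^2] makes the expression equal to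
    [- q - 2]. *)
Lemma quadratic_vanish (beta : C) (q : R) : 0 <= q ->
  (forall a : C, 0 <= 2 * complex.Re (a * beta) + q) -> beta = 0.
Proof.
move=> q0 h; apply/eqP; rewrite -mod_eq0; apply/negP => /negP m0.
have m2 : 0 < modulus beta ^+ 2 by rewrite exprn_gt0// lt_def m0 mod_ge0.
have := h (- (rc ((q + 1) / modulus beta ^+ 2) * conjc beta)).
rewrite mulNr -mulrA [conjc beta * beta]mulrC mulJ -rcM -rcN /= divfK ?gt_eqF//.
by move=> ?; lra.
Qed.

Lemma form_rearrange (x y m p q t : R) : m * t + 2 * y + q <= t * (m + 2 * x + p) ->
  0 <= 2 * (t * x - y) + (t * p - q).
Proof. lra. Qed.

Variable e : nat -> C -> C.
Hypothesis he : maximizing_sequence e.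

Let He n : H2 (e n). Proof. by case: (he n). Qed.
Let HTe n : H2 (T (e n)). Proof. exact: HT. Qed.

Lemma maximizing_orthonormal i j : hardy_inner (e i) (e j) = (i == j)%:R.
Proof.
have [_ oi i1 _] := he i; have [_ oj _ _] := he j.
have [ij|ji|<-] := ltngtP i j; last by rewrite hardy_inner_sqn// i1.
  by rewrite (hardy_inner_conj (He j) (He i)) oj//; exact: (conj_rc 0).
exact: oi.
Qed.

Lemma hardy_inner_combination (c : nat -> C) N i : (i < N)%N ->
  hardy_inner (fun z => \sum_(0 <= k < N) c k * e k z) (e i) = c i.
Proof.
move=> iN; rewrite hardy_inner_sum//.
rewrite big_mkord (bigD1 (Ordinal iN))//= maximizing_orthonormal eqxx mulr1 big1 ?addr0// => k ki.
rewrite maximizing_orthonormal (_ : (k == i :> nat) = false) ?mulr0//.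
by apply/negbTE; move: ki; rewrite -val_eqE.
Qed.

(* The form s^2 <x, y> - <T x, T y> is nonnegative on the orthogonal complement
   of the previous vectors and vanishes at (e n, e n), hence at (e n, g). *)
Lemma eigen_orthogonal n g : H2 g -> orthogonal_to e n g ->
  hardy_inner (T (e n)) (T g) = rc (sqn (T (e n))) * hardy_inner (e n) g.
Proof.
move=> hg og; have [_ on n1 mx] := he n; have hTg := HT hg.
apply/esym/eqP; rewrite -subr_eq0; apply/eqP.
pose s2 := sqn (T (e n)).
have q0 : 0 <= s2 * sqn g - sqn (T g) by rewrite subr_ge0; exact: mx.
apply: (quadratic_vanish q0) => a.
have := mx _ (H2_lin a (He n) hg).
have -> : T (fun z => a * e n z + g z) = (fun z => a * T (e n) z + T g z) by [].
rewrite (sqn_lin_expand a (He n) hg) (sqn_lin_expand a (HTe n) hTg) n1 mulr1 -/s2.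
rewrite mulrBr cReB mulrCA.
have -> : complex.Re (rc s2 * (a * hardy_inner (e n) g)) = s2 * complex.Re (a * hardy_inner (e n) g).
  by rewrite cReM /= mul0r subr0.
move=> mo; apply: form_rearrange; apply: mo => i ltin.
by rewrite (hardy_inner_lin a (He n) hg (He i)) on// og// mulr0 addr0.
Qed.

(** Write [g] as a combination [p] of [e 0, ..., e (n - 1)] plus a vector orthogonal to them. The
    latter is the case of [eigen_orthogonal]; for [p] both sides are 0, since [eigen_orthogonal] at
    [i < n], tested against [e n], makes [T (e i)] orthogonal to [T (e n)]. *)
Lemma eigen_equation n g : H2 g ->
  hardy_inner (T (e n)) (T g) = rc (sqn (T (e n))) * hardy_inner (e n) g.
Proof.
move=> hg; have hTg := HT hg; pose c i := hardy_inner g (e i).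
pose p z := \sum_(0 <= i < n) c i * e i z; have hp : H2 p by exact: H2_sum.
have hTp := HT hp; pose g' z := - 1 * p z + g z; have hg' : H2 g' by exact: H2_lin.
have og' : orthogonal_to e n g'.
  by move=> i ltin; rewrite (hardy_inner_lin (-1) hp hg (He i)) hardy_inner_combination// mulN1r addNr.
have oTp : hardy_inner (T (e n)) (T p) = 0.
  rewrite (hardy_inner_conj hTp (HTe n)).
  have -> : T p = (fun z => \sum_(0 <= i < n) c i * T (e i) z) by [].
  rewrite (hardy_inner_sum c (fun i _ => HTe i) (HTe n)) big_nat big1 => [|i /andP[_ ltin]].
    exact: (conj_rc 0).
  have oi : orthogonal_to e i (e n).
    by move=> k ki; rewrite maximizing_orthonormal gtn_eqF// (ltn_trans ki).
  rewrite (eigen_orthogonal (He n) oi).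
  by rewrite maximizing_orthonormal ltn_eqF// !mulr0.
have op : hardy_inner (e n) p = 0.
  rewrite (hardy_inner_conj hp (He n)) (hardy_inner_sum c (fun i _ => He i) (He n)).
  rewrite big_nat big1 => [|i /andP[_ ltin]]; first exact: (conj_rc 0).
  by rewrite maximizing_orthonormal ltn_eqF// mulr0.
have gE : g = (fun z => 1 * p z + g' z).
  by apply/funext => z; rewrite /g' mul1r mulN1r addrA subrr add0r.
have TgE : T g = (fun z => 1 * T p z + T g' z).
  by rewrite {1}gE.
rewrite TgE (hardy_inner_linr 1 hTp (HT hg') (HTe n)) oTp mulr0 add0r (eigen_orthogonal hg' og').
have -> : hardy_inner (e n) g = hardy_inner (e n) g' by rewrite {1}gE (hardy_inner_linr 1 hp hg' (He n)) op mulr0 add0r.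
by [].
Qed.

(* Some nonzero combination of e 0, ..., e n has its first n Taylor coefficients
   equal to 0. *)
Lemma maximum_le_tail n (D : R) : (forall f (B : R), hol_disk f -> sq_le f B ->
    (forall k, (k < n)%N -> taylor f k = 0) -> sq_le (T f) (B * D)) ->
  (forall i, (i <= n)%N -> sqn (T (e n)) <= sqn (T (e i))) -> sqn (T (e n)) <= D.
Proof.
move=> hD mono; have [c [[i0 i0n c0] hc]] := kernel_vector n (fun i k => taylor (e i) k).
pose f z := \sum_(0 <= i < n.+1) c i * e i z; have hf : H2 f by exact: H2_sum.
have fT k : (k < n)%N -> taylor f k = 0 by move=> kn; rewrite taylor_sum// hc.
have := sqn_le (hD f (sqn f) (proj1 hf) (sqn_sq_le hf) fT).
have hTf := HT hf.
have sf : sqn f = \sum_(0 <= i < n.+1) modulus (c i) ^+ 2.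
  apply: rc_inj; rewrite -hardy_inner_sqn// {1}/f (hardy_inner_sum c (fun i _ => He i) hf) rc_sum.
  rewrite !big_nat; apply: eq_bigr => i /andP[_ ltin].
  by rewrite (hardy_inner_conj hf (He i)) hardy_inner_combination// mulJ.
have sTf : sqn (T f) = \sum_(0 <= i < n.+1) sqn (T (e i)) * modulus (c i) ^+ 2.
  apply: rc_inj; rewrite -hardy_inner_sqn//.
  have {1}-> : T f = (fun z => \sum_(0 <= i < n.+1) c i * T (e i) z) by [].
  rewrite (hardy_inner_sum c (fun i _ => HTe i) hTf) rc_sum.
  rewrite !big_nat; apply: eq_bigr => i /andP[_ ltin].
  by rewrite eigen_equation// (hardy_inner_conj hf (He i)) hardy_inner_combination// mulrCA mulJ -rcM.
have f0 : 0 < sqn f.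
  rewrite sf (bigD1_seq i0) ?mem_index_iota ?iota_uniq//=.
  by rewrite ltr_pwDl ?exprn_gt0 ?mod_gt0// sumr_ge0// => i _; exact: sqr_ge0.
(* The images [T (e i)] are orthogonal, so [sqn (T f)] is a sum of [|c i|^2] with weights
   [sqn (T (e i))], of which the last is the smallest. *)
have low : sqn (T (e n)) * sqn f <= sqn (T f).
  have -> : sqn (T (e n)) * sqn f = \sum_(0 <= i < n.+1) sqn (T (e n)) * modulus (c i) ^+ 2.
    by rewrite sf mulr_sumr.
  rewrite [leRHS]sTf; apply: ler_sum_nat => i /andP[_ ltin].
  exact: ler_wpM2r (sqr_ge0 _) _ _ (mono i ltin).
by move=> h; rewrite -(ler_pM2r f0) [D * _]mulrC; exact: le_trans low h.
Qed.

Lemma sqn_maximum_decay : (forall n, 0 <= sqn (T (e n))) /\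
  (forall n, sqn (T (e n.+1)) <= sqn (T (e n))) /\
  forall j, exists2 K : R, 0 <= K & forall n, sqn (T (e n)) <= K / n.+1%:R ^+ j.+1.
Proof.
have mono n : sqn (T (e n.+1)) <= sqn (T (e n)).
  have [_ _ _ mx] := he n; have [hn on n1 _] := he n.+1.
  have := mx _ hn; rewrite n1 mulr1; apply => i ltin; apply: on; exact: ltnW.
split; first by move=> n; exact: sqn_ge0.
split => // j; have [K K0 hK] := composition_tail sphi decay j; exists K => // n.
apply: maximum_le_tail => [f B hf hB f0|i]; first exact: hK.
elim: n => [|n IH]; first by rewrite leqn0 => /eqP ->.
rewrite leq_eqVlt => /orP[/eqP ->//|]; rewrite ltnS => /IH; exact: le_trans.
Qed.

Lemma composition_singular_numbers : singular_numbers T (fun n => Num.sqrt (sqn (T (e n)))).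
Proof.
have [s0 [mono dec]] := sqn_maximum_decay.
split; first by move=> n; exact: sqrtr_ge0.
  by move=> n; rewrite ler_sqrt.
exists e; split.
- by move=> n; exact/hardy_space2.
- exact: maximizing_orthonormal.
- by move=> n g /hardy_space2 hg; rewrite eigen_equation// sqr_sqrtr.
move=> f /hardy_space2 hf of_ z z1; have hTf := HT hf.
apply: taylor0_eq0 => //; first by case: hTf.
have [K K0 hK] := dec 0%N.
(* Being orthogonal to all [e i], [f] competes in the maximum at every stage:
   [sqn (T f) <= sqn (T (e n)) * sqn f] for each [n], and the right side tends to 0. *)
have Tf0 : sqn (T f) <= 0.
  apply/ler_addgt0Pr => d d0; rewrite add0r.
  have [n hn] : exists n : nat, K * sqn f / d < n.+1%:R.
    by exists (Num.truncn (K * sqn f / d)); exact: truncnS_gt.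
  have [_ _ _ mx] := he n; apply: (le_trans (mx f hf _)); first by move=> i _; exact: of_.
  apply: (@le_trans _ _ (K / n.+1%:R * sqn f)).
    by apply: ler_wpM2r; [exact: sqn_ge0|have := hK n; rewrite expr1].
  by rewrite mulrAC ler_pdivrMr// [d * _]mulrC -ler_pdivrMr// ltW.
move=> k; apply/eqP; rewrite -mod_eq0 -sqrf_eq0 eq_le sqr_ge0 andbT.
apply: le_trans Tf0; apply: le_trans (sqn_ub k.+1 hTf).
by rewrite psqS lerDr psq_ge0.
Qed.

Lemma schatten_sum (p : R) : 0 < p ->
  (\sum_(0 <= n <oo) (Num.sqrt (sqn (T (e n))) `^ p)%:E < +oo)%E.
Proof.
move=> p0; have [s0 [_ dec]] := sqn_maximum_decay.
(* Then [(j + 1) p / 2 >= 2], so the [p]-th powers, that is the powers [p / 2] of [sqn (T (e n))],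
   are dominated by a multiple of [1 / (n + 1) ^ 2]. *)
pose j := Num.truncn (4 / p); have [K K0 hK] := dec j.
have jp : 2 <= j.+1%:R * (p / 2).
  have := truncnS_gt (4 / p); rewrite -/j ltr_pdivrMr//; lra.
have p2 : 0 <= p / 2 by rewrite divr_ge0// ltW.
pose Q := K `^ (p / 2); have Q0 : 0 <= Q by exact: powR_ge0.
have term n : Num.sqrt (sqn (T (e n))) `^ p <= Q * (n.+1%:R ^+ 2)^-1.
  have -> : Num.sqrt (sqn (T (e n))) `^ p = sqn (T (e n)) `^ (p / 2).
    rewrite -[in RHS](sqr_sqrtr (s0 n)) -powR_mulrn ?sqrtr_ge0// -powRrM.
    by congr (_ `^ _); field.
  have n0 : 0 <= n.+1%:R^-1 :> R by rewrite invr_ge0.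
  apply: (@le_trans _ _ ((K / n.+1%:R ^+ j.+1) `^ (p / 2))).
    by apply: ge0_ler_powR => //; rewrite ?nnegrE// divr_ge0// exprn_ge0.
  rewrite -exprVn powRM ?exprn_ge0//; apply: ler_wpM2l => //.
  rewrite -powR_mulrn// -powRrM -exprVn -powR_mulrn//; apply: ger_powR => //.
  by rewrite invr_gt0 ltr0n invf_le1 ?ler1n.
have tn0 n : (0 <= (Num.sqrt (sqn (T (e n))) `^ p)%:E)%E by rewrite lee_fin powR_ge0.
apply: (@le_lt_trans _ _ (Q * 2)%:E); last exact: ltry.
apply: lime_le; first exact: is_cvg_nneseries.
apply: nearW => N; rewrite sumEFin lee_fin.
apply: (@le_trans _ _ (\sum_(0 <= n < N) Q * (n.+1%:R ^+ 2)^-1)); first exact: ler_sum.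
rewrite -big_distrr /=; apply: ler_wpM2l => //.
by have := @inv_square_sum R 0 N (leq0n N); rewrite divr1.
Qed.

End SingularNumbers.

Theorem proposition4p2 (R : realType) (Psi : \bar R -> \bar R)
    (phi : cplx R -> cplx R) :
  orlicz_function Psi -> Delta2_up Psi -> analytic_self_map phi ->
  compact_operator (hardy_orlicz_space Psi) (hardy_orlicz_norm Psi)
    (composition_operator phi) ->
  (forall alpha : R, 1 <= alpha ->
     alpha_carleson alpha (pullback_measure phi)) /\
  (forall p : R, 0 < p -> schatten_class p (composition_operator phi)).
Proof.
move=> oPsi D2 sphi Kphi.
have small (alpha : R) := near_set_small oPsi sphi D2 Kphi (alpha := alpha).
split=> [alpha a1|p p0]; first exact: (pullback_alpha_carleson small (lt_le_trans ltr01 a1)).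
have decay := power_mean_decay sphi small.
have [e he] := maximizing_sequence_ex sphi decay.
split; first exact: composition_compact.
exists (fun n => Num.sqrt (sqn (composition_operator phi (e n)))).
by split; [exact: composition_singular_numbers|exact: schatten_sum].
Qed.
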